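(* Let $R_{0,1,1}(z)=\dfrac{{}_2F_1(a,b+1;c+1;z)}{{}_2F_1(a,b;c;z)}$. For any real $a,b,c$ with $-c\notin\mathbb N_0$ there are $\kappa,\lambda\in\mathbb N_0$ such that $\varepsilon R_{0,1,1}\in\mathcal N_\kappa^\lambda$ for a certain $\varepsilon\in\{-1,1\}$. More specifically: (A) If $\{-a,-b-1,a-c-1,b-c\}\cap\mathbb N_0=\varnothing$, put $$\theta_j=\operatorname{sign}\big[(c+2j)\Gamma(a+j)\Gamma(c-b+j)\Gamma(b+j+1)\Gamma(c-a+j+1)\big]\quad (j\ge0),$$ $$\eta_j=\operatorname{sign}\big[(c+2j-1)\Gamma(a+j)\Gamma(c-b+j)\Gamma(b+j)\Gamma(c-a+j)\big]\quad (j\ge1).$$ Then $R_{0,1,1}(z)$ is not rational, and $\varepsilon R_{0,1,1}\in\mathcal N_\kappa^\lambda$ with $\varepsilon=\theta_0$, where $\lambda$ and $\kappa$ are, respectively, the numbers of negative entries in the sequences $(\theta_j)_{j=0}^\infty$ and $(\eta_j)_{j=1}^\infty$. (B) If $\{-a,-b-1,a-c-1,b-c\}\cap\mathbb N_0\ne\varnothing$, put $$s_1=\min\big(\{-a,b-c\}\cap\mathbb N_0\big),\quad s_2=\min\big(\{-b,a-c\}\cap\mathbb N\big),\quad s=\min\{2s_1,2s_2-1\},$$ with $\min(\varnothing)=+\infty$. Then $R_{0,1,1}(z)$ is a rational function of degree $K=\lfloor\frac{s+1}2\rfloor$ satisfying $\varepsilon R_{0,1,1}\in\mathcal N_\kappa^\lambda$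 and $-\varepsilon R_{0,1,1}\in\mathcal N_{K-\kappa}^{\Lambda-\lambda}$, where $\Lambda=\lfloor\frac{s+2}2\rfloor$ equals the degree of $zR_{0,1,1}(z)$, and $\varepsilon,\kappa,\lambda$ are as follows. (B1) If $s=2s_1>0$, put for $j=0,\dots,s_1-1$ and $\delta\in\{0,1\}$ $$\varepsilon_{2j+1+\delta}=\operatorname{sign}\frac{(a+j+\delta)_{s_1-j-\delta}(c-b+j+\delta)_{s_1-j-\delta}(b+j+1)_{s_1-j}(c-a+j+1)_{s_1-j}}{(c+2j+\delta)(c+2s_1)}.$$ Then $\varepsilon=\varepsilon_1$ and $\lambda$ (resp. $\kappa$) is the number of negative entries in the sequence $\varepsilon_1,\varepsilon_3,\dots,\varepsilon_{2s_1-1}$ (resp. $\varepsilon_2,\varepsilon_4,\dots,\varepsilon_{2s_1}$). If $s_1=0$, then $\lambda=\kappa=0$ and $\varepsilon=1$. (B2) If $s=2s_2-1$, put for $j=0,\dots,s_2-1$, $\delta\in\{0,1\}$, $j+\delta\ne0$ $$\varepsilon_{2j+\delta}=\operatorname{sign}\frac{(a+j)_{s_2-j}(c-b+j)_{s_2-j}(b+j+\delta)_{s_2-j-\delta}(c-a+j+\delta)_{s_2-j-\delta}}{(c+2j-1+\delta)(c+2s_2-1)}$$ and $\varepsilon=\varepsilon_1$. If $s_2>1$, then $\lambda$ (resp. $\kappa$) is the number of negative entries in the sequence $\varepsilon_1,\varepsilon_3,\dots,\varepsilon_{2s_2-1}$ (resp. $\varepsilon_2,\varepsilon_4,\dots,\varepsilon_{2s_2-2}$);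 if $s_2=1$, then $\lambda=\frac12-\frac\varepsilon2$ and $\kappa=0$.
   Context: $\mathbb N_0=\{0,1,2,\dots\}$, $\mathbb N=\{1,2,\dots\}$, $\mathbb C_+=\{z:\operatorname{Im}z>0\}$; $(x)_k=x(x+1)\cdots(x+k-1)$, $(x)_0=1$. ${}_2F_1$ is the Gauss hypergeometric function (principal branch in $\mathbb C\setminus[1,+\infty)$). For points $z_1,\dots,z_n\in\mathbb C_+$ that are not poles of $f$, the Pick matrix is $H_f(z_1,\dots,z_n)=\left[\frac{f(z_k)-\overline{f(z_j)}}{z_k-\overline{z_j}}\right]_{k,j=1}^n$. For $\kappa\in\mathbb N_0$, $f\in\mathcal N_\kappa$ means that $f$ is meromorphic in $\mathbb C_+$ (and extended to the lower half-plane by the symmetry $f(\overline z)=\overline{f(z)}$), that $H_f(z_1,\dots,z_n)$ has at most $\kappa$ negative eigenvalues for every $n\in\mathbb N$ and every choice of points, and exactly $\kappa$ for some choice. $f\in\mathcal N_\kappa^\lambda$ means $f\in\mathcal N_\kappa$ and $zf(z)\in\mathcal N_\lambda$. The degree of a rational function is the maximum of the degrees of its numerator and denominator in lowest terms. *)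

(* Defs.v *)
From HB Require Import structures.
From mathcomp Require Import all_boot all_order all_algebra.
From mathcomp Require Import all_classical all_reals all_analysis.
From mathcomp Require Import complex.

Set Implicit Arguments.
Unset Strict Implicit.
Unset Printing Implicit Defensive.

Import Order.TTheory GRing.Theory Num.Theory.
Import numFieldNormedType.Exports.

Local Open Scope classical_set_scope.
Local Open Scope ring_scope.

(* The ascription selects the normed-space topology that every
   numClosedFieldType carries. *)
Definition Cx (R : realType) : numClosedFieldType := R[i].

Definition ofR (R : realType) (x : R) : Cx R := real_complex R x.

Definition upper_half (R : realType) : set (Cx R) :=
  [set z | 0 < complex.Im z].

Definition slit_plane (R : realType) : set (Cx R) :=
  [set z | ~ (complex.Im z = 0 /\ 1 <= complex.Re z)].

(* Weierstrass: locally the sum of a convergent power series. *)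
Definition analytic_at (R : realType) (f : Cx R -> Cx R) (z0 : Cx R) : Prop :=
  exists u : nat -> Cx R,
    \forall z \near z0, series (fun n => u n * (z - z0) ^+ n) @ \oo --> f z.

(* A meromorphic function is represented by a total function whose values at
   its poles are irrelevant: a point is a pole when f is not analytic there. *)
Definition meromorphic_at (R : realType) (f : Cx R -> Cx R) (z0 : Cx R) : Prop :=
  exists (m : nat) (g : Cx R -> Cx R),
    analytic_at g z0 /\ \forall z \near z0^', (z - z0) ^+ m * f z = g z.

Definition pick_matrix (R : realType) (f : Cx R -> Cx R) (n : nat)
    (z : 'I_n -> Cx R) : 'M[Cx R]_n :=
  \matrix_(k, j) ((f (z k) - (f (z j))^*) / (z k - (z j)^*)).

(* Counted with algebraic multiplicity; in the order of Cx R, x < 0 says that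
   x is real and negative. *)
Definition neg_eigenvalues (R : realType) (n : nat) (M : 'M[Cx R]_n) : nat :=
  count (fun x => x < 0) (sval (closed_field_poly_normal (char_poly M))).

Definition admissible (R : realType) (f : Cx R -> Cx R) (n : nat)
    (z : 'I_n -> Cx R) : Prop :=
  forall i, upper_half (z i) /\ analytic_at f (z i).

Definition nevanlinna (R : realType) (kappa : nat) (f : Cx R -> Cx R) : Prop :=
  [/\ forall z, upper_half z -> meromorphic_at f z,
      forall z, upper_half z -> analytic_at f z -> f z^* = (f z)^*,
      forall (n : nat) (z : 'I_n -> Cx R), (0 < n)%N -> admissible f z ->
        (neg_eigenvalues (pick_matrix f z) <= kappa)%N
    & exists (n : nat) (z : 'I_n -> Cx R),
        [/\ (0 < n)%N, admissible f z
          & neg_eigenvalues (pick_matrix f z) = kappa]].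

Definition nevanlinna2 (R : realType) (kappa lambda : nat)
    (f : Cx R -> Cx R) : Prop :=
  nevanlinna kappa f /\ nevanlinna lambda (fun z => z * f z).

Definition poch (R : realType) (x : R) (k : nat) : R :=
  \prod_(i < k) (x + i%:R).

Definition is_hyp2F1 (R : realType) (a b c : R) (F : Cx R -> Cx R) : Prop :=
  (forall z, slit_plane z -> analytic_at F z) /\
  (forall z, `|z| < 1 ->
    series (fun n => ofR (poch a n * poch b n / (poch c n * n`!%:R)) * z ^+ n)
      @ \oo --> F z).

(* The analytic continuation to the slit plane is unique; the values chosen on
   the cut itself are arbitrary. *)
Definition hyp2F1 (R : realType) (a b c : R) : Cx R -> Cx R :=
  xget (fun=> 0) [set F | is_hyp2F1 a b c F].

Definition R011 (R : realType) (a b c : R) (z : Cx R) : Cx R :=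
  hyp2F1 a (b + 1) (c + 1) z / hyp2F1 a b c z.

Definition rational_of_degree (R : realType) (d : nat) (f : Cx R -> Cx R)
    : Prop :=
  exists P Q : {poly Cx R},
    [/\ Q != 0, coprimep P Q, maxn (size P).-1 (size Q).-1 = d
      & forall z, slit_plane z -> Q.[z] != 0 -> f z = P.[z] / Q.[z]].

Definition rational_function (R : realType) (f : Cx R -> Cx R) : Prop :=
  exists d, rational_of_degree d f.

(* The Gauss product, valid for every real x that is not a pole. *)
Definition Gamma_fun (R : realType) (x : R) : R :=
  lim ((fun n : nat => n`!%:R * n%:R `^ x / poch x n.+1) @ \oo).

Definition theta_sign (R : realType) (a b c : R) (j : nat) : R :=
  Num.sg ((c + (2 * j)%:R) * Gamma_fun (a + j%:R) * Gamma_fun (c - b + j%:R)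
          * Gamma_fun (b + j%:R + 1) * Gamma_fun (c - a + j%:R + 1)).

Definition eta_sign (R : realType) (a b c : R) (j : nat) : R :=
  Num.sg ((c + (2 * j)%:R - 1) * Gamma_fun (a + j%:R) * Gamma_fun (c - b + j%:R)
          * Gamma_fun (b + j%:R) * Gamma_fun (c - a + j%:R)).

Definition rational_case (R : realType) (a b c : R) : Prop :=
  exists n : nat, n%:R \in [:: - a; - b - 1; a - c - 1; b - c].

(* Minima of sets of naturals, with value +oo on the empty set. *)
Definition s1_of (R : realType) (a b c : R) : \bar R :=
  ereal_inf [set n%:R%:E | n in [set n : nat | n%:R \in [:: - a; b - c]]].

Definition s2_of (R : realType) (a b c : R) : \bar R :=
  ereal_inf
    [set n%:R%:E | n in [set n : nat | (0 < n)%N /\ n%:R \in [:: - b; a - c]]].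

Definition s_of (R : realType) (a b c : R) : \bar R :=
  Order.min (2%:E * s1_of a b c)%E (2%:E * s2_of a b c - 1%:E)%E.

(* epsB1 a b c s1 j d is the sign with index 2j + 1 + d *)
Definition epsB1 (R : realType) (a b c : R) (s1 j d : nat) : R :=
  Num.sg (poch (a + (j + d)%:R) (s1 - j - d)
          * poch (c - b + (j + d)%:R) (s1 - j - d)
          * poch (b + j%:R + 1) (s1 - j)
          * poch (c - a + j%:R + 1) (s1 - j)
          / ((c + (2 * j + d)%:R) * (c + (2 * s1)%:R))).

(* epsB2 a b c s2 j d is the sign with index 2j + d, for j + d != 0 *)
Definition epsB2 (R : realType) (a b c : R) (s2 j d : nat) : R :=
  Num.sg (poch (a + j%:R) (s2 - j)
          * poch (c - b + j%:R) (s2 - j)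
          * poch (b + (j + d)%:R) (s2 - j - d)
          * poch (c - a + (j + d)%:R) (s2 - j - d)
          / ((c + (2 * j)%:R - 1 + d%:R) * (c + (2 * s2)%:R - 1))).

(* Main.v *)
Require Import Defs.
From HB Require Import structures.
From mathcomp Require Import all_boot all_order all_algebra.
From mathcomp Require Import all_classical all_reals all_analysis.
From mathcomp Require Import complex sesquilinear spectral.
From mathcomp Require Import zify ring lra.

(** Let F_m be the hypergeometric function with third parameter c + m whose
    first two parameters arise from (a, b) by m steps (x, y) |-> (y + 1, x).
    Then R = F_1 / F_0, and Gauss's relation F_m = F_(m+1) - d_m z F_(m+2)
    expands R into the continued fraction 1/(1 - d_0 z/(1 - d_1 z/(1 - ...))).
    Everything in the theorem is read off from the signs of the products
    D_n = d_0 ... d_(n-1).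

    The kernel behind the Pick matrices of z F_(i+1) / F_i is
      L_i(z,w) = (z F_(i+1)(z) F_i(w)^* - F_i(z) (w F_(i+1)(w))^* ) / (z - w^* ),
    and two steps of Gauss's relation peel off a square:
      L_i(z,w) = F_(i+1)(z) F_(i+1)(w)^* + d_i d_(i+1) z w^* L_(i+2)(z,w).
    Iterating gives L_0 = sum_j D_(2j) v_j(z) v_j(w)^* with v_j = z^j F_(2j+1),
    while the kernel of R itself is d_0 L_1, a sum with coefficients D_(2j+1).
    Hence the form of the Pick matrix is nonnegative as soon as the finitely
    many v_j with a negative coefficient are annihilated: this bounds the number
    of negative squares ([sker_bounded]). The bound is attained because every
    step of the iteration can be realized by one more point taken close enough
    to the origin, where z w^* L_(i+2) is small ([attained_step]). Pick matrices
    are congruent to kernel matrices away from the zeros of F_0, and a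
    perturbation of the points covers the zeros ([nevanlinna_of_kernel]).

    The expansion needs the remainder D_(2J) (z w^* )^J L_(2J)(z,w) to vanish in
    the limit on the whole upper half-plane, where F_m must be estimated as m
    grows. The map z = 4w/(1+w)^2 from the unit disc onto the slit plane turns
    F_m into a power series in w. In a weighted l1 norm the normalized series
    (1+w)^(-m) F_m grows at most like (1+eps)^m because 4 d_m tends to 1. Since
    z^J (1+w)^(2J) = (4w)^J, the two functions in the remainder contribute at most
    (4|w|)^J each, up to such factors, and the decay of D_(2J) like 4^(-2J) leaves
    a geometric sequence ([tail_bound]). The same change of
    variable provides the analytic continuation of the hypergeometric series:
    its coefficients in w satisfy a recurrence with all singularities on the
    unit circle, so the series converges in the disc ([ucoef_summable]).

    Up to squares the denominators c + k of D_n telescope, and its numerators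
    are Pochhammer symbols; the Gamma function rewrites them as the signs theta
    and eta. The product D_n vanishes from some n on exactly when a, b, c satisfy
    one of the integrality conditions. In that case F_s, for the first zero d_s,
    is 1 or a power of 1 - z, and R is a ratio of polynomials given by the
    backward recursion, coprime by construction. If no d_m vanishes, a rational
    R is impossible: a relation p F_0 = q F_1 with polynomials p, q produces one
    of smaller degree between F_1 and F_2, and so on ([germ_ratio_descent]). *)

Set Implicit Arguments.
Unset Strict Implicit.
Unset Printing Implicit Defensive.

Import Order.TTheory GRing.Theory Num.Theory.
Import numFieldNormedType.Exports.

Local Open Scope classical_set_scope.
Local Open Scope ring_scope.

(** * Moduli and limits of complex sequences *)

(** Over an abstract field these limits do not unfold the complex numbers. *)
Section SequencesGeneric.
Variables (K : numClosedFieldType) (u v : nat -> K) (l l' : K).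
Hypotheses (hu : u @ \oo --> l) (hv : v @ \oo --> l').

Lemma seq_cvgD : (fun n => u n + v n) @ \oo --> l + l'.
Proof. exact: cvgD. Qed.
Lemma seq_cvgB : (fun n => u n - v n) @ \oo --> l - l'.
Proof. exact: cvgB. Qed.
Lemma seq_cvgM : (fun n => u n * v n) @ \oo --> l * l'.
Proof. exact: cvgM. Qed.
Lemma seq_cvgV : l != 0 -> (fun n => (u n)^-1) @ \oo --> l^-1.
Proof. by move=> l0; apply: cvgV. Qed.
End SequencesGeneric.
Lemma seq_cvg_cst (K : numClosedFieldType) (l : K) : (fun=> l) @ \oo --> l.
Proof. exact: cvg_cst. Qed.
Lemma seq_cvg_unique (K : numClosedFieldType) (u : nat -> K) (l l' : K) :
  u @ \oo --> l -> u @ \oo --> l' -> l = l'.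
Proof. by move=> h1 h2; apply: (cvg_unique _ h1 h2). Qed.

Section Modulus.
Variable R : realType.
Local Notation C := (Cx R).
Implicit Types (x y : R) (z w : C).

(** The norm of [Cx R] has its values in [Cx R]; this is the same number as an
    element of [R], where the estimates take place. *)
Definition modulus z : R := complex.Re `|z|.
Local Notation mo := modulus.

Lemma ofR_additive : {morph @ofR R : x y / x - y}.
Proof. by move=> x y; rewrite /ofR rmorphB. Qed.
Lemma ofR_mult : monoid_morphism (@ofR R).
Proof. by split=> [|x y]; rewrite /ofR ?rmorph1 ?rmorphM. Qed.
HB.instance Definition _ := GRing.isZmodMorphism.Build R C (@ofR R) ofR_additive.
HB.instance Definition _ := GRing.isMonoidMorphism.Build R C (@ofR R) ofR_mult.

Lemma normE z : `|z| = ofR (mo z).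
Proof. by []. Qed.

Lemma le_ofR x y : (ofR x <= ofR y) = (x <= y).
Proof. exact: lecR. Qed.
Lemma lt_ofR x y : (ofR x < ofR y) = (x < y).
Proof. exact: ltcR. Qed.
Lemma ofR_inj : injective (@ofR R).
Proof. by move=> x y []. Qed.

Lemma mo_ge0 z : 0 <= mo z.
Proof. by rewrite -le_ofR -normE rmorph0. Qed.
Lemma moM z w : mo (z * w) = mo z * mo w.
Proof. by apply: ofR_inj; rewrite rmorphM -!normE normrM. Qed.
Lemma moD z w : mo (z + w) <= mo z + mo w.
Proof. by rewrite -le_ofR rmorphD -!normE ler_normD. Qed.
Lemma moN z : mo (- z) = mo z.
Proof. by rewrite /mo normrN. Qed.
Lemma mo0 : mo 0 = 0. Proof. by rewrite /mo normr0. Qed.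
Lemma mo1 : mo 1 = 1. Proof. by rewrite /mo normr1. Qed.
Lemma mo_eq0 z : (mo z == 0) = (z == 0).
Proof. by rewrite -[RHS]normr_eq0 normE -(inj_eq ofR_inj) rmorph0. Qed.
Lemma mo_gt0 z : (0 < mo z) = (z != 0).
Proof. by rewrite lt0r mo_ge0 mo_eq0 andbT. Qed.
Lemma moX z n : mo (z ^+ n) = mo z ^+ n.
Proof. by elim: n => [|n IH]; rewrite ?expr0 ?mo1 // !exprS moM IH. Qed.
Lemma moV z : mo z^-1 = (mo z)^-1.
Proof. by apply: ofR_inj; rewrite fmorphV -!normE normfV. Qed.
Lemma mo_conj z : mo z^* = mo z.
Proof. by apply: ofR_inj; rewrite -!normE norm_conjC. Qed.
Lemma mo_ofR x : mo (ofR x) = `|x|.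
Proof.
case: (ger0P x) => [h|h]; first by rewrite /mo ger0_norm // -(rmorph0 (@ofR R)) le_ofR.
by rewrite /mo ltr0_norm // -(rmorph0 (@ofR R)) lt_ofR.
Qed.
Lemma moB z w : mo (z - w) = mo (w - z).
Proof. by rewrite -moN opprB. Qed.
Lemma moBD z w v : mo (z - v) <= mo (z - w) + mo (w - v).
Proof. by rewrite -[z - v](subrKA w) moD. Qed.
Lemma mo_geB z w : mo z - mo w <= mo (z - w).
Proof. by rewrite lerBlDr -{1}[z](subrK w) moD. Qed.
Lemma mo_geD z w : mo z - mo w <= mo (z + w).
Proof. by rewrite -[w]opprK moN mo_geB. Qed.
Lemma mo_sum I (r : seq I) (P : pred I) (F : I -> C) :
  mo (\sum_(i <- r | P i) F i) <= \sum_(i <- r | P i) mo (F i).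
Proof.
elim/big_rec2: _ => [|i x y _ h]; first by rewrite mo0.
by rewrite (le_trans (moD _ _)) // lerD2l.
Qed.

Lemma Re_ofR x : complex.Re (ofR x) = x. Proof. by []. Qed.
Lemma Im_ofR x : complex.Im (ofR x) = 0. Proof. by []. Qed.
Lemma cReD z w : complex.Re (z + w) = complex.Re z + complex.Re w.
Proof. by case: z; case: w. Qed.
Lemma cImD z w : complex.Im (z + w) = complex.Im z + complex.Im w.
Proof. by case: z; case: w. Qed.
Lemma cReN z : complex.Re (- z) = - complex.Re z. Proof. by case: z. Qed.
Lemma cImN z : complex.Im (- z) = - complex.Im z. Proof. by case: z. Qed.
Lemma cReM z w : complex.Re (z * w) =
  complex.Re z * complex.Re w - complex.Im z * complex.Im w.
Proof. by case: z; case: w. Qed.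
Lemma cImM z w : complex.Im (z * w) =
  complex.Re z * complex.Im w + complex.Im z * complex.Re w.
Proof. by case: z => a b; case: w => c d /=. Qed.
Lemma cRe_conj z : complex.Re (z^*) = complex.Re z. Proof. by case: z. Qed.
Lemma cIm_conj z : complex.Im (z^*) = - complex.Im z. Proof. by case: z. Qed.
Lemma conj_ofR x : (ofR x)^* = ofR x.
Proof. exact: conjc_real. Qed.
Lemma sqr_mo z : mo z ^+ 2 = complex.Re z ^+ 2 + complex.Im z ^+ 2.
Proof.
apply: ofR_inj; transitivity (`|z| ^+ 2); first by rewrite normE rmorphXn.
exact: esym (add_Re2_Im2 z).
Qed.
Lemma Re_le_mo z : `|complex.Re z| <= mo z.
Proof.
rewrite -(@ler_pXn2r _ 2) ?nnegrE ?mo_ge0 // sqr_mo real_normK ?num_real //.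
by rewrite lerDl sqr_ge0.
Qed.
Lemma Im_le_mo z : `|complex.Im z| <= mo z.
Proof.
rewrite -(@ler_pXn2r _ 2) ?nnegrE ?mo_ge0 // sqr_mo real_normK ?num_real //.
by rewrite lerDr sqr_ge0.
Qed.
Lemma mo_le_ReIm z : mo z <= `|complex.Re z| + `|complex.Im z|.
Proof.
rewrite -(@ler_pXn2r _ 2) ?nnegrE ?mo_ge0 ?addr_ge0 // sqr_mo sqrrD !real_normK ?num_real //.
by rewrite -addrA [X in _ <= _ + X]addrC addrA lerDl mulrn_wge0 ?mulr_ge0.
Qed.
Lemma complexP z w : complex.Re z = complex.Re w -> complex.Im z = complex.Im w -> z = w.
Proof. by case: z => a b; case: w => c d /= -> ->. Qed.

Lemma lt_mo z x : (`|z| < ofR x) = (mo z < x).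
Proof. by rewrite normE lt_ofR. Qed.

Lemma gt0_ofR (e : C) : 0 < e -> exists2 x, 0 < x & e = ofR x.
Proof.
case: e => u v h; exists u; move: h; rewrite ltcE /= => /andP[/eqP hv hu] //.
by rewrite hv.
Qed.

Definition tends (u : nat -> C) (l : C) := forall e : R, 0 < e ->
  exists N : nat, forall n, (N <= n)%N -> mo (u n - l) < e.

Lemma cvg_tends u l : (u @ \oo --> l) <-> tends u l.
Proof.
split=> [|h].
  move/cvgrPdistC_lt => h e e0.
  have : 0 < ofR e by rewrite -(rmorph0 (@ofR R)) lt_ofR.
  move=> /h [N _ hN]; exists N => n Nn.
  by rewrite -lt_mo; apply: hN.
apply/cvgrPdistC_lt => e /gt0_ofR[x x0 ->].
have [N hN] := h x x0; exists N => // n /= Nn.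
by rewrite lt_mo; apply: hN.
Qed.

Lemma tends_unique u l l' : tends u l -> tends u l' -> l = l'.
Proof.
move=> /cvg_tends h1 /cvg_tends h2.
exact: seq_cvg_unique h1 h2.
Qed.

Lemma tends_cst l : tends (fun=> l) l.
Proof. by apply/cvg_tends; exact: seq_cvg_cst. Qed.
Lemma tendsD u v l l' : tends u l -> tends v l' -> tends (fun n => u n + v n) (l + l').
Proof. by move=> /cvg_tends h1 /cvg_tends h2; apply/cvg_tends; exact: seq_cvgD. Qed.
Lemma tendsB u v l l' : tends u l -> tends v l' -> tends (fun n => u n - v n) (l - l').
Proof. by move=> /cvg_tends h1 /cvg_tends h2; apply/cvg_tends; exact: seq_cvgB. Qed.
Lemma tendsM u v l l' : tends u l -> tends v l' -> tends (fun n => u n * v n) (l * l').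
Proof. by move=> /cvg_tends h1 /cvg_tends h2; apply/cvg_tends; exact: seq_cvgM. Qed.
Lemma tendsV u l : l != 0 -> tends u l -> tends (fun n => (u n)^-1) l^-1.
Proof. by move=> l0 /cvg_tends h1; apply/cvg_tends; exact: seq_cvgV. Qed.
Lemma tends_conj u l : tends u l -> tends (fun n => (u n)^*) l^*.
Proof.
by move=> h e /h [N hN]; exists N => n /hN; rewrite -rmorphB mo_conj.
Qed.
Lemma tends_eq u v l : u =1 v -> tends u l -> tends v l.
Proof. by move=> /funext ->. Qed.
Lemma tends_shift u l k : tends u l -> tends (fun n => u (n + k)%N) l.
Proof.
by move=> h e /h [N hN]; exists N => n Nn; apply: hN; rewrite (leq_trans Nn) ?leq_addr.
Qed.
Lemma tends_unshift u l k : tends (fun n => u (n + k)%N) l -> tends u l.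
Proof.
move=> h e /h [N hN]; exists (N + k)%N => n Nn.
have := hN (n - k)%N; rewrite subnK ?(leq_trans _ Nn) ?leq_addl //; apply.
by rewrite -(leq_add2r k) subnK ?(leq_trans _ Nn) ?leq_addl.
Qed.
Lemma tends_sum I (r : seq I) (u : I -> nat -> C) (l : I -> C) :
  (forall i, tends (u i) (l i)) -> tends (fun n => \sum_(i <- r) u i n) (\sum_(i <- r) l i).
Proof.
move=> h; elim: r => [|i r IH].
  by rewrite big_nil; apply: (tends_eq _ (tends_cst _)) => n; rewrite big_nil.
rewrite big_cons; apply: (tends_eq _ (tendsD (h i) IH)) => n; by rewrite big_cons.
Qed.
Lemma tends_squeeze (u : nat -> C) (v : nat -> R) l :
  (forall n, mo (u n - l) <= v n) -> v @ \oo --> (0 : R) -> tends u l.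
Proof.
move=> h /cvgrPdist_lt hv e e0; have [N _ hN] := hv e e0; exists N => n Nn.
apply: le_lt_trans (h n) _; have := hN n Nn; rewrite sub0r normrN.
by apply: le_lt_trans; apply: ler_norm.
Qed.

Lemma tends_mo_le u l B : tends u l -> (forall n, mo (u n) <= B) -> mo l <= B.
Proof.
move=> h hB; rewrite leNgt; apply/negP => hl.
have /h [N /(_ N (leqnn _))] : 0 < mo l - B by rewrite subr_gt0.
have := hB N; have := mo_geB l (u N); rewrite moB; lra.
Qed.

(** The real and the imaginary parts are dominated by the modulus, so they form
    absolutely convergent real series. *)
Lemma abs_summable (u : nat -> C) (B : R) :
  (forall N, \sum_(i < N) mo (u i) <= B) ->
  exists l, tends (fun N => \sum_(i < N) u i) l.
Proof.
move=> hB.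
have real_case (v : nat -> R) : (forall i, `|v i| <= mo (u i)) ->
    exists l : R, (fun N => \sum_(i < N) v i) @ \oo --> l.
  move=> hv.
  have h : cvgn (series v).
    apply: normed_cvg.
    have -> : [normed series v] = (fun n => \sum_(i < n) `|v i|).
      by apply/funext => n; rewrite /normed_series_of seriesEnat /= big_mkord.
    apply: nondecreasing_is_cvgn.
      by apply/nondecreasing_seqP => n; rewrite big_ord_recr /= lerDl.
    exists B => _ [n _ <-]; rewrite (le_trans _ (hB n)) //.
    by apply: ler_sum => i _; apply: hv.
  exists (limn (series v)).
  suff -> : (fun N => \sum_(i < N) v i) = series v by [].
  by apply/funext => n; rewrite /series /= big_mkord.
have [a /cvgrPdistC_lt ha] := real_case (fun i => complex.Re (u i)) (fun i => Re_le_mo _).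
have [b /cvgrPdistC_lt hb] := real_case (fun i => complex.Im (u i)) (fun i => Im_le_mo _).
exists (Complex a b : C) => e e0.
have e2 : 0 < e / 2 by rewrite divr_gt0.
have [N1 _ hN1] := ha _ e2; have [N2 _ hN2] := hb _ e2.
exists (maxn N1 N2) => n; rewrite geq_max => /andP[n1 n2].
apply: le_lt_trans (mo_le_ReIm _) _; rewrite [e]splitr.
have hR : complex.Re (\sum_(i < n) u i) = \sum_(i < n) complex.Re (u i).
  by apply: (big_morph (fun z : C => complex.Re z)) => // x y; rewrite cReD.
have hI : complex.Im (\sum_(i < n) u i) = \sum_(i < n) complex.Im (u i).
  by apply: (big_morph (fun z : C => complex.Im z)) => // x y; rewrite cImD.
rewrite cReD cImD cReN cImN hR hI /=; apply: ltrD; first exact: hN1.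
exact: hN2.
Qed.

End Modulus.
Notation mo := modulus.

(** * Power series and analytic functions *)

Section PowerSeries.
Variable R : realType.
Local Notation C := (Cx R).
Implicit Types (r B e x y : R) (u v : nat -> C) (f g : C -> C) (z h : C).

(** Besides convergence to [f] on the closed disc, a bound [B] on the weighted
    l1 norm of the coefficients is recorded. This norm is submultiplicative and
    complete, which makes products and compositions of series routine. *)
Definition pser r B u f :=
  (forall N, \sum_(i < N) mo (u i) * r ^+ i <= B) /\
  (forall h, mo h <= r -> tends (fun N => \sum_(i < N) u i * h ^+ i) (f h)).

Lemma pow_le x y n : 0 <= x -> x <= y -> x ^+ n <= y ^+ n :> R.
Proof. by move=> x0 xy; apply: lerXn2r; rewrite // nnegrE // (le_trans x0). Qed.

Lemma tends_mo u (l : C) : tends u l -> tends (fun n => ofR (mo (u n))) (ofR (mo l)).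
Proof.
move=> hu e /hu [N hN]; exists N => n /hN; apply: le_lt_trans.
rewrite -rmorphB mo_ofR ler_norml.
have := mo_geB (u n) l; have := mo_geB l (u n); rewrite (moB l) => h1 h2.
by apply/andP; split; lra.
Qed.

(** Otherwise disjoint blocks of sum larger than [e] could be collected until
    they exceed [S]. *)
Lemma bounded_sum_tail (b : nat -> R) (S e : R) : 0 < e -> (forall k, 0 <= b k) ->
  (forall K, \sum_(k < K) b k <= S) ->
  exists K, forall j, \sum_(k < j) b (K + k)%N <= e.
Proof.
move=> e0 b0 hS; apply: contrapT => hn.
have step K : exists j, e < \sum_(k < j) b (K + k)%N.
  apply: contrapT => hj; apply: hn; exists K => j; rewrite leNgt; apply/negP => h.
  by apply: hj; exists j.
have many n : exists K, n%:R * e <= \sum_(k < K) b k.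
  elim: n => [|n [K hK]]; first by exists 0%N; rewrite big_ord0 mul0r.
  have [j hj] := step K; exists (K + j)%N; rewrite big_split_ord /= -natr1 mulrDl mul1r.
  by apply: lerD hK (ltW hj).
have [K hK] := many (Num.truncn (S / e)).+1.
have : S / e < (Num.truncn (S / e)).+1%:R by exact: truncnS_gt.
by rewrite ltr_pdivrMr // => /lt_le_trans /(_ hK) /lt_le_trans /(_ (hS K)); rewrite ltxx.
Qed.

Lemma pser_bound_ge0 r B u f : pser r B u f -> 0 <= B.
Proof. by case=> /(_ 0%N); rewrite big_ord0. Qed.

Lemma pser_val_le r B u f h : pser r B u f -> mo h <= r -> mo (f h) <= B.
Proof.
case=> hB hf hr; apply: tends_mo_le (hf h hr) _ => n.
apply: le_trans (mo_sum _ _ _) (le_trans _ (hB n)); apply: ler_sum => i _.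
by rewrite moM moX ler_wpM2l ?mo_ge0 // pow_le ?mo_ge0.
Qed.

Section SeriesClosure.
Variables (r S : R) (u : nat -> nat -> C) (b : nat -> R) (U : nat -> C).
Hypotheses (r0 : 0 < r) (hb : forall k N, \sum_(i < N) mo (u k i) * r ^+ i <= b k)
  (hS : forall K, \sum_(k < K) b k <= S)
  (hU : forall n, tends (fun K => \sum_(k < K) u k n) (U n)).

Lemma series_norm_le N : \sum_(i < N) mo (U i) * r ^+ i <= S.
Proof.
have pos : 0 <= \sum_(i < N) mo (U i) * r ^+ i.
  by apply: sumr_ge0 => i _; rewrite mulr_ge0 ?mo_ge0 ?exprn_ge0 ?ltW.
rewrite -[leLHS]ger0_norm // -mo_ofR.
have h : tends (fun K => \sum_(i < N) ofR (mo (\sum_(k < K) u k i)) * ofR (r ^+ i))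
    (\sum_(i < N) ofR (mo (U i)) * ofR (r ^+ i)).
  by apply: tends_sum => i; apply: tendsM (tends_cst _); apply: tends_mo.
rewrite rmorph_sum; under eq_bigr do rewrite rmorphM.
apply: tends_mo_le h _ => K; apply: le_trans (mo_sum _ _ _) _.
apply: le_trans (hS K).
apply: (@le_trans _ _ (\sum_(i < N) \sum_(k < K) mo (u k i) * r ^+ i)).
  apply: ler_sum => i _; rewrite -rmorphM mo_ofR ger0_norm; last first.
    by rewrite mulr_ge0 ?mo_ge0 ?exprn_ge0 ?ltW.
  rewrite -mulr_suml; apply: ler_wpM2r; first by rewrite exprn_ge0 ?ltW.
  exact: mo_sum.
by rewrite exchange_big /=; apply: ler_sum => k _; apply: hb.
Qed.
End SeriesClosure.

(** Completeness of the weighted l1 norm. Products and compositions are both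
    obtained from it, as normally convergent sums of series. *)
Lemma pser_series r (S : R) (u : nat -> nat -> C) (b : nat -> R) (U : nat -> C)
    (f : nat -> C -> C) (F : C -> C) : 0 < r ->
  (forall k, pser r (b k) (u k) (f k)) ->
  (forall K, \sum_(k < K) b k <= S) ->
  (forall n, tends (fun K => \sum_(k < K) u k n) (U n)) ->
  (forall h, mo h <= r -> tends (fun K => \sum_(k < K) f k h) (F h)) ->
  pser r S U F.
Proof.
move=> r0 hf hS hU hF.
have hb k N := (hf k).1 N.
have b0 k := pser_bound_ge0 (hf k).
split; first exact: (series_norm_le r0 hb hS hU).
move=> h hr e e0.
(* One third for the tail of the coefficients, one for the tail of the values, one for the finite sum of series. *)
have e3 : 0 < e / 3 by rewrite divr_gt0.
have [K hK] := bounded_sum_tail e3 b0 hS.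
have tailU N : \sum_(i < N) mo (U i - \sum_(k < K) u k i) * r ^+ i <= e / 3.
  apply: (@series_norm_le r _ (fun k => u (K + k)%N) (fun k => b (K + k)%N)
    (fun n => U n - \sum_(k < K) u k n)) => //.
  move=> n; apply: (tends_eq (u := fun j => \sum_(k < j + K) u k n - \sum_(k < K) u k n)).
    by move=> j /=; rewrite [in LHS]addnC big_split_ord /= addrAC subrr add0r.
  apply: tendsB (tends_cst _).
  exact: (tends_shift (u := fun K => \sum_(k < K) u k n) K (hU n)).
have tailF : mo (F h - \sum_(k < K) f k h) <= e / 3.
  have h1 : tends (fun j => \sum_(k < j + K) f k h - \sum_(k < K) f k h)
      (F h - \sum_(k < K) f k h).
    apply: tendsB (tends_cst _).
    exact: (tends_shift (u := fun K => \sum_(k < K) f k h) K (hF h hr)).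
  apply: tends_mo_le h1 _ => j; rewrite addnC big_split_ord /= addrAC subrr add0r.
  apply: le_trans (mo_sum _ _ _) (le_trans _ (hK j)); apply: ler_sum => k _.
  exact: pser_val_le (hf _) hr.
have : tends (fun N => \sum_(k < K) \sum_(i < N) u k i * h ^+ i) (\sum_(k < K) f k h).
  by apply: tends_sum => k; apply: (hf k).2.
move=> /(_ _ e3) [N hN]; exists N => n Nn.
have -> : \sum_(i < n) U i * h ^+ i - F h =
  \sum_(i < n) (U i - \sum_(k < K) u k i) * h ^+ i +
  ((\sum_(k < K) \sum_(i < n) u k i * h ^+ i - \sum_(k < K) f k h) -
   (F h - \sum_(k < K) f k h)).
  have -> : \sum_(i < n) (U i - \sum_(k < K) u k i) * h ^+ i =
     \sum_(i < n) U i * h ^+ i - \sum_(k < K) \sum_(i < n) u k i * h ^+ i.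
    rewrite exchange_big /= -sumrB; apply: eq_bigr => i _.
    by rewrite mulrBl mulr_suml.
  ring.
apply: le_lt_trans (moD _ _) _.
apply: (@lt_le_trans _ _ (e / 3 + (e / 3 + e / 3))); last by lra.
apply: ler_ltD.
  apply: le_trans (mo_sum _ _ _) (le_trans _ (tailU n)); apply: ler_sum => i _.
  by rewrite moM moX ler_wpM2l ?mo_ge0 // pow_le ?mo_ge0.
apply: le_lt_trans (moD _ _) _; rewrite moN; apply: ltr_leD => //.
exact: hN.
Qed.

(** Each coefficient of the sum is an absolutely convergent series, being
    dominated by the norms. *)
Lemma pser_series_ex r (S : R) (u : nat -> nat -> C) (b : nat -> R)
    (f : nat -> C -> C) (F : C -> C) : 0 < r ->
  (forall k, pser r (b k) (u k) (f k)) ->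
  (forall K, \sum_(k < K) b k <= S) ->
  (forall h, mo h <= r -> tends (fun K => \sum_(k < K) f k h) (F h)) ->
  exists U, pser r S U F.
Proof.
move=> r0 hf hS hF.
have hU n : exists l, tends (fun K => \sum_(k < K) u k n) l.
  apply: (@abs_summable _ (fun k => u k n) (S / r ^+ n)) => K.
  rewrite ler_pdivlMr ?exprn_gt0 // mulr_suml; apply: le_trans (hS K).
  apply: ler_sum => k _; apply: le_trans ((hf k).1 n.+1).
  rewrite big_ord_recr /= lerDr; apply: sumr_ge0 => i _.
  by rewrite mulr_ge0 ?mo_ge0 ?exprn_ge0 ?ltW.
have [U hU'] := choice hU.
exists U; exact: pser_series r0 hf hS hU' hF.
Qed.

Lemma pser_eq r B u f g : (forall h, mo h <= r -> f h = g h) ->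
  pser r B u f -> pser r B u g.
Proof. by move=> fg [h1 h2]; split=> // h hr; rewrite -fg //; apply: h2. Qed.

Lemma pser_shrink r r' B u f : 0 <= r' -> r' <= r -> pser r B u f -> pser r' B u f.
Proof.
move=> r0 rr [h1 h2]; split=> [N|h hr]; last by apply: h2; apply: le_trans hr rr.
apply: le_trans (h1 N); apply: ler_sum => i _; rewrite ler_wpM2l ?mo_ge0 //.
by rewrite pow_le.
Qed.

Lemma pser_cst r (c : C) : pser r (mo c) (fun n => if n == 0%N then c else 0) (fun=> c).
Proof.
have E h N : \sum_(i < N.+1) (if (i : nat) == 0%N then c else 0) * h ^+ i = c.
  rewrite big_ord_recl /= expr0 mulr1 big1 ?addr0 // => i _.
  by rewrite mul0r.
split=> [[|N]|h _].
- by rewrite big_ord0 mo_ge0.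
- rewrite big_ord_recl /= expr0 mulr1 big1 ?addr0 // => i _.
  by rewrite mo0 mul0r.
- by move=> e e0; exists 1%N => [[|n]] // _; rewrite E subrr mo0.
Qed.

Lemma pser_add r B B' u v f g : pser r B u f -> pser r B' v g -> 0 <= r ->
  pser r (B + B') (fun n => u n + v n) (fun h => f h + g h).
Proof.
move=> [h1 h2] [h3 h4] r0; split=> [N|h hr].
  apply: le_trans (lerD (h1 N) (h3 N)); rewrite -big_split; apply: ler_sum => i _ /=.
  by rewrite -mulrDl ler_wpM2r ?exprn_ge0 // moD.
apply: (tends_eq _ (tendsD (h2 h hr) (h4 h hr))) => N.
by rewrite -big_split; apply: eq_bigr => i _ /=; rewrite mulrDl.
Qed.

Lemma pser_scale r B u f (c : C) : pser r B u f ->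
  pser r (mo c * B) (fun n => c * u n) (fun h => c * f h).
Proof.
move=> [h1 h2]; split=> [N|h hr].
  under eq_bigr do rewrite moM -mulrA.
  by rewrite -mulr_sumr ler_wpM2l ?mo_ge0 // h1.
apply: (tends_eq _ (tendsM (tends_cst c) (h2 h hr))) => N.
by rewrite mulr_sumr; apply: eq_bigr => i _; rewrite mulrA.
Qed.

Definition shiftS u n := if n is n'.+1 then u n' else 0.

Lemma pser_shift r B u f : pser r B u f -> 0 <= r ->
  pser r (r * B) (shiftS u) (fun h => h * f h).
Proof.
move=> [h1 h2] r0; split=> [[|N]|h hr].
- by rewrite big_ord0 mulr_ge0 // (pser_bound_ge0 (conj h1 h2)).
- rewrite big_ord_recl /= mo0 mul0r add0r.
  under eq_bigr do rewrite /bump /= add1n exprS mulrCA.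
  by rewrite -mulr_sumr ler_wpM2l // h1.
- apply: (@tends_unshift _ _ _ 1).
  apply: (tends_eq _ (tendsM (tends_cst h) (h2 h hr))) => N.
  rewrite addn1 big_ord_recl /= mul0r add0r mulr_sumr; apply: eq_bigr => i _.
  by rewrite /bump /= add1n exprS mulrCA.
Qed.

Lemma pser_monom_coef r B u f k : pser r B u f -> 0 <= r ->
  pser r (r ^+ k * B) (fun n => if (k <= n)%N then u (n - k)%N else 0)
    (fun h => h ^+ k * f h).
Proof.
move=> hf r0; elim: k => [|k IH].
  rewrite expr0 mul1r (_ : (fun n => _) = u); last by apply/funext => n; rewrite subn0.
  by apply: pser_eq hf => h _; rewrite expr0 mul1r.
rewrite (_ : (fun n => _) = shiftS (fun n => if (k <= n)%N then u (n - k)%N else 0)).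
  by rewrite exprS -mulrA; apply: pser_eq (pser_shift IH r0) => h _; rewrite exprS mulrA.
by apply/funext => -[|n].
Qed.

Lemma tends_eventually u (l : C) N : (forall n, (N <= n)%N -> u n = l) -> tends u l.
Proof. by move=> h e e0; exists N => n /h ->; rewrite subrr mo0. Qed.

(** The Cauchy product is the normally convergent sum of the u_k h^k g(h). *)
Lemma pser_mul_coef r B B' u v f g : 0 < r -> pser r B u f -> pser r B' v g ->
  pser r (B * B') (fun n => \sum_(k < n.+1) u k * v (n - k)%N) (fun h => f h * g h).
Proof.
move=> r0 hf hg.
have hk k := pser_scale (u k) (pser_monom_coef k hg (ltW r0)).
apply: (pser_series r0 hk).
- move=> K; under eq_bigr do rewrite mulrA.
  by rewrite -mulr_suml ler_wpM2r ?(pser_bound_ge0 hg) // hf.1.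
- move=> n; apply: (@tends_eventually _ _ n.+1) => K nK.
  rewrite -(subnKC nK) big_split_ord /= [X in _ + X]big1 ?addr0.
    by apply: eq_bigr => k _; rewrite -ltnS ltn_ord.
  by move=> k _; rewrite leqNgt addSn ltnS leq_addr mulr0.
- move=> h hr; apply: (tends_eq _ (tendsM (hf.2 h hr) (tends_cst (g h)))) => K.
  by rewrite mulr_suml; apply: eq_bigr => i _; rewrite mulrA.
Qed.

Lemma pser_pow r B u f k : 0 < r -> pser r B u f ->
  exists U, pser r (B ^+ k) U (fun h => f h ^+ k).
Proof.
move=> r0 hf; elim: k => [|k [v hv]].
  eexists; rewrite expr0 -(mo1 R).
  exact: pser_cst.
eexists; rewrite exprS; apply: pser_eq (pser_mul_coef r0 hf hv) => h _.
by rewrite exprS.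
Qed.

(** The norm of [f] is at most the radius on which [g] is summable, so the u_k f^k
    form a normally convergent sum. *)
Lemma pser_comp r rho B u v f g : 0 < r -> pser rho B u g -> pser r rho v f ->
  exists U, pser r B U (fun h => g (f h)).
Proof.
move=> r0 hg hf.
have hk k : exists w, pser r (mo (u k) * rho ^+ k) w (fun h => u k * f h ^+ k).
  have [w hw] := pser_pow k r0 hf.
  by exists (fun n => u k * w n); apply: pser_scale.
have [w hw] := choice hk.
apply: (pser_series_ex r0 hw); first exact: hg.1.
by move=> h hr; apply: hg.2; apply: pser_val_le hf hr.
Qed.

Lemma pser_id r : 0 <= r ->
  pser r r (shiftS (fun n => if n == 0%N then 1 else 0)) (fun h => h).
Proof.
move=> r0; have := pser_shift (pser_cst r 1) r0; rewrite mo1 mulr1.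
by apply: pser_eq => h _; rewrite mulr1.
Qed.

Lemma pser_at0 r B u f : 0 <= r -> pser r B u f -> f 0 = u 0%N.
Proof.
move=> r0 [_ /(_ 0)]; rewrite mo0 => /(_ r0) h; apply: tends_unique h _.
move=> e e0; exists 1%N => [[|n]] // _.
by rewrite big_ord_recl /= expr0 mulr1 big1 ?addr0 ?subrr ?mo0 // => i _; rewrite /bump expr0n mulr0.
Qed.

(** Shrinking the disc brings the norm down to the modulus at the centre. *)
Lemma pser_small r B u f e : 0 < r -> 0 < e -> pser r B u f ->
  exists2 r', 0 < r' <= r & pser r' (mo (f 0) + e) u f.
Proof.
move=> r0 e0 hf.
have B0 := pser_bound_ge0 hf.
have [q [q0 q1 qB]] : exists q, [/\ 0 < q, q <= 1 & q * B <= e].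
  have Be : 0 < B + e by rewrite ltr_wpDl.
  exists (e / (B + e)); split; first by rewrite divr_gt0.
    by rewrite ler_pdivrMr // mul1r lerDr.
  by rewrite mulrAC ler_pdivrMr // ler_pM2l // lerDl ltW.
have r'0 : 0 < r * q by rewrite mulr_gt0.
have r'r : r * q <= r by rewrite ger_pMr.
exists (r * q); first by rewrite r'0.
split; last by case: (pser_shrink (ltW r'0) r'r hf).
have f0 := pser_at0 (ltW r0) hf.
case=> [|N]; first by rewrite big_ord0 addr_ge0 ?mo_ge0 ?ltW.
rewrite big_ord_recl /= expr0 mulr1 f0 lerD2l; apply: le_trans qB.
apply: (@le_trans _ _ (q * \sum_(i < N.+1) mo (u i) * r ^+ i)); last first.
  by rewrite ler_wpM2l ?hf.1 // ltW.
rewrite big_ord_recl /= mulrDr mulr_sumr; apply: ler_wpDl.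
  by rewrite expr0 mulr1 mulr_ge0 ?mo_ge0 // ltW.
apply: ler_sum => i _; rewrite /bump /= add1n mulrCA ler_wpM2l ?mo_ge0 //.
rewrite exprMn mulrC ler_wpM2r ?exprn_ge0 ?(ltW r0) //.
rewrite exprS ger_pMr //.
by apply: exprn_ile1 => //; rewrite ltW.
Qed.

(** Division by the variable multiplies the norm by at most 1/r. *)
Lemma pser_tail r B u f : 0 < r -> pser r B u f ->
  exists2 g, pser r (B / r) (fun n => u n.+1) g & forall h, mo h <= r -> f h = u 0%N + h * g h.
Proof.
move=> r0 hf; have f0 := pser_at0 (ltW r0) hf.
exists (fun h => if h == 0 then u 1%N else (f h - u 0%N) / h); last first.
  move=> h hr; case: eqP => [->|/eqP h0]; first by rewrite mul0r addr0.
  by rewrite mulrCA divff // mulr1 addrC subrK.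
split=> [N|h hr].
  rewrite ler_pdivlMr //; apply: le_trans (hf.1 N.+1); rewrite mulr_suml.
  rewrite big_ord_recl /= ler_wpDl //.
    by rewrite mulr_ge0 ?mo_ge0 ?expr0.
  by apply: ler_sum => i _; rewrite /bump /= add1n exprSr mulrA.
case: eqP => [->|/eqP h0].
  move=> e e0; exists 1%N => [[|n]] // _.
  by rewrite big_ord_recl /= expr0 mulr1 big1 ?addr0 ?subrr ?mo0 // => i _; rewrite /bump expr0n mulr0.
have := tends_shift 1 (hf.2 h hr).
move=> /tendsB /(_ (tends_cst (u 0%N))) /tendsM /(_ (tends_cst h^-1)).
apply: tends_eq => N; rewrite addn1 big_ord_recl /= expr0 mulr1 addrC addKr mulr_suml.
by apply: eq_bigr => i _; rewrite /bump /= add1n exprSr mulrA mulfK.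
Qed.

(** Division by the variable is repeated as long as the constant term vanishes. *)
Lemma pser_order r B u f m : 0 < r -> pser r B u f -> (forall i, (i < m)%N -> u i = 0) ->
  exists B' g, pser r B' (fun n => u (n + m)%N) g /\ forall h, mo h <= r -> f h = h ^+ m * g h.
Proof.
move=> r0 hf; elim: m => [|m IH] hm.
  exists B, f; split; last by move=> h _; rewrite expr0 mul1r.
  by rewrite (_ : (fun n => u (n + 0)%N) = u) //; apply/funext => n; rewrite addn0.
have [|B' [g [hg fg]]] := IH; first by move=> i im; apply: hm; apply: ltnW.
have [g' hg' gg'] := pser_tail r0 hg.
exists (B' / r), g'; split.
  rewrite (_ : (fun n => u (n + m.+1)%N) = (fun n => u (n.+1 + m)%N)) //.
  by apply/funext => n; rewrite addnS addSn.
by move=> h hr; rewrite fg // gg' // hm // add0r exprSr mulrA.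
Qed.

Lemma pser_dichotomy r B u f : 0 < r -> pser r B u f ->
  (forall h, mo h <= r -> f h = 0) \/
  exists m B' v g, [/\ pser r B' v g, v 0%N != 0 & forall h, mo h <= r -> f h = h ^+ m * g h].
Proof.
move=> r0 hf; case: (pselect (exists i, u i != 0)) => [ex|no]; last first.
  left=> h hr; apply: tends_unique (hf.2 h hr) _.
  apply: (tends_eq _ (tends_cst 0)) => N; rewrite big1 // => i _.
  by case: (eqVneq (u i) 0) => [->|ui]; rewrite ?mul0r //; case: no; exists i.
right; have [m um hm] := ex_minnP ex.
have [|B' [g [hg fg]]] := @pser_order r B u f m r0 hf.
  by move=> i; rewrite ltnNge; case: (eqVneq (u i) 0) => // /hm ->.
by exists m, B', (fun n => u (n + m)%N), g.
Qed.

Definition ana f z0 := exists r B u, 0 < r /\ pser r B u (fun h => f (z0 + h)).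

Lemma near_mo (P : C -> Prop) z0 : (\forall z \near z0, P z) <->
  exists2 e, 0 < e & forall h, mo h < e -> P (z0 + h).
Proof.
split.
  move/nbhs_ballP => [e /= /gt0_ofR [x x0 ->] he]; exists x => // h hx; apply: he.
  by rewrite -ball_normE /ball_ /= opprD addNKr normrN lt_mo.
move=> [e e0 he]; apply/nbhs_ballP; exists (ofR e) => /=.
  by rewrite -(rmorph0 (@ofR R)) lt_ofR.
move=> z; rewrite -ball_normE /ball_ /= lt_mo => hz.
by rewrite -[z](subrK z0) addrC; apply: he; rewrite moB.
Qed.

Lemma geometric_sum_le (x : R) N : 0 <= x -> x < 1 -> \sum_(i < N) x ^+ i <= (1 - x)^-1.
Proof.
move=> x0 x1; have y0 : 0 < 1 - x by rewrite subr_gt0.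
rewrite -[leRHS]mul1r ler_pdivlMr //.
suff -> : (\sum_(i < N) x ^+ i) * (1 - x) = 1 - x ^+ N by rewrite gerBl exprn_ge0.
elim: N => [|N IH]; first by rewrite big_ord0 mul0r expr0 subrr.
by rewrite big_ord_recr /= mulrDl IH exprS; ring.
Qed.

(** Convergence at one point off the centre bounds the terms there; comparison with a
    geometric series makes the norm finite on the disc of half the radius. *)
Lemma anaP f z0 : analytic_at f z0 <-> ana f z0.
Proof.
split.
  move=> [u /near_mo [e e0 hu]].
  have sE z : tends (fun N => \sum_(i < N) u i * (z - z0) ^+ i) (f z) <->
     series (fun n => u n * (z - z0) ^+ n) @ \oo --> f z.
    rewrite (_ : series _ = fun N => \sum_(i < N) u i * (z - z0) ^+ i).
      by split=> /cvg_tends.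
    by apply/funext => N; rewrite /series /= big_mkord.
  pose p := e / 2; have p0 : 0 < p by rewrite divr_gt0.
  have mp : mo (ofR p) = p by rewrite mo_ofR ger0_norm // ltW.
  have pe : p < e by rewrite ltr_pdivrMr // ltr_pMr // ltr1n.
  have : tends (fun N => \sum_(i < N) u i * (ofR p) ^+ i) (f (z0 + ofR p)).
    have := hu (ofR p); rewrite mp => /(_ pe) /sE; apply: tends_eq => N.
    by apply: eq_bigr => i _; rewrite addrC addKr.
  move=> hc; have [N hN] := hc 1 ltr01.
  pose M := 2 + \sum_(i < N) mo (u i) * p ^+ i.
  have M0 : 0 <= M by rewrite addr_ge0 // sumr_ge0 // => i _; rewrite mulr_ge0 ?mo_ge0 ?exprn_ge0 ?ltW.
  have bu i : mo (u i) * p ^+ i <= M.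
    case: (leqP N i) => iN; last first.
      rewrite /M (bigD1 (Ordinal iN)) //= addrCA lerDl addr_ge0 //.
      by rewrite sumr_ge0 // => j _; rewrite mulr_ge0 ?mo_ge0 ?exprn_ge0 ?ltW.
    have h1 := hN i iN; have h2 := hN i.+1 (leqW iN).
    apply: (@le_trans _ _ 2); last first.
      by rewrite lerDl sumr_ge0 // => j _; rewrite mulr_ge0 ?mo_ge0 ?exprn_ge0 ?ltW.
    have -> : mo (u i) * p ^+ i = mo (u i * (ofR p) ^+ i) by rewrite moM moX mp.
    rewrite big_ord_recr /= in h2.
    have := moBD (u i * ofR p ^+ i) (f (z0 + ofR p) - \sum_(j < i) u j * ofR p ^+ j) 0.
    rewrite !subr0 (moB (f _)) opprB addrA [_ + \sum_(j < i) _]addrC; lra.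
  exists (p / 2), (2 * M), u; split; first by rewrite divr_gt0.
  split=> [K|h hp].
    apply: (@le_trans _ _ (\sum_(i < K) M * (1 / 2) ^+ i)).
      apply: ler_sum => i _; rewrite mul1r exprMn mulrA; apply: ler_wpM2r; last exact: bu.
      by rewrite exprn_ge0 // invr_ge0.
    rewrite -mulr_sumr mulrC ler_wpM2r //.
    have E : (1 - 1 / 2)^-1 = 2 :> R by field.
    by rewrite -[leRHS]E; apply: geometric_sum_le; lra.
  have := hu h; have -> : mo h < e by apply: le_lt_trans hp _; rewrite /p; lra.
  by move=> /(_ isT) /sE; apply: tends_eq => n; apply: eq_bigr => i _; rewrite addrC addKr.
move=> [r [B [u [r0 hu]]]]; exists u; apply/near_mo; exists r => // h hr.
have := hu.2 h (ltW hr) => /cvg_tends.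
rewrite (_ : series _ = fun N => \sum_(i < N) u i * h ^+ i) //.
by apply/funext => N; rewrite /series /= big_mkord; apply: eq_bigr => i _; rewrite addrC addKr.
Qed.

End PowerSeries.

(** * Operations on analytic functions and the identity theorem *)

Section Analytic.
Variable R : realType.
Local Notation C := (Cx R).
Implicit Types (r B e x y : R) (u v : nat -> C) (f g : C -> C) (z h : C).

Lemma ana_near f g z0 : (exists2 e, 0 < e & forall h, mo h < e -> f (z0 + h) = g (z0 + h)) ->
  ana f z0 -> ana g z0.
Proof.
move=> [e e0 fg] [r [B [u [r0 hf]]]].
have s0 : 0 < Num.min r (e / 2) by rewrite lt_min r0 divr_gt0.
exists (Num.min r (e / 2)), B, u; split=> //.
apply: (pser_eq (f := fun h => f (z0 + h))).
  move=> h; rewrite le_min => /andP[_ he]; apply: fg; apply: le_lt_trans he _.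
  by rewrite ltr_pdivrMr // ltr_pMr // ltr1n.
by apply: pser_shrink (ltW s0) _ hf; rewrite ge_min lexx.
Qed.

Lemma ana_ext f g z0 : (forall z, f z = g z) -> ana f z0 -> ana g z0.
Proof. by move=> fg; apply: ana_near; exists 1 => // h _. Qed.

Lemma ana_pair f g z0 : ana f z0 -> ana g z0 -> exists r B u B' v,
  [/\ 0 < r, pser r B u (fun h => f (z0 + h)) & pser r B' v (fun h => g (z0 + h))].
Proof.
move=> [r [B [u [r0 hf]]]] [r' [B' [v [r'0 hg]]]].
have s0 : 0 < Num.min r r' by rewrite lt_min r0.
exists (Num.min r r'), B, u, B', v; split=> //.
  by apply: pser_shrink (ltW s0) _ hf; rewrite ge_min lexx.
by apply: pser_shrink (ltW s0) _ hg; rewrite ge_min lexx orbT.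
Qed.

Lemma ana_cst (c : C) z0 : ana (fun=> c) z0.
Proof. by exists 1, (mo c), (fun n => if n == 0%N then c else 0); split=> //; apply: pser_cst. Qed.

Lemma anaD f g z0 : ana f z0 -> ana g z0 -> ana (fun z => f z + g z) z0.
Proof.
move=> /ana_pair h /h [r [B [u [B' [v [r0 hf hg]]]]]].
by do 3 eexists; split; [exact: r0|exact: (pser_add hf hg (ltW r0))].
Qed.

Lemma anaM f g z0 : ana f z0 -> ana g z0 -> ana (fun z => f z * g z) z0.
Proof.
move=> /ana_pair h /h [r [B [u [B' [v [r0 hf hg]]]]]].
by do 3 eexists; split; [exact: r0|exact: (pser_mul_coef r0 hf hg)].
Qed.

Lemma ana_id z0 : ana (fun z => z) z0.
Proof.
have h := pser_add (pser_cst 1 z0) (pser_id (@ler01 R)) (@ler01 R).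
by do 3 eexists; split; [exact: ltr01|exact: h].
Qed.

Lemma anaB f g z0 : ana f z0 -> ana g z0 -> ana (fun z => f z - g z) z0.
Proof.
move=> hf hg; apply: (@ana_ext (fun z => f z + (-1) * g z)).
  by move=> z; rewrite mulN1r.
by apply: anaD hf (anaM (ana_cst _ _) hg).
Qed.

(** On a small disc the norm of [f] is close to the modulus of its value at the
    centre, so only that value has to lie in the disc of [g]. *)
Lemma ana_powerseries rho B u g f z0 : ana f z0 -> pser rho B u g -> mo (f z0) < rho ->
  ana (fun z => g (f z)) z0.
Proof.
move=> [r [B' [v [r0 hf]]]] hg h0.
have e0 : 0 < rho - mo (f z0) by rewrite subr_gt0.
have [r' /andP[r'0 r'r] hf'] := pser_small r0 e0 hf.
rewrite addr0 addrC subrK in hf'.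
by have [U hU] := pser_comp r'0 hg hf'; do 3 eexists; split; [exact: r'0|exact: hU].
Qed.

Lemma tends_geometric z : mo z < 1 -> tends (fun N => \sum_(i < N) z ^+ i) (1 - z)^-1.
Proof.
move=> z1.
have n0 : 1 - z != 0.
  by apply/eqP => h; move: z1; rewrite (_ : z = 1) ?mo1 ?ltxx // -[z](subKr 1) h subr0.
have m0 : 0 < mo (1 - z) by rewrite mo_gt0.
apply: (@tends_squeeze _ _ (fun N => (mo (1 - z))^-1 * mo z ^+ N)); last first.
  rewrite -[0](mulr0 (mo (1 - z))^-1); apply: cvgMr; apply: cvg_expr.
  by rewrite ger0_norm ?mo_ge0.
move=> N; suff -> : \sum_(i < N) z ^+ i - (1 - z)^-1 = - ((1 - z)^-1 * z ^+ N).
  by rewrite moN moM moV moX.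
apply: (mulfI n0); rewrite mulrBr mulrN mulrA divff // mul1r.
elim: N => [|N IH]; first by rewrite big_ord0 mulr0 expr0 sub0r.
by rewrite big_ord_recr /= mulrDr addrAC IH exprS; ring.
Qed.

Lemma pser_geometric rho : 0 <= rho -> rho < 1 ->
  pser rho (1 - rho)^-1 (fun=> 1) (fun z : C => (1 - z)^-1).
Proof.
move=> r0 r1; split=> [N|h hr].
  by under eq_bigr do rewrite mo1 mul1r; apply: geometric_sum_le.
apply: tends_eq (tends_geometric (le_lt_trans hr r1)) => N.
by apply: eq_bigr => i _; rewrite mul1r.
Qed.

(** Up to a constant, 1/f is the geometric series 1/(1-t) at t = 1 - f/f(z0). *)
Lemma ana_inv f z0 : ana f z0 -> f z0 != 0 -> ana (fun z => (f z)^-1) z0.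
Proof.
move=> hf f0; set c := f z0.
apply: (@ana_ext (fun z => c^-1 * (1 - (1 - c^-1 * f z))^-1)).
  by move=> z; rewrite subKr invfM invrK mulrA mulVf // mul1r.
apply: anaM (ana_cst _ _) _.
have h1 : ana (fun z => 1 - c^-1 * f z) z0.
  exact: anaB (ana_cst _ _) (anaM (ana_cst _ _) hf).
apply: (ana_powerseries h1 (@pser_geometric (1 / 2) _ _)); try lra.
by rewrite mulVf // subrr mo0; lra.
Qed.

Lemma ana_div f g z0 : ana f z0 -> ana g z0 -> g z0 != 0 -> ana (fun z => f z / g z) z0.
Proof. by move=> hf hg g0; apply: anaM hf (ana_inv hg g0). Qed.

Lemma ana_continuous f z0 e : ana f z0 -> 0 < e ->
  exists2 d, 0 < d & forall h, mo h < d -> mo (f (z0 + h) - f z0) < e.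
Proof.
move=> [r [B [u [r0 hf]]]] e0.
have [g hg fg] := pser_tail r0 hf.
have f0 := pser_at0 (ltW r0) hf; rewrite addr0 in f0.
set D := B / r + 1; have D0 : 0 < D by rewrite ltr_wpDl // (pser_bound_ge0 hg).
exists (Num.min r (e / D)); first by rewrite lt_min r0 divr_gt0.
move=> h; rewrite lt_min => /andP[hr hd].
rewrite fg ?(ltW hr) // f0 addrC addKr moM.
rewrite ltr_pdivlMr // in hd; apply: le_lt_trans hd; rewrite ler_wpM2l ?mo_ge0 //.
by apply: le_trans (pser_val_le hg (ltW hr)) _; rewrite lerDl.
Qed.

Lemma ana_near_neq0 f z0 : ana f z0 -> f z0 != 0 ->
  exists2 d, 0 < d & forall h, mo h < d -> f (z0 + h) != 0.
Proof.
move=> hf f0; have [|d d0 hd] := ana_continuous hf (e := mo (f z0)); first by rewrite mo_gt0.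
exists d => // h /hd; apply: contraTneq => ->.
by rewrite sub0r moN ltxx.
Qed.

Lemma ana_conj f z0 : ana f z0 -> ana (fun z => (f z^*)^*) z0^*.
Proof.
move=> [r [B [u [r0 [h1 h2]]]]]; exists r, B, (fun n => (u n)^*); split=> //.
split=> [N|h hr]; first by under eq_bigr do rewrite mo_conj; apply: h1.
rewrite rmorphD /= conjCK.
have := tends_conj (h2 h^* _); rewrite mo_conj => /(_ hr); apply: tends_eq => N.
by rewrite rmorph_sum; apply: eq_bigr => i _; rewrite rmorphM rmorphXn /= conjCK.
Qed.

Lemma ana_dichotomy f z0 : ana f z0 ->
  (exists2 d, 0 < d & forall h, mo h <= d -> f (z0 + h) = 0) \/
  exists m g, [/\ ana g z0, g z0 != 0 &
    exists2 d, 0 < d & forall h, mo h <= d -> f (z0 + h) = h ^+ m * g (z0 + h)].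
Proof.
move=> [r [B [u [r0 hf]]]]; have [h0|] := pser_dichotomy r0 hf; first by left; exists r.
move=> [m [B' [v [g [hg v0 fg]]]]]; right; exists m, (fun z => g (z - z0)); split.
- exists r, B', v; split=> //; apply: pser_eq hg => h _; by rewrite addrC addKr.
- by rewrite subrr (pser_at0 (ltW r0) hg).
- by exists r => // h hr; rewrite fg // [z0 + h]addrC addrK.
Qed.

(** The zeros spread from the origin along the segment to [z]. The set of times
    before which [f] vanishes near the segment has a supremum; there [f] is either
    flat, which lets the set grow, or has an isolated zero, which contradicts the
    vanishing at earlier times. *)
Lemma identity_star (D : set C) f :
  (forall z t, D z -> 0 <= t <= 1 -> D (ofR t * z)) ->
  (forall z, D z -> ana f z) ->
  (exists2 d, 0 < d & forall h, mo h < d -> f h = 0) ->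
  forall z, D z -> f z = 0.
Proof.
move=> star hf [d0 d00 hd0] z Dz.
(* [V t]: f vanishes near the point t z; [A]: it does so at all times up to t. *)
pose V t := exists2 d, 0 < d & forall h, mo h < d -> f (ofR t * z + h) = 0.
pose A := [set t : R | 0 <= t <= 1 /\ forall s, 0 <= s <= t -> V s].
have A0 : A 0.
  split; first by rewrite lexx ler01.
  move=> s; rewrite -eq_le => /eqP <-; exists d0 => // h hh.
  by rewrite rmorph0 mul0r add0r; apply: hd0.
have hsup : has_sup A by split; [exists 0|exists 1 => t [/andP[]]].
pose T := sup A.
have T0 : 0 <= T by apply: ub_le_sup => //; case: hsup.
have T1 : T <= 1 by apply: ge_sup => [|t [/andP[]]] //; exists 0.
have below s : 0 <= s -> s < T -> V s.
  move=> s0 sT.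
  have [|t [_ ht] st] := @sup_adherent _ A (T - s) _ hsup; first by rewrite subr_gt0.
  by apply: ht; rewrite s0 ltW // (le_lt_trans _ st) // /T; lra.
have z0 := mo_ge0 z.
(* Arbitrarily close to the supremum there are times at which f vanishes locally; T = 0 is covered by the hypothesis at the origin. *)
have near_T e : 0 < e -> exists t, [/\ 0 <= t, t <= T, (T - t) * mo z < e & V t].
  move=> e0; case: (ltrP 0 T) => [Tp|Tn].
    have m1 : 0 < mo z + 1 by rewrite ltr_wpDl.
    pose t := Num.max 0 (T - e / (mo z + 1)).
    have tT : t < T by rewrite gt_max Tp gtrBl divr_gt0.
    have t0 : 0 <= t by rewrite le_max lexx.
    exists t; split=> //; [exact: ltW| |exact: below].
    have h1 : T - t <= e / (mo z + 1).
      by rewrite lerBlDr -lerBlDl le_max lexx orbT.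
    apply: le_lt_trans (ler_wpM2r z0 h1) _.
    by rewrite mulrAC ltr_pdivrMr // ltr_pM2l // ltrDl.
  have TE : T = 0 by apply/le_anti; rewrite Tn T0.
  exists 0; split=> //; first by rewrite TE subrr mul0r.
  by case: A0 => _; apply; rewrite lexx.
have anaT : ana f (ofR T * z) by apply: hf; apply: star => //; rewrite T0.
have [[d d_gt0 hd]|[m [g [hg g0 [d d_gt0 hd]]]]] := ana_dichotomy anaT; last first.
  have [d2 d20 hd2] := ana_near_neq0 hg g0.
  pose e := Num.min d d2; have e0 : 0 < e by rewrite lt_min d_gt0.
  have [t [t0 tT te [dt dt0 ht]]] := near_T e e0.
  (* Off the centre f = h^m g has no zero near T z, while it vanishes near t z. *)
  have absurd h : mo h < e -> h != 0 -> f (ofR T * z + h) = 0 -> False.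
    rewrite lt_min => /andP[/ltW h1 h2] hn; rewrite hd // => /eqP.
    by rewrite mulf_eq0 expf_eq0 (negPf hn) andbF (negPf (hd2 h h2)).
  case: (eqVneq (ofR (t - T) * z) 0) => [E|hn].
    pose p := Num.min dt e / 2.
    have p0 : 0 < p by rewrite divr_gt0 // lt_min dt0.
    have pm : p < Num.min dt e.
      by rewrite /p ltr_pdivrMr // ltr_pMr ?ltr1n // lt_min dt0.
    have mp : mo (ofR p) = p by rewrite mo_ofR ger0_norm // ltW.
    move: pm; rewrite lt_min => /andP[p1 p2].
    case: (absurd (ofR p)); rewrite ?mp -?mo_eq0 ?mp ?gt_eqF //.
    rewrite -[RHS](ht (ofR p)) ?mp //; congr (f (_ + _)).
    by apply/eqP; rewrite eq_sym -subr_eq0 -mulrBl -rmorphB E.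
  case: (absurd (ofR (t - T) * z)) => //.
    by rewrite moM mo_ofR distrC ger0_norm // subr_ge0.
  rewrite -[RHS](ht 0) ?mo0 //; congr f; rewrite rmorphB; ring.
have VT s : (`|s - T| * mo z < d / 2) -> V s.
  move=> hs; exists (d / 2) => [|h hh]; first by rewrite divr_gt0.
  rewrite (_ : ofR s * z + h = ofR T * z + (ofR (s - T) * z + h)); last first.
    by rewrite rmorphB; ring.
  apply: hd; apply: le_trans (moD _ _) _; rewrite moM mo_ofR; lra.
have all_below s : 0 <= s <= T -> V s.
  move=> /andP[s0 sT]; case: (ltrP s T) => [/below|Ts]; first exact.
  by apply: VT; rewrite (_ : s = T) ?subrr ?normr0 ?mul0r ?divr_gt0 //; apply/le_anti; rewrite sT.
suff TE : T = 1.
  have [|e e0 he] := all_below 1; first by rewrite ler01 TE lexx.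
  by have := he 0; rewrite mo0 rmorph1 mul1r addr0; apply.
apply/eqP; rewrite eq_le T1 /= leNgt; apply/negP => T1'.
have m1 : 0 < mo z + 1 by rewrite ltr_wpDl.
pose e := Num.min (1 - T) (d / 2 / (mo z + 1) / 2).
have e0 : 0 < e by rewrite lt_min subr_gt0 T1' !divr_gt0.
have : T + e <= T.
  apply: ub_le_sup; first by case: hsup.
  split.
    by apply/andP; split; [rewrite addr_ge0 // ltW|rewrite -lerBrDl ge_min lexx].
  move=> s /andP[s0 se]; case: (lerP s T) => [sT|Ts]; first by apply: all_below; rewrite s0.
  apply: VT; rewrite ger0_norm ?subr_ge0 ?(ltW Ts) //.
  have h1 : s - T <= d / 2 / (mo z + 1) / 2.
    by apply: (@le_trans _ _ e); [rewrite lerBlDl|rewrite ge_min lexx orbT].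
  apply: (@le_lt_trans _ _ (d / 2 / (mo z + 1) / 2 * (mo z + 1))).
    by apply: ler_pM; rewrite ?subr_ge0 ?(ltW Ts) ?mo_ge0 // lerDl.
  rewrite mulrAC mulfVK ?gt_eqF // ltr_pdivrMr // ltr_pMr ?divr_gt0 //; lra.
by rewrite gerDl leNgt e0.
Qed.

Lemma identity_star2 (D : set C) f g :
  (forall z t, D z -> 0 <= t <= 1 -> D (ofR t * z)) ->
  (forall z, D z -> ana f z) -> (forall z, D z -> ana g z) ->
  (exists2 d, 0 < d & forall h, mo h < d -> f h = g h) ->
  forall z, D z -> f z = g z.
Proof.
move=> star hf hg [d d0 fg] z Dz; apply/eqP; rewrite -subr_eq0; apply/eqP.
apply: (@identity_star D (fun z => f z - g z)) => // [x Dx|].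
  exact: anaB (hf x Dx) (hg x Dx).
by exists d => // h /fg ->; rewrite subrr.
Qed.

End Analytic.

(** * The slit plane as the image of the unit disc *)

Section Growth.
Variable R : realType.
Implicit Types (x y : R).

Lemma ratio_bounded (x : nat -> R) q N : (forall n, 0 <= x n) -> 0 <= q -> q < 1 ->
  (forall n, (N <= n)%N -> x n.+1 <= q * x n) ->
  exists B, forall K, \sum_(i < K) x i <= B.
Proof.
move=> x0 q0 q1 hx; exists (\sum_(i < N) x i + x N * (1 - q)^-1) => K.
apply: (@le_trans _ _ (\sum_(i < N + K) x i)).
  by rewrite addnC big_split_ord /= lerDl sumr_ge0.
rewrite big_split_ord /= lerD2l.
apply: (@le_trans _ _ (\sum_(i < K) x N * q ^+ i)); last first.
  by rewrite -mulr_sumr ler_wpM2l // geometric_sum_le.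
apply: ler_sum => -[i _] _ /=; elim: i => [|i IH]; first by rewrite addn0 expr0 mulr1.
rewrite addnS; apply: le_trans (hx _ _) _; first by rewrite leq_addr.
by rewrite exprS mulrCA ler_wpM2l.
Qed.

(** A ratio test whose limit superior is only known to be at most 1: it yields
    summability on every disc of radius smaller than 1. *)
Lemma ratio_summable (f : nat -> R) :
  (forall e, 0 < e -> exists N, forall n, (N <= n)%N -> `|f n.+1| <= (1 + e) * `|f n|) ->
  forall r, 0 < r -> r < 1 -> exists B, forall K, \sum_(i < K) `|f i| * r ^+ i <= B.
Proof.
move=> hf r r0 r1.
pose e := (1 - r) / 2; have e0 : 0 < e by rewrite /e; lra.
have [N hN] := hf e e0.
have q1 : (1 + e) * r < 1 by rewrite /e; nra.
apply: (@ratio_bounded (fun i => `|f i| * r ^+ i) ((1 + e) * r) N) => // [n||n Nn].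
- by rewrite mulr_ge0 // exprn_ge0 // ltW.
- by rewrite mulr_ge0 ?ltW // addr_gt0.
- rewrite exprS; have -> : (1 + e) * r * (`|f n| * r ^+ n) =
    (1 + e) * `|f n| * (r * r ^+ n) by ring.
  by rewrite ler_wpM2r ?hN // mulr_ge0 ?exprn_ge0 // ltW.
Qed.

(** Quotients of consecutive Pochhammer symbols are products of such factors. *)
Lemma shifted_ratio_near1 (s t e : R) : 0 < e ->
  exists N : nat, forall n, (N <= n)%N -> 0 < t + n%:R /\ `|s + n%:R| <= (1 + e) * (t + n%:R).
Proof.
move=> e0; pose M := `|t| + `|s - t| / e + 1.
exists (Num.truncn M).+1 => n Nn.
have M0 : 0 <= M by rewrite !addr_ge0 // divr_ge0 // ltW.
have hn : M <= n%:R.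
  by apply: le_trans (ltW (truncnS_gt M)) _; rewrite ler_nat.
have h1 : - t <= `|t| by rewrite -normrN ler_norm.
have h2 : 0 <= `|s - t| / e by rewrite divr_ge0 // ltW.
have tn : `|s - t| / e <= t + n%:R by move: hn; rewrite /M; lra.
split; first by move: hn; rewrite /M; lra.
have -> : s + n%:R = (t + n%:R) + (s - t) by ring.
apply: le_trans (ler_normD _ _) _; rewrite mulrDl mul1r.
apply: lerD; last by rewrite mulrC -ler_pdivrMr.
by rewrite ger0_norm //; apply: le_trans tn.
Qed.

Lemma pochS x n : poch x n.+1 = poch x n * (x + n%:R).
Proof. by rewrite /poch big_ord_recr. Qed.
Lemma poch0 x : poch x 0 = 1. Proof. by rewrite /poch big_ord0. Qed.

Lemma fact_neq0 n : n`!%:R != 0 :> R.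
Proof. by rewrite pnatr_eq0 -lt0n fact_gt0. Qed.

(** The Taylor coefficients of (1-z)^(-x). *)
Definition binom_coef x n : R := poch x n / n`!%:R.

Lemma binom_coefS x n : n.+1%:R * binom_coef x n.+1 = (x + n%:R) * binom_coef x n.
Proof.
rewrite /binom_coef pochS factS natrM invfM.
have n0 : n.+1%:R != 0 :> R by rewrite pnatr_eq0.
move: (poch x n) (x + n%:R) (n`!%:R) (fact_neq0 n) n.+1%:R n0 => p y v v0 w w0.
by field; rewrite ?v0 ?w0.
Qed.

(** Vandermonde's convolution, the coefficientwise form of
    (1-z)^(-x) (1-z)^(-y) = (1-z)^(-(x+y)); both sides satisfy the same first order
    recurrence in [n]. *)
Lemma binom_coef_conv x y n :
  \sum_(k < n.+1) binom_coef x k * binom_coef y (n - k) = binom_coef (x + y) n.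
Proof.
elim: n => [|n IH].
  by rewrite big_ord_recl big_ord0 /binom_coef !poch0 fact0 !divr1 mulr1 addr0.
have n0 : n.+1%:R != 0 :> R by rewrite pnatr_eq0.
apply: (mulfI n0); rewrite binom_coefS -IH.
have -> : n.+1%:R * (\sum_(k < n.+2) binom_coef x k * binom_coef y (n.+1 - k)) =
  \sum_(k < n.+2) k%:R * binom_coef x k * binom_coef y (n.+1 - k) +
  \sum_(k < n.+2) (n.+1 - k)%:R * binom_coef y (n.+1 - k) * binom_coef x k.
  rewrite mulr_sumr -big_split; apply: eq_bigr => k _ /=.
  have -> : n.+1%:R = k%:R + (n.+1 - k)%:R :> R by rewrite -natrD subnKC // -ltnS ltn_ord.
  ring.
rewrite big_ord_recl /= !mul0r add0r [X in _ + X]big_ord_recr /= subnn !mul0r addr0.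
rewrite -big_split mulr_sumr; apply: eq_bigr => -[k kn] _ /=.
rewrite /bump /= add1n subSS subSn // binom_coefS binom_coefS.
have -> : n%:R = k%:R + (n - k)%:R :> R by rewrite -natrD subnKC.
ring.
Qed.

Lemma binom_coef_summable x r : 0 < r -> r < 1 ->
  exists B, forall K, \sum_(i < K) `|binom_coef x i| * r ^+ i <= B.
Proof.
apply: ratio_summable => e e0; have [N hN] := shifted_ratio_near1 x 1 e0.
exists N => n /hN [h1 h2].
have n0 : 0 < n.+1%:R :> R by rewrite ltr0n.
rewrite -(ler_pM2l n0) -{1}[n.+1%:R]ger0_norm ?(ltW n0) // -normrM binom_coefS normrM.
by rewrite mulrA ler_wpM2r // mulrC -nat1r.
Qed.

Lemma real_coef_pser r (f : nat -> R) : (exists B, forall K, \sum_(i < K) `|f i| * r ^+ i <= B) ->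
  exists B F, pser r B (fun n => ofR (f n)) F.
Proof.
move=> [B hB]; have hl (h : Cx R) : exists l, mo h <= r ->
    tends (fun N => \sum_(i < N) ofR (f i) * h ^+ i) l.
  case: (pselect (mo h <= r)) => hr; last by exists 0.
  have [|l hl] := @abs_summable _ (fun i => ofR (f i) * h ^+ i) B; last by exists l.
  move=> K; apply: le_trans (hB K); apply: ler_sum => i _.
  by rewrite moM moX mo_ofR ler_wpM2l // pow_le ?mo_ge0.
have [F hF] := choice hl; exists B, F; split=> // N.
by apply: le_trans (hB N); apply: ler_sum => i _; rewrite mo_ofR.
Qed.

End Growth.

Section SlitPlane.
Variable R : realType.
Local Notation C := (Cx R).
Implicit Types (z w h : C).

(** Off the slit, 1 - z is not a nonpositive real, so its square roots are not
    purely imaginary and one of them lies in the right half-plane. *)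
Lemma slit_sqrt z : slit_plane z -> exists2 s : C, s ^+ 2 = 1 - z & 0 < complex.Re s.
Proof.
move=> hz; have [s hs] : exists s : C, s ^+ 2 = 1 - z by exists (sqrtC (1 - z)); rewrite sqrtCK.
case: (ltrgtP (complex.Re s) 0) => [neg|pos|E].
- by exists (- s); rewrite ?sqrrN // cReN oppr_gt0.
- by exists s.
have hI : complex.Im (s ^+ 2) = complex.Im (1 - z) by rewrite hs.
have hR : complex.Re (s ^+ 2) = complex.Re (1 - z) by rewrite hs.
case: hz; move: hI hR.
rewrite !expr2 cReM cImM cReD cImD cReN cImN E !mul0r !mulr0 sub0r !addr0 /= => h1 h2.
by split; [lra|have := sqr_ge0 (complex.Im s); rewrite expr2; lra].
Qed.

Lemma slit_plane_star z (t : R) : slit_plane z -> 0 <= t <= 1 -> slit_plane (ofR t * z).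
Proof.
move=> hz /andP[t0 t1] []; rewrite cReM cImM Re_ofR Im_ofR !mul0r subr0 addr0 => h1 h2.
apply: hz; move/eqP: h1; rewrite mulf_eq0 => /orP[/eqP t00|/eqP ->].
  by move: h2; rewrite t00 mul0r ler10.
split=> //; rewrite leNgt; apply/negP => x1.
by case: (lerP (complex.Re z) 0) => x0; nra.
Qed.

Lemma disc_slit z : mo z < 1 -> slit_plane z.
Proof.
move=> h [_ h1]; have := Re_le_mo z; have := ler_norm (complex.Re z); lra.
Qed.

Lemma half_plane_cayley (s : C) : 0 < complex.Re s -> 1 + s != 0 /\ mo ((1 - s) / (1 + s)) < 1.
Proof.
move=> hs; have n0 : 1 + s != 0.
  apply/eqP => /(congr1 (fun x : C => complex.Re x)); rewrite cReD /=; lra.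
split=> //; rewrite moM moV ltr_pdivrMr ?mo_gt0 // mul1r.
rewrite -(@ltr_pXn2r _ 2) ?nnegrE ?mo_ge0 // !sqr_mo !cReD !cImD cReN cImN /=; nra.
Qed.

Lemma cayley_uniformizes (s z : C) : 1 + s != 0 -> s ^+ 2 = 1 - z ->
  z * (1 + (1 - s) / (1 + s)) ^+ 2 = 4 * ((1 - s) / (1 + s)).
Proof.
move=> n0 hs; have -> : z = 1 - s ^+ 2 by rewrite hs subKr.
by field.
Qed.

(** The map w |-> 4w/(1+w)^2 is injective on the disc: equal values force
    (w - w') (1 - w w') = 0. *)
Lemma uniformizer_unique (z w w' : C) : mo w < 1 -> mo w' < 1 ->
  z * (1 + w) ^+ 2 = 4 * w -> z * (1 + w') ^+ 2 = 4 * w' -> w = w'.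
Proof.
move=> h h' E E'.
have n4 : (4 : C) != 0 by rewrite pnatr_eq0.
have : 4 * ((w - w') * (1 - w * w')) = 0 :> C.
  have -> : 4 * ((w - w') * (1 - w * w')) =
    (4 * w) * (1 + w') ^+ 2 - (4 * w') * (1 + w) ^+ 2 by ring.
  by rewrite -E -E'; ring.
move/eqP; rewrite !mulf_eq0 (negPf n4) /= => /orP[|]; first by rewrite subr_eq0 => /eqP.
rewrite subr_eq0 => /eqP E1; have := congr1 (@modulus R) E1; rewrite mo1 moM => h1.
move: (mo_ge0 w) (mo_ge0 w') h h' h1; clear => *; exfalso; nra.
Qed.

Lemma slit_uniformizer z : slit_plane z ->
  exists w : C, mo w < 1 /\ z * (1 + w) ^+ 2 = 4 * w.
Proof.
move=> /slit_sqrt [s hs s0]; have [n0 h] := half_plane_cayley s0.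
by exists ((1 - s) / (1 + s)); split=> //; apply: cayley_uniformizes.
Qed.

(** The conformal map of the slit plane onto the unit disc, inverse to
    w |-> 4w/(1+w)^2. *)
Definition unif z : C := xget 0 [set w : C | mo w < 1 /\ z * (1 + w) ^+ 2 = 4 * w].

Lemma unifP z : slit_plane z -> mo (unif z) < 1 /\ z * (1 + unif z) ^+ 2 = 4 * unif z.
Proof. by move=> /slit_uniformizer hz; rewrite /unif; case: xgetP => // hn; case: hz => w /hn. Qed.

Lemma unifE z w : mo w < 1 -> z * (1 + w) ^+ 2 = 4 * w -> unif z = w.
Proof.
move=> h1 h2; have := xgetPex 0 (ex_intro (fun w => mo w < 1 /\ z * (1 + w) ^+ 2 = 4 * w) w (conj h1 h2)).
by move=> [h3 h4]; apply: uniformizer_unique h4 h2.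
Qed.

(** The binomial series of exponent 1/2, whose square is computed by Vandermonde's
    convolution. *)
Lemma local_sqrt : exists B v (g : C -> C), pser (1 / 2) B v g /\
  g 0 = 1 /\ forall h, mo h <= 1 / 2 -> g h ^+ 2 = 1 - h.
Proof.
have r0 : 0 < (1 / 2 : R) by lra.
have r1 : (1 / 2 : R) < 1 by lra.
have [B [g hg]] := real_coef_pser (binom_coef_summable (- (1 / 2)) r0 r1).
exists B, (fun n => ofR (binom_coef (- (1 / 2)) n)), g; split=> //; split.
  by rewrite (pser_at0 (ltW r0) hg) /binom_coef poch0 fact0 divr1 rmorph1.
move=> h hh; have hgg := pser_mul_coef r0 hg hg.
rewrite expr2; apply: tends_unique (hgg.2 h hh) _.
apply: (@tends_eventually _ _ _ 2) => n n2.
have E k : \sum_(j < k.+1) @ofR R (binom_coef (- (1 / 2)) j) * ofR (binom_coef (- (1 / 2)) (k - j)) =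
    @ofR R (binom_coef (- 1) k).
  transitivity (@ofR R (\sum_(j < k.+1) (binom_coef (- (1 / 2)) j * binom_coef (- (1 / 2)) (k - j)))).
    by rewrite rmorph_sum; apply: eq_bigr => j _; rewrite rmorphM.
  by rewrite binom_coef_conv; congr (ofR (binom_coef _ _)); field.
under eq_bigr do rewrite E.
have z2 k : binom_coef (- 1 : R) k.+2 = 0 :> R.
  by rewrite /binom_coef /poch big_ord_recl big_ord_recl /= addNr mul0r mulr0 mul0r.
rewrite -(subnKC n2) big_split_ord /= [X in _ + X]big1 ?addr0; last first.
  by move=> i _; rewrite add2n z2 rmorph0 mul0r.
rewrite !big_ord_recl big_ord0 /= /binom_coef pochS !poch0 fact0 factS fact0 /= !mul1r !addr0 divr1.
by rewrite ?divr1 ?invr1 ?mulr1 ?rmorph1 /bump /= expr1 rmorphN1 mulN1r.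
Qed.

(** With s^2 = 1 - z in the right half-plane, the inverse map is (1-s)/(1+s). Near
    z0 the root is s0 sqrt(1 - (z-z0)/s0^2), an analytic function. *)
Lemma ana_unif z0 : slit_plane z0 -> ana unif z0.
Proof.
move=> hz0; have [s hs s0] := slit_sqrt hz0.
have [n0 hw] := half_plane_cayley s0.
have sn : s != 0 by apply/eqP => E; move: s0; rewrite E /= ltxx.
have [B [v [g [hg [g0 gg]]]]] := local_sqrt.
pose sig z := s * g (s ^- 2 * (z - z0)).
have E0 : s ^- 2 * (z0 - z0) = 0 by rewrite subrr mulr0.
have asig : ana sig z0.
  apply: anaM (ana_cst _ _) _.
  apply: (ana_powerseries (f := fun z => s ^- 2 * (z - z0)) _ hg).
    exact: anaM (ana_cst _ _) (anaB (ana_id _) (ana_cst _ _)).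
  by rewrite E0 mo0; lra.
have sig0 : sig z0 = s by rewrite /sig E0 g0 mulr1.
have n0' : 1 + sig z0 != 0 by rewrite sig0.
pose W z := (1 - sig z) / (1 + sig z).
have aW : ana W z0.
  apply: (@ana_div _ (fun z => 1 - sig z) (fun z => 1 + sig z) z0 _ _ n0').
    exact: anaB (ana_cst _ _) asig.
  exact: anaD (ana_cst _ _) asig.
have W0 : mo (W z0) < 1 by rewrite /W sig0.
have [d1 d10 h1] := ana_near_neq0 (anaD (ana_cst 1 z0) asig) n0'.
have [|d2 d20 h2] := @ana_continuous _ _ _ (1 - mo (W z0)) aW; first by rewrite subr_gt0.
apply: ana_near aW.
have m0 : 0 < mo s by rewrite mo_gt0.
exists (Num.min (Num.min d1 d2) (mo s ^+ 2 / 2)).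
  by rewrite !lt_min d10 d20 divr_gt0 // exprn_gt0.
move=> h; rewrite !lt_min => /andP[/andP[hd1 hd2] hd3].
symmetry; apply: unifE.
  have := h2 h hd2; have := moD (W (z0 + h) - W z0) (W z0); rewrite subrK; lra.
apply: cayley_uniformizes; first exact: h1.
have hE : z0 + h - z0 = h by rewrite addrC addKr.
rewrite /sig hE exprMn gg; last first.
  rewrite moM moV moX ler_pdivrMl ?exprn_gt0 //; lra.
by rewrite mulrBr mulr1 mulrA divff ?expf_neq0 // mul1r hs opprD addrA.
Qed.

End SlitPlane.

(** * The hypergeometric series in the variable of the disc *)

Section Uniformized.
Variable R : realType.
Local Notation C := (Cx R).
Implicit Types (x y : R) (f g : nat -> R).

Lemma pochSl x n : poch x n.+1 = x * poch (x + 1) n.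
Proof.
rewrite /poch big_ord_recl addr0; congr (_ * _); apply: eq_bigr => i _.
by rewrite /bump /= natrD addrA.
Qed.

(** Coefficient of w^n in z^k (1+w)^(-x), where z = 4w/(1+w)^2. *)
Fixpoint tcoef (k : nat) (x : R) (n : nat) : R :=
  if k is k'.+1 then (if n is n'.+1 then 4 * tcoef k' (x + 2) n' else 0)
  else (-1) ^+ n * binom_coef x n.

Arguments tcoef : simpl nomatch.

Lemma tcoef_lt k x n : (n < k)%N -> tcoef k x n = 0.
Proof. by elim: k x n => // k IH x [|n] //= nk; rewrite IH ?mulr0. Qed.

Lemma tcoef0 k x : tcoef k x 0 = (k == 0%N)%:R.
Proof. by case: k => //=; rewrite expr0 mul1r /binom_coef poch0 fact0 divr1. Qed.

Lemma binom_coef_pascal x n : binom_coef (x + 1) n.+1 = binom_coef x n.+1 + binom_coef (x + 1) n.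
Proof.
rewrite /binom_coef pochS pochSl factS natrM invfM.
have n0 : 1 + n%:R != 0 :> R by rewrite nat1r pnatr_eq0.
rewrite -nat1r; move: (poch (x + 1) n) (n`!%:R) (fact_neq0 R n) (n%:R) n0 => p v v0 w w0.
by field; rewrite ?v0 ?w0.
Qed.

(** Multiplication by 1 + w. *)
Lemma tcoef_up k x n : tcoef k (x + 1) n.+1 + tcoef k (x + 1) n = tcoef k x n.+1.
Proof.
elim: k x n => [|k IH] x n /=.
  rewrite binom_coef_pascal exprS; move: ((-1) ^+ n) => e; ring.
have E : x + 1 + 2 = x + 2 + 1 by ring.
case: n => [|n] /=; rewrite E; last by rewrite -(IH (x + 2)); ring.
by rewrite addr0 !tcoef0.
Qed.

(** For g = z^k (1+w)^(-x) the logarithmic derivative gives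
    (1+w) w g' = k (1-w) g - x w g. *)
Lemma tcoef_euler k x n : n.+1%:R * tcoef k x n.+1 + n%:R * tcoef k x n =
  k%:R * (tcoef k x n.+1 - tcoef k x n) - x * tcoef k x n.
Proof.
elim: k x n => [|k IH] x n /=.
  rewrite mul0r sub0r mulrCA binom_coefS exprS; move: ((-1) ^+ n) => e; ring.
case: n => [|n] /=; first by rewrite tcoef0 !mulr0 addr0 !subr0; case: k {IH} => [|k] //=; rewrite !mulr0.
have := IH (x + 2) n; rewrite -(natr1 n.+1) -(natr1 n) -(natr1 k) => E.
have -> : (n%:R + 1 + 1) * (4 * tcoef k (x + 2) n.+1) + (n%:R + 1) * (4 * tcoef k (x + 2) n) =
  4 * ((n%:R + 1) * tcoef k (x + 2) n.+1 + n%:R * tcoef k (x + 2) n) +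
  4 * (tcoef k (x + 2) n.+1 + tcoef k (x + 2) n) by ring.
by rewrite E; ring.
Qed.

Definition sh f n : R := if n is n'.+1 then f n' else 0.

(** Coefficient of w^n in (1+w)^(-x) sum_k f_k z^k. *)
Definition ucoef x f n : R := \sum_(k < n.+1) f k * tcoef k x n.

Lemma ucoef_widen x f n N : (n < N)%N -> ucoef x f n = \sum_(k < N) f k * tcoef k x n.
Proof.
move=> nN; rewrite -(subnKC nN) big_split_ord /= [X in _ = _ + X]big1; first by rewrite addr0.
by move=> i _; rewrite tcoef_lt ?mulr0 // addSn ltnS leq_addr.
Qed.

Lemma ucoef_0 x f : ucoef x f 0 = f 0%N.
Proof. by rewrite /ucoef big_ord_recl big_ord0 tcoef0 mulr1 addr0. Qed.

Lemma ucoef_up x f n : ucoef (x + 1) f n.+1 + ucoef (x + 1) f n = ucoef x f n.+1.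
Proof.
rewrite (@ucoef_widen _ _ n n.+2) // /ucoef -big_split /=.
by apply: eq_bigr => k _; rewrite -(tcoef_up k x n) mulrDr.
Qed.

(** The relation f = f' - d z f'' between power series in z, rewritten in w: the
    factor z = 4w/(1+w)^2 shifts the index, raises the exponent by 2 and brings a 4. *)
Lemma ucoef_contiguous x f f' f'' d n :
  f 0%N = f' 0%N -> (forall k, f k.+1 = f' k.+1 - d * f'' k) ->
  ucoef x f n.+1 = ucoef x f' n.+1 - 4 * d * ucoef (x + 2) f'' n.
Proof.
move=> h0 hS; rewrite /ucoef [in LHS]big_ord_recl [X in _ = X - _]big_ord_recl /= h0.
rewrite -addrA; congr (_ + _); rewrite mulr_sumr -sumrB; apply: eq_bigr => k _.
by rewrite /bump /= add1n hS; ring.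
Qed.

(** With D = z d/dz, the hypergeometric operator D (D+c-1) - z (D+a) (D+b) maps z^k to
    k(k+c-1) z^k - (k+a)(k+b) z^(k+1), and the sum over k against the hypergeometric
    coefficients telescopes. The identity is multiplied by (1+w)^2 (1-w), which
    makes the operator polynomial in w. *)
Lemma tcoef_ode a b c k n : let t i := tcoef k 0 i in
  n.+3%:R ^+ 2 * t n.+3 + n.+2%:R ^+ 2 * t n.+2 - n.+1%:R ^+ 2 * t n.+1 - n%:R ^+ 2 * t n
  + (c - 1) * n.+3%:R * t n.+3 + (3 * c - 4 * (a + b) - 1) * n.+2%:R * t n.+2
  + (3 * c - 4 * (a + b) - 1) * n.+1%:R * t n.+1 + (c - 1) * n%:R * t n
  - 4 * a * b * (t n.+2 - t n.+1) =
  k%:R * (k%:R + c - 1) * (tcoef k (-2) n.+3 - tcoef k (-2) n.+2) -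
  (k%:R + a) * (k%:R + b) * (tcoef k.+1 (-2) n.+3 - tcoef k.+1 (-2) n.+2).
Proof.
move=> t /=; have -> : - 2 + 2 = 0 :> R by rewrite addNr.
have e1 i : tcoef k (-1) i.+1 = t i.+1 + t i.
  by rewrite -tcoef_up /t (_ : -1 + 1 = 0 :> R) // addNr.
have e2 i : tcoef k (-2) i.+2 = t i.+2 + 2 * t i.+1 + t i.
  rewrite -tcoef_up (_ : -2 + 1 = -1 :> R); last by ring.
  by rewrite !e1; ring.
rewrite !e2 -/(t n.+2) -/(t n.+1).
have E i : i.+1%:R * t i.+1 + i%:R * t i - k%:R * (t i.+1 - t i) = 0.
  by rewrite /t tcoef_euler mul0r subr0 subrr.
have := E n; have := E n.+1; have := E n.+2; rewrite -(natr1 n.+2) -(natr1 n.+1) -(natr1 n).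
move: (t n) (t n.+1) (t n.+2) (t n.+3) (n%:R) (k%:R) => t0 t1 t2 t3 m l E2 E1 E0.
apply/eqP; rewrite -subr_eq0; apply/eqP.
(* The identity is this combination of the Euler relations at three consecutive indices. *)
rewrite -[RHS](_ : (m + 1 + 1 + 1 + l + c - 1) * 0 + (- (2 * l + 1) + 2 * c - 4 * (a + b)) * 0 +
   (- (m + 1 + 1 + 1) + l + c + 2) * 0 = 0); last by ring.
rewrite -{1}E2 -{1}E1 -E0; ring.
Qed.

Variables (a b c : R).
Hypothesis hc : forall n : nat, - c != n%:R.

Definition hcoef a b c n : R := poch a n * poch b n / (poch c n * n`!%:R).

Lemma c_shift_neq0 n : c + n%:R != 0.
Proof. by rewrite -[c]opprK addrC subr_eq0 eq_sym. Qed.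

Lemma poch_c_neq0 n : poch c n != 0.
Proof. by apply/prodf_neq0 => i _; apply: c_shift_neq0. Qed.

Lemma hcoefS k : (k%:R + c) * k.+1%:R * hcoef a b c k.+1 = (k%:R + a) * (k%:R + b) * hcoef a b c k.
Proof.
rewrite /hcoef !pochS factS natrM.
have n0 : k.+1%:R != 0 :> R by rewrite pnatr_eq0.
move: (c_shift_neq0 k) (poch_c_neq0 k) (fact_neq0 R k).
rewrite -(natr1 k) in n0 *; move: (poch a k) (poch b k) (poch c k) (k%:R) n0 (k`!%:R) => p q r m m0 v h1 h2 v0.
by field; rewrite ?v0 ?h1 ?h2 ?m0.
Qed.

Lemma hcoef_0 : hcoef a b c 0 = 1.
Proof. by rewrite /hcoef !poch0 fact0 !mulr1 divr1. Qed.

Let f := hcoef a b c.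
Let g := ucoef 0 f.

(** The leading coefficient of the equation in w is (1+w)^2 (1-w): all its
    singularities lie on the unit circle, and the other terms are of lower order
    in [n]. *)
Lemma ucoef_ode n :
  n.+3%:R ^+ 2 * (g n.+3 + g n.+2 - g n.+1 - g n) =
  - (c - 1) * n.+3%:R * g n.+3
  + ((2 * n.+2%:R + 1) - (3 * c - 4 * (a + b) - 1) * n.+2%:R + 4 * a * b) * g n.+2
  + (- (4 * n.+1%:R + 4) - (3 * c - 4 * (a + b) - 1) * n.+1%:R - 4 * a * b) * g n.+1
  + (- (6 * n%:R + 9) - (c - 1) * n%:R) * g n.
Proof.
pose N := n.+4; pose F k (x : nat -> R) := f k * x k.
have gE i : (i <= n.+3)%N -> g i = \sum_(k < N) f k * tcoef k 0 i.
  by move=> iN; apply: ucoef_widen.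
have tele : \sum_(k < N) f k * (k%:R * (k%:R + c - 1) * (tcoef k (-2) n.+3 - tcoef k (-2) n.+2) -
  (k%:R + a) * (k%:R + b) * (tcoef k.+1 (-2) n.+3 - tcoef k.+1 (-2) n.+2)) = 0.
  pose W k := k%:R * (k%:R + c - 1) * f k * (tcoef k (-2) n.+3 - tcoef k (-2) n.+2).
  transitivity (\sum_(0 <= k < N) (W k - W k.+1)).
    rewrite big_mkord; apply: eq_bigr => k _; rewrite mulrBr; congr (_ - _); rewrite /W.
      by ring.
    have := hcoefS k; rewrite -/f -(natr1 k) => E.
    rewrite mulrA [f k * _]mulrC -E; ring.
  rewrite (eq_bigr (fun k => - (W k.+1 - W k))) => [|k _]; last by rewrite opprB.
  rewrite sumrN telescope_sumr // /W mul0r !mul0r subr0.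
  rewrite !tcoef_lt ?subrr ?mulr0 ?oppr0 //.
have hsum : \sum_(k < N) f k * (
  n.+3%:R ^+ 2 * tcoef k 0 n.+3 + n.+2%:R ^+ 2 * tcoef k 0 n.+2 - n.+1%:R ^+ 2 * tcoef k 0 n.+1 - n%:R ^+ 2 * tcoef k 0 n
  + (c - 1) * n.+3%:R * tcoef k 0 n.+3 + (3 * c - 4 * (a + b) - 1) * n.+2%:R * tcoef k 0 n.+2
  + (3 * c - 4 * (a + b) - 1) * n.+1%:R * tcoef k 0 n.+1 + (c - 1) * n%:R * tcoef k 0 n
  - 4 * a * b * (tcoef k 0 n.+2 - tcoef k 0 n.+1)) = 0.
  by rewrite -[RHS]tele; apply: eq_bigr => k _; rewrite tcoef_ode.
have lin (A3 A2 A1 A0 : R) : A3 * g n.+3 + A2 * g n.+2 + A1 * g n.+1 + A0 * g n =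
    \sum_(k < N) f k * (A3 * tcoef k 0 n.+3 + A2 * tcoef k 0 n.+2 + A1 * tcoef k 0 n.+1 + A0 * tcoef k 0 n).
  have g3 := gE n.+3 (leqnn _).
  have g2 := gE n.+2 (leqnSn _).
  have g1 : g n.+1 = _ := gE n.+1 (ltnW (leqnSn _)).
  have g0 : g n = _ := gE n (ltnW (ltnW (leqnSn _))).
  rewrite g3 g2 g1 g0 !mulr_sumr -!big_split; apply: eq_bigr => k _ /=; ring.
have E : (n.+3%:R ^+ 2 + (c - 1) * n.+3%:R) * g n.+3
  + (n.+2%:R ^+ 2 + (3 * c - 4 * (a + b) - 1) * n.+2%:R - 4 * a * b) * g n.+2
  + (- n.+1%:R ^+ 2 + (3 * c - 4 * (a + b) - 1) * n.+1%:R + 4 * a * b) * g n.+1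
  + (- n%:R ^+ 2 + (c - 1) * n%:R) * g n = 0.
  by rewrite lin -[RHS]hsum; apply: eq_bigr => k _; ring.
apply/eqP; rewrite -subr_eq0 -[X in _ == X]E; apply/eqP; rewrite -(natr1 n.+2) -(natr1 n.+1) -(natr1 n); ring.
Qed.

(** In the weighted norm, division by 1 + w or by 1 - w costs at most a factor
    1/(1-r). *)
Lemma weighted_div (x y : nat -> R) r N : 0 <= r -> r < 1 -> (forall n, 0 <= x n) ->
  (forall n, x n <= y n + sh x n) ->
  \sum_(i < N) x i * r ^+ i <= (\sum_(i < N) y i * r ^+ i) / (1 - r).
Proof.
move=> r0 r1 x0 hx; rewrite ler_pdivlMr ?subr_gt0 // mulrBr mulr1 lerBlDr.
apply: (@le_trans _ _ (\sum_(i < N) (y i + sh x i) * r ^+ i)).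
  by apply: ler_sum => i _; rewrite ler_wpM2r ?exprn_ge0.
under eq_bigr do rewrite mulrDl; rewrite big_split lerD2l /=.
case: N => [|N]; first by rewrite !big_ord0 mul0r.
rewrite big_ord_recl /= mul0r add0r big_ord_recr /= mulrDl mulr_suml.
apply: ler_wpDr; first by rewrite !mulr_ge0 // exprn_ge0.
by apply: ler_sum => i _; rewrite /bump /= add1n exprSr mulrA.
Qed.

Lemma sum_sh_le (x : nat -> R) r N : 0 <= r -> r <= 1 -> (forall n, 0 <= x n) ->
  \sum_(i < N) sh x i * r ^+ i <= \sum_(i < N) x i * r ^+ i.
Proof.
move=> r0 r1 x0; case: N => [|N]; first by rewrite !big_ord0.
rewrite big_ord_recl /= mul0r add0r big_ord_recr /=.
apply: ler_wpDr; first by rewrite mulr_ge0 // exprn_ge0.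
apply: ler_sum => i _; rewrite /bump /= add1n exprS mulrCA.
by rewrite ler_piMl // mulr_ge0 // exprn_ge0.
Qed.

(** Put H = (1+w)^2 (1-w) g. For large n the recurrence bounds |H_n| by a small
    multiple of the neighbouring |g_i|. Recovering g from H costs three divisions
    by linear factors, that is (1-r)^(-3); a multiple small against this lets the
    norm of g be absorbed, up to the contribution of finitely many terms. *)
Lemma ucoef_summable r : 0 < r -> r < 1 ->
  exists B, forall K, \sum_(i < K) `|g i| * r ^+ i <= B.
Proof.
move=> r0 r1.
pose x n := `|g n|; have x0 n : 0 <= x n by exact: normr_ge0.
pose g1 n := g n + sh g n; pose g2 n := g1 n + sh g1 n; pose H n := g2 n - sh g2 n.
pose A := 3 * c - 4 * (a + b) - 1.
pose D := 1 + `|c - 1| + `|A| + `|4 * a * b|.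
have D1 : 1 <= D by rewrite /D -!addrA lerDl !addr_ge0.
have Dc : `|c - 1| <= D by rewrite /D; have := normr_ge0 A; have := normr_ge0 (4 * a * b); lra.
have DA : `|A| <= D by rewrite /D; have := normr_ge0 (c - 1); have := normr_ge0 (4 * a * b); lra.
have Dab : `|4 * a * b| <= D by rewrite /D; have := normr_ge0 (c - 1); have := normr_ge0 A; lra.
have HE n : H n.+3 = g n.+3 + g n.+2 - g n.+1 - g n by rewrite /H /g2 /g1 /=; ring.
have Hb n : n.+3%:R * `|H n.+3| <= 8 * D * (x n.+3 + x n.+2 + x n.+1 + x n).
  have n0 : 0 < n.+3%:R :> R by rewrite ltr0n.
  rewrite -(ler_pM2l n0) mulrA -expr2 -[n.+3%:R ^+ 2]ger0_norm ?sqr_ge0 // -normrM HE ucoef_ode -/A.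
  have nn : 0 <= n%:R :> R by [].
  have e3 : n.+3%:R = n%:R + 3 :> R by rewrite -addn3 natrD.
  have e2 : n.+2%:R = n%:R + 2 :> R by rewrite -addn2 natrD.
  have e1 : n.+1%:R = n%:R + 1 :> R by rewrite -addn1 natrD.
  rewrite e3 e2 e1; move: (n%:R) nn => m m0 {n0 e3 e2 e1}.
  have prod (u v w : R) : `|u| <= D -> 0 <= v -> v <= w -> `|u * v| <= D * w.
    by move=> h1 h2 h3; rewrite normrM (ger0_norm h2) ler_pM.
  have mD : m + 3 <= D * (m + 3) by rewrite ler_peMl // addr_ge0.
  have D3 : D <= D * (m + 3) by rewrite ler_peMr; lra.
  have bound (l u : R) : `|l| <= 8 * (D * (m + 3)) -> `|l * u| <= 8 * (D * (m + 3)) * `|u|.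
    by move=> h; rewrite normrM ler_wpM2r.
  have p3 := prod (c - 1) (m + 3) (m + 3) Dc _ _.
  have p2 := prod A (m + 2) (m + 3) DA _ _.
  have p1 := prod A (m + 1) (m + 3) DA _ _.
  have p0 := prod (c - 1) m (m + 3) Dc _ _.
  have -> : (m + 3) * (8 * D * (x n.+3 + x n.+2 + x n.+1 + x n)) =
    8 * (D * (m + 3)) * x n.+3 + 8 * (D * (m + 3)) * x n.+2 + 8 * (D * (m + 3)) * x n.+1
    + 8 * (D * (m + 3)) * x n by ring.
  apply: (le_trans (ler_normD _ _) (lerD (le_trans (ler_normD _ _)
    (lerD (le_trans (ler_normD _ _) (lerD _ _)) _)) _)); apply: bound.
  - by rewrite !mulNr normrN; apply: le_trans (p3 _ _) _; lra.
  - apply: le_trans (ler_normD _ _) _; apply: le_trans (lerD (ler_normB _ _) (lexx _)) _.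
    have := p2; rewrite (ger0_norm (_ : 0 <= 2 * (m + 2) + 1)); last by lra.
    move=> /(_ _ _) h; have := h _ _; lra.
  - apply: le_trans (ler_normB _ _) _; apply: le_trans (lerD (ler_normB _ _) (lexx _)) _.
    rewrite normrN (ger0_norm (_ : 0 <= 4 * (m + 1) + 4)); last by lra.
    have := p1 _ _; lra.
  - apply: le_trans (ler_normB _ _) _; rewrite normrN (ger0_norm (_ : 0 <= 6 * m + 9)); last by lra.
    have := p0 _ _; lra.
have r1' : 0 < 1 - r by rewrite subr_gt0.
(* Four shifts and three divisions by 1 - r: then 4 e S is half of (1-r)^3 S. *)
pose e := (1 - r) ^+ 3 / 8; have e0 : 0 < e by rewrite divr_gt0 // exprn_gt0.
pose N := (Num.truncn (8 * D / e)).+1.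
(* The finitely many coefficients at which the recurrence is not yet small. *)
pose h n := if (n < N + 3)%N then `|H n| else 0.
pose y n := x n + sh x n + sh (sh x) n + sh (sh (sh x)) n.
have shx0 (u : nat -> R) : (forall n, 0 <= u n) -> forall n, 0 <= sh u n.
  by move=> hu [|n] //=.
have sx0 := shx0 _ x0; have ssx0 := shx0 _ sx0; have sssx0 := shx0 _ ssx0.
have y0 n : 0 <= y n by rewrite !addr_ge0.
have Hy n : `|H n| <= e * y n + h n.
  rewrite /h; case: ltnP => hn; first by rewrite lerDr mulr_ge0 // ltW.
  rewrite addr0; case: n hn => [|[|[|n]]]; rewrite ?addn3 // !ltnS => hn.
  have n0 : 0 < n.+3%:R :> R by rewrite ltr0n.
  rewrite -(ler_pM2l n0); apply: le_trans (Hb n) _.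
  rewrite mulrA ler_wpM2r //; first exact: (y0 n.+3).
  rewrite -ler_pdivrMr //; apply: le_trans (ltW (truncnS_gt _)) _.
  by rewrite ler_nat (leq_trans hn) // ltnW // ltnW.
pose M := \sum_(i < N + 3) `|H i| * r ^+ i.
have M0 : 0 <= M by apply: sumr_ge0 => i _; rewrite mulr_ge0 ?exprn_ge0 // ltW.
exists (2 * M / (1 - r) ^+ 3) => K.
set S := \sum_(i < K) _.
have hM : \sum_(i < K) h i * r ^+ i <= M.
  apply: (@le_trans _ _ (\sum_(i < N + 3 + K) h i * r ^+ i)).
    rewrite addnC big_split_ord /= lerDl sumr_ge0 // => i _.
    by rewrite mulr_ge0 ?exprn_ge0 ?(ltW r0) // /h; case: ifP.
  rewrite big_split_ord /= [X in _ + X]big1 ?addr0.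
    by apply: ler_sum => i _; rewrite /h ltn_ord.
  by move=> i _; rewrite /h ltnNge leq_addr mul0r.
have hyS : \sum_(i < K) y i * r ^+ i <= 4 * S.
  rewrite /y; under eq_bigr do rewrite !mulrDl.
  rewrite !big_split /= -/S.
  have s1 := sum_sh_le K (ltW r0) (ltW r1) x0.
  have s2 := sum_sh_le K (ltW r0) (ltW r1) sx0.
  have s3 := sum_sh_le K (ltW r0) (ltW r1) ssx0.
  rewrite -/S in s1; lra.
have hH : \sum_(i < K) `|H i| * r ^+ i <= 4 * e * S + M.
  apply: (@le_trans _ _ (\sum_(i < K) (e * y i + h i) * r ^+ i)).
    by apply: ler_sum => i _; rewrite ler_wpM2r ?exprn_ge0 // ltW.
  under eq_bigr do rewrite mulrDl -mulrA.
  rewrite big_split /= -mulr_sumr; apply: lerD hM.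
  by apply: le_trans (ler_wpM2l (ltW e0) hyS) _; rewrite mulrA [e * 4]mulrC.
have step (u v : nat -> R) : (forall n, `|u n| <= `|v n| + sh (fun n => `|u n|) n) ->
    \sum_(i < K) `|u i| * r ^+ i <= (\sum_(i < K) `|v i| * r ^+ i) / (1 - r).
  by move=> huv; apply: (@weighted_div (fun n => `|u n|) (fun n => `|v n|)) => //; exact: ltW.
have t1 : S <= (\sum_(i < K) `|g1 i| * r ^+ i) / (1 - r).
  apply: step => -[|n]; rewrite /g1 /= ?addr0 //.
  by rewrite -{1}[g n.+1](addrK (g n)); apply: ler_normB.
have t2 : \sum_(i < K) `|g1 i| * r ^+ i <= (\sum_(i < K) `|g2 i| * r ^+ i) / (1 - r).
  apply: step => -[|n]; rewrite /g2 /= ?addr0 //.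
  by rewrite -{1}[g1 n.+1](addrK (g1 n)); apply: ler_normB.
have t3 : \sum_(i < K) `|g2 i| * r ^+ i <= (\sum_(i < K) `|H i| * r ^+ i) / (1 - r).
  apply: step => -[|n]; rewrite /H /= ?subr0 ?addr0 //.
  by rewrite -{1}[g2 n.+1](subrK (g2 n)); apply: ler_normD.
have q3 : 0 < (1 - r) ^+ 3 by apply: exprn_gt0.
move: t1 t2 t3; rewrite !(ler_pdivlMr _ _ r1') => t1 t2 t3.
rewrite (ler_pdivlMr _ _ q3).
have t4 : S * (1 - r) ^+ 3 <= 4 * e * S + M.
  apply: le_trans hH; apply: le_trans t3; rewrite exprSr mulrA ler_pM2r //.
  by apply: le_trans t2; rewrite exprSr mulrA expr1 ler_pM2r.
have : 4 * e * S = S * (1 - r) ^+ 3 / 2 by rewrite /e; field.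
lra.
Qed.

End Uniformized.

(** * Analytic continuation of the hypergeometric series *)

Section Existence.
Variable R : realType.
Local Notation C := (Cx R).
Implicit Types (x y : R) (z w h : C).

(** The value where the series diverges is irrelevant. *)
Definition psum (u : nat -> C) h : C :=
  xget 0 [set l | tends (fun N => \sum_(i < N) u i * h ^+ i) l].

Lemma psum_tends (u : nat -> C) h l : tends (fun N => \sum_(i < N) u i * h ^+ i) l -> psum u h = l.
Proof. by move=> hl; apply: xget_unique => // l' hl'; apply: tends_unique hl' hl. Qed.

Lemma psum_pser r B (u : nat -> C) : (forall N, \sum_(i < N) mo (u i) * r ^+ i <= B) -> pser r B u (psum u).
Proof.
move=> hB; split=> // h hr.
have [|l hl] := @abs_summable _ (fun i => u i * h ^+ i) B; last by rewrite (psum_tends hl).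
move=> N; apply: le_trans (hB N); apply: ler_sum => i _.
by rewrite moM moX ler_wpM2l ?mo_ge0 // pow_le ?mo_ge0.
Qed.

Lemma psumE r B u f h : pser r B u f -> mo h <= r -> psum u h = f h.
Proof. by case=> _ hf hr; apply: psum_tends; apply: hf. Qed.

Lemma psum_mul1D r B B' (u v : nat -> C) h : 0 <= r -> pser r B u (psum u) -> pser r B' v (psum v) ->
  (forall n, v n = u n + shiftS u n) -> mo h <= r -> psum v h = (1 + h) * psum u h.
Proof.
move=> r0 hu hv uv hr; have huS := pser_add hu (pser_shift hu r0) r0.
have E : v = fun n => u n + shiftS u n by apply/funext.
by rewrite mulrDl mul1r E (psumE huS hr).
Qed.

Definition cseq (f : nat -> R) n : C := ofR (f n).

Lemma cseq_sum r (f : nat -> R) N :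
  \sum_(i < N) mo (cseq f i) * r ^+ i = \sum_(i < N) `|f i| * r ^+ i.
Proof. by apply: eq_bigr => i _; rewrite mo_ofR. Qed.

Arguments tcoef : simpl never.

Lemma tcoefSS k x n : tcoef k.+1 x n.+1 = 4 * tcoef k (x + 2) n.
Proof. by []. Qed.

Lemma tcoef_pser0 (j : nat) :
  pser (1 / 10) ((10 / 9) ^+ j) (cseq (tcoef 0 j%:R)) (fun w => (1 + w) ^- j).
Proof.
have r0 : 0 < 1 / 10 :> R by lra.
elim: j => [|j IH].
  rewrite expr0 -(mo1 R); apply: pser_eq (_ : pser _ _ _ (fun=> 1)) => [h _|].
    by rewrite expr0 invr1.
  rewrite (_ : cseq _ = fun n => if n == 0%N then 1 else 0); first exact: pser_cst.
  apply/funext => -[|n]; rewrite /cseq /tcoef /= /binom_coef ?pochSl.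
    by rewrite expr0 poch0 fact0 divr1 mulr1 rmorph1.
  by rewrite !mul0r mulr0 rmorph0.
have hb N : \sum_(i < N) mo (cseq (tcoef 0 j.+1%:R) i) * (1 / 10) ^+ i <= (10 / 9) ^+ j.+1.
  rewrite cseq_sum.
  apply: (@le_trans _ _ ((\sum_(i < N) `|tcoef 0 (j%:R : R) i| * (1 / 10) ^+ i) / (1 - 1 / 10))).
    apply: (@weighted_div _ (fun n => `|tcoef 0 (j.+1%:R : R) n|) (fun n => `|tcoef 0 (j%:R : R) n|)) => //; try lra.
    move=> [|n] /=; first by rewrite !tcoef0 addr0.
    by rewrite -(tcoef_up 0 j%:R n) natr1 -{1}[tcoef 0 _ n.+1](addrK (tcoef 0 j.+1%:R n)) ler_normB.
  rewrite ler_pdivrMr; last by lra.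
  have := IH.1 N; rewrite cseq_sum exprS; lra.
apply: pser_eq (psum_pser hb) => h hr.
have h1 : 1 + h != 0.
  apply/eqP => h0; have := mo_geD 1 h; rewrite h0 mo0 mo1; lra.
apply: (mulfI h1).
rewrite -(psum_mul1D (ltW r0) (psum_pser hb) (psum_pser IH.1)) //.
  by rewrite (psumE IH) // exprS invfM mulrA divff // mul1r.
move=> [|n]; first by rewrite /cseq !tcoef0 addr0.
by rewrite /cseq /= -(tcoef_up 0 j%:R n) natr1 rmorphD.
Qed.

(** At radius 1/10 the norm of z = 4w/(1+w)^2 is at most (4/10)(10/9)^2 = 40/81.
    Since this is below 1, a power series in z convergent in the unit disc may be
    rearranged in powers of w. *)
Lemma tcoef_pser k (j : nat) :
  pser (1 / 10) ((4 / 10) ^+ k * (10 / 9) ^+ (j + 2 * k))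
    (cseq (tcoef k j%:R)) (fun w => (4 * w) ^+ k * (1 + w) ^- (j + 2 * k)).
Proof.
have r0 : 0 <= 1 / 10 :> R by lra.
elim: k j => [|k IH] j.
  rewrite muln0 addn0 expr0 [1 * _ ^+ _]mul1r.
  by apply: pser_eq (tcoef_pser0 j) => h _; rewrite expr0 mul1r.
have e : (j + 2 * k.+1 = j.+2 + 2 * k)%N by lia.
have := pser_scale 4 (pser_shift (IH j.+2) r0).
have -> : (fun n => 4 * shiftS (cseq (tcoef k j.+2%:R)) n) = cseq (tcoef k.+1 j%:R) :> (nat -> C).
  apply/funext => -[|n]; rewrite /cseq /=; first by rewrite tcoef0 mulr0 rmorph0.
  have -> : j.+2%:R = j%:R + 2 :> R by rewrite -natrD addn2.
  by rewrite tcoefSS rmorphM rmorph_nat.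
have -> : mo (4 : C) = 4 by rewrite -(rmorph_nat (@ofR R)) mo_ofR ger0_norm.
rewrite -e !exprS => h.
have -> : 4 / 10 * (4 / 10) ^+ k * (10 / 9) ^+ (j + 2 * k.+1) =
   4 * (1 / 10 * ((4 / 10) ^+ k * (10 / 9) ^+ (j + 2 * k.+1))) :> R by ring.
by apply: pser_eq h => h _; rewrite !exprS; ring.
Qed.

Variables (a b c : R).
Hypothesis hc : forall n : nat, - c != n%:R.
Let f := hcoef a b c.

Lemma hcoef_summable r : 0 < r -> r < 1 -> exists B, forall K, \sum_(i < K) `|f i| * r ^+ i <= B.
Proof.
apply: ratio_summable => e e0.
pose d := Num.min 1 (e / 3); have d0 : 0 < d by rewrite lt_min ltr01 divr_gt0.
have [d1 d3] : d <= 1 /\ d <= e / 3 by rewrite !ge_min !lexx orbT.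
have [N1 h1] := shifted_ratio_near1 a c d0.
have [N2 h2] := shifted_ratio_near1 b 1 d0.
exists (maxn N1 N2) => n; rewrite geq_max => /andP[/h1 [c0 hA] /h2 [_ hB]].
have n0 : 0 < n.+1%:R :> R by rewrite ltr0n.
have p0 : 0 < (n%:R + c) * n.+1%:R by rewrite mulr_gt0 // addrC.
rewrite -(ler_pM2l p0) -{1}[_ * n.+1%:R]ger0_norm ?(ltW p0) // -normrM (hcoefS _ _ hc) -/f.
move: (f n) => fn; rewrite !normrM.
rewrite mulrA ler_wpM2r // (addrC n%:R a) (addrC n%:R b).
have -> : (n%:R + c) * n.+1%:R * (1 + e) = (1 + e) * ((c + n%:R) * (1 + n%:R)).
  by rewrite nat1r; ring.
apply: (@le_trans _ _ ((1 + d) * (c + n%:R) * ((1 + d) * (1 + n%:R)))).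
  by rewrite ler_pM.
have -> : (1 + d) * (c + n%:R) * ((1 + d) * (1 + n%:R)) = (1 + d) ^+ 2 * ((c + n%:R) * (1 + n%:R)) by ring.
rewrite ler_wpM2r //; first by rewrite mulr_ge0 // ltW.
have dd : d * d <= d by rewrite ler_piMl // ltW.
have -> : (1 + d) ^+ 2 = 1 + 2 * d + d * d by ring.
lra.
Qed.

Lemma ucoef_summable_nat (m : nat) r : 0 < r -> r < 1 ->
  exists B, forall K, \sum_(i < K) `|ucoef m%:R f i| * r ^+ i <= B.
Proof.
move=> r0 r1; elim: m => [|m [B hB]]; first exact: ucoef_summable hc _ r0 r1.
exists (B / (1 - r)) => K.
have r1' : 0 < 1 - r by rewrite subr_gt0.
apply: (@le_trans _ _ ((\sum_(i < K) `|ucoef m%:R f i| * r ^+ i) / (1 - r))).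
  apply: (@weighted_div _ (fun n => `|ucoef m.+1%:R f n|) (fun n => `|ucoef m%:R f n|)) => //.
    exact: ltW.
  move=> [|n]; first by rewrite !ucoef_0 addr0.
  by rewrite -(ucoef_up m%:R f n) natr1 -{1}[ucoef _ _ n.+1](addrK (ucoef m.+1%:R f n)) ler_normB.
by rewrite ler_pM2r ?invr_gt0.
Qed.

(** The function (1+w)^(-m) F(4w/(1+w)^2) on the unit disc. *)
Definition ufun (m : nat) : C -> C := psum (cseq (ucoef m%:R f)).

Lemma ufun_pser m r : 0 < r -> r < 1 -> exists B, pser r B (cseq (ucoef m%:R f)) (ufun m).
Proof.
move=> r0 r1; have [B hB] := ucoef_summable_nat m r0 r1.
by exists B; apply: psum_pser => N; rewrite cseq_sum.
Qed.

Lemma radius_between w : mo w < 1 -> exists r, [/\ 0 < r, r < 1 & mo w < r].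
Proof. by move=> w1; have := mo_ge0 w; exists ((1 + mo w) / 2); split; lra. Qed.

Lemma ufun_up m w : mo w < 1 -> ufun m w = (1 + w) * ufun m.+1 w.
Proof.
move=> /radius_between [r [r0 r1 wr]].
have [B hB] := ufun_pser m r0 r1; have [B' hB'] := ufun_pser m.+1 r0 r1.
apply: (psum_mul1D (ltW r0) hB' hB _ (ltW wr)) => -[|n].
  by rewrite /cseq !ucoef_0 addr0.
by rewrite /cseq /= -(ucoef_up m%:R f n) natr1 rmorphD.
Qed.

Lemma ufun_pow m w : mo w < 1 -> ufun 0 w = (1 + w) ^+ m * ufun m w.
Proof.
move=> w1; elim: m => [|m IH]; first by rewrite expr0 mul1r.
by rewrite IH (ufun_up m w1) exprSr mulrA.
Qed.

Definition hsum : C -> C := psum (cseq f).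

Lemma hsum_pser r : 0 < r -> r < 1 -> exists B, pser r B (cseq f) hsum.
Proof.
move=> r0 r1; have [B hB] := hcoef_summable r0 r1.
by exists B; apply: psum_pser => N; rewrite cseq_sum.
Qed.

Lemma ufun_near0 w : mo w <= 1 / 10 -> ufun 0 w = hsum (4 * w / (1 + w) ^+ 2).
Proof.
have r0 : 0 < 1 / 10 :> R by lra.
have [||B hB] := @hcoef_summable (40 / 81); [lra|lra|].
have [||B1 hB1] := @hsum_pser (40 / 81); [lra|lra|].
suff : pser (1 / 10) B (cseq (ucoef 0 f)) (fun w => hsum (4 * w / (1 + w) ^+ 2)).
  by move=> h hw; rewrite -(psumE h hw).
have hk k := pser_scale (ofR (f k)) (tcoef_pser k 0).
apply: (pser_series r0 hk).
- move=> K; apply: le_trans (hB K); apply: ler_sum => k _.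
  rewrite mo_ofR ler_wpM2l // add0n exprM -exprMn.
  by rewrite (_ : 4 / 10 * (10 / 9) ^+ 2 = 40 / 81 :> R) //; field.
- move=> n; apply: (@tends_eventually _ _ _ n.+1) => K nK.
  rewrite /cseq (ucoef_widen _ _ nK) rmorph_sum; apply: eq_bigr => k _.
  by rewrite rmorphM.
- move=> h hr.
  have m9 : 9 / 10 <= mo (1 + h) by have := mo_geD 1 h; rewrite mo1; lra.
  have m0 : 0 < mo (1 + h) by lra.
  have : mo (4 * h / (1 + h) ^+ 2) <= 40 / 81.
    rewrite !moM moV moX -(rmorph_nat (@ofR R)) mo_ofR ger0_norm //.
    rewrite ler_pdivrMr ?exprn_gt0 //.
    have := mo_ge0 h; nra.
  move=> /hB1.2; apply: tends_eq => K; apply: eq_bigr => k _.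
  by rewrite add0n [in LHS]exprMn exprVn -exprM.
Qed.

(** Near the origin this is the hypergeometric series, and the right-hand side is
    analytic on the slit plane: it is the required continuation. *)
Definition hyp_slit z := ufun 0 (unif z).

Lemma ana_hyp_slit z : slit_plane z -> ana hyp_slit z.
Proof.
move=> hz; have [w1 _] := unifP hz; have [r [r0 r1 wr]] := radius_between w1.
have [B hB] := ufun_pser 0 r0 r1.
exact: ana_powerseries (ana_unif hz) hB wr.
Qed.

Lemma unif0 : unif (0 : C) = 0.
Proof. by apply: unifE; rewrite ?mo0 // mul0r mulr0. Qed.

Lemma slit0 : slit_plane (0 : C).
Proof. by apply: disc_slit; rewrite mo0. Qed.

Lemma hyp_slit_near0 : exists2 d, 0 < d & forall h, mo h < d -> hyp_slit h = hsum h.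
Proof.
have [|d d0 hd] := @ana_continuous _ _ _ (1 / 10) (ana_unif slit0); first by lra.
exists (Num.min d 1); first by rewrite lt_min d0 ltr01.
move=> h; rewrite lt_min => /andP[h1 h2].
have := hd h h1; rewrite add0r unif0 subr0 => hw.
have [w1 E] := unifP (disc_slit h2).
rewrite /hyp_slit (ufun_near0 (ltW hw)) -E mulfK // expf_neq0 //.
by apply/eqP => h0; have := mo_geD 1 (unif h); rewrite h0 mo0 mo1; lra.
Qed.

Lemma ana_hsum z : mo z < 1 -> ana hsum z.
Proof.
move=> /radius_between [r [r0 r1 zr]]; have [B hB] := hsum_pser r0 r1.
exact: ana_powerseries (ana_id z) hB zr.
Qed.

(** The rearrangement only covers a neighbourhood of the origin; the identity
    theorem extends it to the disc. *)
Lemma hyp_slit_disc z : mo z < 1 -> hyp_slit z = hsum z.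
Proof.
move: z; apply: (@identity_star2 _ [set z | mo z < 1]) => /=.
- move=> z t hz /andP[t0 t1]; rewrite moM mo_ofR ger0_norm //.
  by apply: le_lt_trans hz; rewrite ler_piMl ?mo_ge0.
- by move=> z hz; apply: ana_hyp_slit; apply: disc_slit.
- exact: ana_hsum.
- exact: hyp_slit_near0.
Qed.

Lemma is_hyp_slit : is_hyp2F1 a b c hyp_slit.
Proof.
split=> z hz; first by apply/anaP; apply: ana_hyp_slit.
have {}hz : mo z < 1 by rewrite -lt_mo rmorph1.
apply/cvg_tends; rewrite (hyp_slit_disc hz).
have [r [r0 r1 zr]] := radius_between hz; have [B hB] := hsum_pser r0 r1.
apply: tends_eq (hB.2 z (ltW zr)) => N; by rewrite /series /= big_mkord.
Qed.

Lemma hyp2F1P : is_hyp2F1 a b c (hyp2F1 a b c).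
Proof. exact: (xgetPex (fun=> 0) (ex_intro (is_hyp2F1 a b c) _ is_hyp_slit)). Qed.

Lemma hyp2F1_uniq F z : is_hyp2F1 a b c F -> slit_plane z -> hyp2F1 a b c z = F z.
Proof.
move=> hF; have h := hyp2F1P; move: z.
apply: (@identity_star2 _ (@slit_plane R)); first exact: slit_plane_star.
- by move=> z hz; apply/anaP; apply: h.1.
- by move=> z hz; apply/anaP; apply: hF.1.
exists 1 => // z hz; have hz' : `|z| < 1 by rewrite -(rmorph1 (@ofR R)) lt_mo.
exact: seq_cvg_unique (h.2 z hz') (hF.2 z hz').
Qed.

Lemma hyp2F1E z : slit_plane z -> hyp2F1 a b c z = hyp_slit z.
Proof. exact: hyp2F1_uniq is_hyp_slit. Qed.

Lemma hyp2F1_hsum z : mo z < 1 -> hyp2F1 a b c z = hsum z.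
Proof. by move=> hz; rewrite hyp2F1E ?hyp_slit_disc //; apply: disc_slit. Qed.

Lemma ana_hyp2F1 z : slit_plane z -> ana (hyp2F1 a b c) z.
Proof. by move=> hz; apply/anaP; apply: hyp2F1P.1. Qed.

Lemma slit_plane_conj z : slit_plane z -> slit_plane z^*.
Proof.
by move=> hz [h1 h2]; apply: hz; move: h1 h2; rewrite cIm_conj cRe_conj => /eqP; rewrite oppr_eq0 => /eqP.
Qed.

(** Both sides continue the same series, whose coefficients are real. *)
Lemma hyp2F1_conj z : slit_plane z -> hyp2F1 a b c z^* = (hyp2F1 a b c z)^*.
Proof.
move=> hz; rewrite -[LHS]conjCK; congr (_^*); symmetry.
apply: (@hyp2F1_uniq (fun z => (hyp2F1 a b c z^*)^*)) => //; split=> {z hz} [z hz|z hz].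
  apply/anaP; rewrite -[z]conjCK; apply: ana_conj; apply: ana_hyp2F1; exact: slit_plane_conj.
have hz' : `|z^*| < 1 by rewrite norm_conjC.
apply/cvg_tends; have /cvg_tends/tends_conj := hyp2F1P.2 _ hz'; apply: tends_eq => N.
rewrite /series /= !big_mkord rmorph_sum; apply: eq_bigr => i _.
by rewrite rmorphM rmorphXn /= conjCK conj_ofR.
Qed.

Lemma hyp2F1_0 : hyp2F1 a b c 0 = 1.
Proof.
rewrite hyp2F1_hsum ?mo0 //; have [||B hB] := @hsum_pser (1 / 2); [lra|lra|].
have r0 : 0 <= 1 / 2 :> R by lra.
by rewrite (pser_at0 r0 hB) /cseq /f hcoef_0 rmorph1.
Qed.

End Existence.

(** * The continued fraction of Gauss and the decay of its remainder *)

Section GaussFraction.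
Variable R : realType.
Local Notation C := (Cx R).
Implicit Types (x y : R) (z w h : C).

(** Gauss's contiguous relation, coefficient by coefficient. *)
Lemma hcoef_contiguous (a b c : R) k : (forall n : nat, c + n%:R != 0) ->
  hcoef a b c k.+1 = hcoef (b + 1) a (c + 1) k.+1 -
    a * (c - b) / (c * (c + 1)) * hcoef (a + 1) (b + 1) (c + 1 + 1) k.
Proof.
move=> hc; rewrite /hcoef.
have k0 : 1 + k%:R != 0 :> R by rewrite nat1r pnatr_eq0.
have c0 : c != 0 by have := hc 0%N; rewrite addr0.
have c1 : c + 1 != 0 by have := hc 1%N.
have c2 : c + 1 + k%:R != 0 by have := hc k.+1; rewrite -nat1r addrA.
have r0 : poch (c + 1) k != 0.
  by apply/prodf_neq0 => i _; have := hc i.+1; rewrite -nat1r addrA.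
have E : poch (c + 1 + 1) k = poch (c + 1) k * (c + 1 + k%:R) / (c + 1).
  by apply: (mulfI c1); rewrite -pochSl pochS [RHS]mulrC mulfVK.
rewrite E (pochSl a) (pochSl b) (pochSl c) (pochS (b + 1)) (pochS (c + 1)) factS natrM -nat1r.
move: (poch (a + 1) k) (poch (b + 1) k) (poch (c + 1) k) (k`!%:R) (fact_neq0 R k) r0 => p q r v v0 r0.
move: (k%:R) k0 c2 => m k0 c2.
by field; rewrite ?v0 ?r0 ?c2 ?k0 ?c0 ?c1.
Qed.

Variables (a b c : R).
Hypothesis hc : forall n : nat, - c != n%:R.

(** The first two parameters of the functions F_m of Gauss's sequence; the third
    one is c + m. *)
Fixpoint parab (m : nat) : R * R :=
  if m is m'.+1 then ((parab m').2 + 1, (parab m').1) else (a, b).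
Definition parA m := (parab m).1.
Definition parB m := (parab m).2.

Lemma parAS m : parA m.+1 = parB m + 1. Proof. by []. Qed.
Lemma parBS m : parB m.+1 = parA m. Proof. by []. Qed.

(** The partial numerators d_m of the continued fraction. *)
Definition gaussd m : R := parA m * (c + m%:R - parB m) / ((c + m%:R) * (c + m%:R + 1)).

Lemma c_shift_admissible m : forall n : nat, - (c + m%:R) != n%:R.
Proof. by move=> n; rewrite opprD subr_eq -natrD. Qed.

Definition gauss_coef m := hcoef (parA m) (parB m) (c + m%:R).

Lemma gauss_coef_contiguous m k : gauss_coef m k.+1 = gauss_coef m.+1 k.+1 - gaussd m * gauss_coef m.+2 k.
Proof.
have e1 : c + m.+1%:R = c + m%:R + 1 by rewrite -addrA natr1.
have e2 : c + m.+2%:R = c + m%:R + 1 + 1 by rewrite -(natr1 m.+1) -(natr1 m) !addrA.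
rewrite /gauss_coef e1 e2 hcoef_contiguous //; exact: (c_shift_neq0 (c_shift_admissible m)).
Qed.

Definition gaussF m := hyp2F1 (parA m) (parB m) (c + m%:R).

Lemma hyp2F1_sym (x y u : R) : hyp2F1 x y u = hyp2F1 y x u.
Proof.
rewrite /hyp2F1; congr (xget _ _); apply/seteqP; split=> F [h1 h2]; split=> // z hz;
  by under [fun n => _]funext do rewrite [poch _ _ * _]mulrC; apply: h2.
Qed.

(** The three-term relation whose iteration is the continued fraction
    1/(1 - d_0 z/(1 - d_1 z/(1 - ...))) of F_1 / F_0. *)
Lemma gaussF_contiguous m z : slit_plane z -> gaussF m z = gaussF m.+1 z - ofR (gaussd m) * (z * gaussF m.+2 z).
Proof.
move: z; apply: (@identity_star2 _ (@slit_plane R)); first exact: slit_plane_star.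
- by move=> z; apply: ana_hyp2F1; apply: c_shift_admissible.
- move=> z hz; apply: anaB; first by apply: ana_hyp2F1 hz; apply: c_shift_admissible.
  apply: anaM (ana_cst _ _) (anaM (ana_id _) _).
  by apply: ana_hyp2F1 hz; apply: c_shift_admissible.
exists (1 / 2) => [|h hh]; first by lra.
have h1 : mo h < 1 by lra.
rewrite /gaussF !(hyp2F1_hsum _ _ (c_shift_admissible _) h1).
have [r0 r1] : 0 < 1 / 2 :> R /\ 1 / 2 < 1 :> R by split; lra.
have [B0 hB0] := hsum_pser (parA m) (parB m) (c_shift_admissible m) r0 r1.
have [B1 hB1] := hsum_pser (parA m.+1) (parB m.+1) (c_shift_admissible m.+1) r0 r1.
have [B2 hB2] := hsum_pser (parA m.+2) (parB m.+2) (c_shift_admissible m.+2) r0 r1.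
have hS := pser_add hB1 (pser_scale (- ofR (gaussd m)) (pser_shift hB2 (ltW r0))) (ltW r0).
rewrite -mulNr -(psumE hS (ltW hh)) -(psumE hB0 (ltW hh)); congr (psum _ _).
apply/funext => -[|n].
  by rewrite /cseq /shiftS mulr0 addr0 !hcoef_0.
rewrite /cseq /shiftS.
by have := gauss_coef_contiguous m n; rewrite /gauss_coef => ->; rewrite rmorphB (rmorphM (@ofR R) (gaussd m)) mulNr.
Qed.

(** The coefficients of (1+w)^(-m) F_m(4w/(1+w)^2). With this normalization the
    recurrence in [m] has the constant sequences as solutions at d_m = 1/4, the
    limiting value. *)
Definition gauss_ucoef m n : R := ucoef m%:R (gauss_coef m) n.

Lemma gauss_ucoef_step m n : gauss_ucoef m.+1 n.+1 - gauss_ucoef m n.+1 = (gauss_ucoef m.+2 n - gauss_ucoef m.+1 n) + (4 * gaussd m - 1) * gauss_ucoef m.+2 n.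
Proof.
rewrite /gauss_ucoef (@ucoef_contiguous _ m%:R _ (gauss_coef m.+1) (gauss_coef m.+2) (gaussd m)); last exact: gauss_coef_contiguous.
  rewrite -(ucoef_up m%:R (gauss_coef m.+1) n) natr1 -natrD addn2; ring.
by rewrite /gauss_coef !hcoef_0.
Qed.

Lemma gauss_ucoef_0 m : gauss_ucoef m 0 = 1.
Proof. by rewrite /gauss_ucoef ucoef_0 /gauss_coef hcoef_0. Qed.

(** [X] is the norm truncated at degree [N] and [Y] that of the increment in [m].
    The hypotheses say that the perturbation 4 d_m - 1 is too small to make the
    increments exceed the fraction [d] of the norm. *)
Section Norms.
Variables (r d e : R) (M : nat).
Hypotheses (r0 : 0 < r) (d0 : 0 < d) (hrde : r * (d * (1 + d) + e * (1 + d) ^+ 2) <= d)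
  (hM : forall m, (M <= m)%N -> `|4 * gaussd m - 1| <= e).
Let X m N := \sum_(i < N) `|gauss_ucoef m i| * r ^+ i.
Let Y m N := \sum_(i < N) `|gauss_ucoef m.+1 i - gauss_ucoef m i| * r ^+ i.

Lemma X_ge0 m N : 0 <= X m N.
Proof. by apply: sumr_ge0 => i _; rewrite mulr_ge0 ?exprn_ge0 // ltW. Qed.

Lemma X_step m N : X m.+1 N <= X m N + Y m N.
Proof.
rewrite -big_split; apply: ler_sum => i _ /=; rewrite -mulrDl ler_wpM2r ?exprn_ge0 ?(ltW r0) //.
by rewrite -{1}[gauss_ucoef m.+1 i](subrK (gauss_ucoef m i)) [leRHS]addrC ler_normD.
Qed.

(** The recurrence expresses the increment through those of the next two indices
    times w. That factor lowers the degree, so the truncation order serves as the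
    induction variable although the index grows. *)
Lemma Y_le m N : (M <= m)%N -> Y m N <= d * X m N.
Proof.
elim: N m => [|N IH] m Mm; first by rewrite /X /Y !big_ord0 mulr0.
have e0 : 0 <= e by apply: le_trans (hM Mm).
have XN : X m N <= X m N.+1.
  by rewrite {2}/X big_ord_recr /= lerDl mulr_ge0 ?exprn_ge0 // ltW.
have h1 : Y m N.+1 <= r * (Y m.+1 N + e * X m.+2 N).
  rewrite {1}/Y big_ord_recl !gauss_ucoef_0 subrr normr0 mul0r add0r.
  rewrite mulr_sumr -big_split mulr_sumr; apply: ler_sum => i _ /=.
  rewrite /bump /= add1n exprS mulrCA ler_wpM2l ?(ltW r0) // mulrA -mulrDl.
  rewrite ler_wpM2r ?exprn_ge0 ?(ltW r0) // gauss_ucoef_step (le_trans (ler_normD _ _)) // lerD2l.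
  by rewrite normrM ler_wpM2r // hM.
have S1 : X m.+1 N <= (1 + d) * X m N.
  by apply: le_trans (X_step m N) _; rewrite mulrDl mul1r lerD2l IH.
have S2 : X m.+2 N <= (1 + d) * X m.+1 N.
  by apply: le_trans (X_step m.+1 N) _; rewrite mulrDl mul1r lerD2l IH // leqW.
have S3 : X m.+2 N <= (1 + d) ^+ 2 * X m N.
  by apply: le_trans S2 _; rewrite expr2 -mulrA ler_wpM2l // addr_ge0 // ltW.
apply: le_trans h1 _.
have hY := IH m.+1 (leqW Mm).
apply: (@le_trans _ _ (r * (d * ((1 + d) * X m N) + e * ((1 + d) ^+ 2 * X m N)))).
  rewrite ler_wpM2l ?(ltW r0) // lerD //; last by rewrite ler_wpM2l.
  by apply: le_trans hY _; rewrite ler_wpM2l // ltW.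
apply: le_trans (ler_wpM2l (ltW d0) XN).
have -> : r * (d * ((1 + d) * X m N) + e * ((1 + d) ^+ 2 * X m N)) =
  r * (d * (1 + d) + e * (1 + d) ^+ 2) * X m N by ring.
by rewrite ler_wpM2r ?X_ge0.
Qed.

Lemma X_growth j N : X (M + j) N <= (1 + d) ^+ j * X M N.
Proof.
elim: j => [|j IH]; first by rewrite addn0 expr0 mul1r.
rewrite addnS; apply: le_trans (X_step _ _) _.
have := Y_le N (leq_addr j M); rewrite exprS -mulrA => hY.
apply: (@le_trans _ _ ((1 + d) * X (M + j) N)); first by rewrite mulrDl mul1r lerD2l.
by rewrite ler_wpM2l // addr_ge0 // ltW.
Qed.

End Norms.

(** Both parameters stay at bounded distance of (c+m)/2, which is why d_m tends to
    1/4. *)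
Lemma par_bounded : exists U, forall m, `|2 * parA m - (c + m%:R)| <= U /\ `|c + m%:R - 2 * parB m| <= U.
Proof.
pose u0 := 2 * a - c; pose v0 := c - 2 * b.
exists (1 + `|u0| + `|v0|) => m.
have : (2 * parA m - (c + m%:R) = u0 /\ c + m%:R - 2 * parB m = v0) \/
       (2 * parA m - (c + m%:R) = 1 - v0 /\ c + m%:R - 2 * parB m = 1 - u0).
  elim: m => [|m IH]; first by left; rewrite /u0 /v0 /parA /parB /= addr0.
  rewrite parAS parBS -nat1r; case: IH => -[h1 h2]; [right|left]; split; lra.
have := normr_ge0 u0; have := normr_ge0 v0.
have := ler_normB 1 u0; have := ler_normB 1 v0; rewrite normr1.
by move=> ? ? ? ? [[-> ->]|[-> ->]]; split; lra.
Qed.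

Lemma gaussd_limit e : 0 < e -> exists M, forall m, (M <= m)%N -> `|4 * gaussd m - 1| <= e.
Proof.
move=> e0; have [U hU] := par_bounded.
have U0 : 0 <= U by apply: le_trans (hU 0%N).1.
pose V := 2 * U + 1 + U * U; have V0 : 0 <= V by rewrite !addr_ge0 // mulr_ge0.
exists (Num.truncn (V / e + `|c| + 1)).+1 => m hm.
have hm' : V / e + `|c| + 1 <= m%:R.
  by apply: le_trans (ltW (truncnS_gt _)) _; rewrite ler_nat.
have Ve : 0 <= V / e by rewrite divr_ge0 // ltW.
have hc1 : - c <= `|c| by rewrite -normrN ler_norm.
have C1 : 1 <= c + m%:R by lra.
have CV : V / e <= c + m%:R by lra.
have [h1 h2] := hU m.
have -> : 4 * gaussd m - 1 = ((c + m%:R) * ((2 * parA m - (c + m%:R)) + (c + m%:R - 2 * parB m) - 1)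
   + (2 * parA m - (c + m%:R)) * (c + m%:R - 2 * parB m)) / ((c + m%:R) * (c + m%:R + 1)).
  by rewrite /gaussd; field; lra.
move: (2 * parA m - (c + m%:R)) (c + m%:R - 2 * parB m) h1 h2 => x y hx hy.
move: (c + m%:R) C1 CV => t t1 tV.
have t0 : 0 < t by lra.
have tt : 0 < t * (t + 1) by rewrite mulr_gt0 // addr_gt0.
rewrite normrM normfV (ger0_norm (ltW tt)) ler_pdivrMr //.
apply: (@le_trans _ _ (t * V)); last first.
  rewrite mulrCA ler_pM2l //; move: tV; rewrite ler_pdivrMr // => tV.
  by apply: le_trans tV _; rewrite mulrC ler_pM2l // lerDl.
apply: le_trans (ler_normD _ _) _; rewrite !normrM (ger0_norm (ltW t0)).
have hxy : `|x + y - 1| <= 2 * U + 1.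
  by apply: le_trans (ler_normB _ _) _; rewrite normr1 lerD2r; apply: le_trans (ler_normD _ _) _; lra.
have hp : `|x| * `|y| <= U * U by rewrite ler_pM.
apply: (@le_trans _ _ (t * (2 * U + 1) + U * U)); first by rewrite lerD // ler_pM2l.
have -> : t * V = t * (2 * U + 1) + t * (U * U) by rewrite /V; ring.
by rewrite lerD2l ler_peMl // mulr_ge0.
Qed.

Definition gaussD i n : R := \prod_(k < n) gaussd (i + k).

Lemma gaussD_growth i e : 0 < e -> exists2 B, 0 <= B & forall n, `|gaussD i n| <= B * ((1 + e) / 4) ^+ n.
Proof.
move=> e0; have [M hM] := gaussd_limit e0.
have e4 : 0 < (1 + e) / 4 by rewrite divr_gt0 // addr_gt0.
exists (\sum_(k < M.+1) `|gaussD i k| / ((1 + e) / 4) ^+ k).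
  by apply: sumr_ge0 => k _; rewrite divr_ge0 // exprn_ge0 // ltW.
have small n : (n <= M)%N ->
    `|gaussD i n| <= (\sum_(k < M.+1) `|gaussD i k| / ((1 + e) / 4) ^+ k) * ((1 + e) / 4) ^+ n.
  move=> nM; rewrite -ler_pdivrMr ?exprn_gt0 //.
  rewrite (bigD1 (Ordinal (nM : (n < M.+1)%N))) //= lerDl; apply: sumr_ge0 => k _.
  by rewrite divr_ge0 // exprn_ge0 // ltW.
elim=> [|n IH]; first by apply: small.
case: (leqP n.+1 M) => nM; first exact: small.
rewrite /gaussD big_ord_recr /= -/(gaussD i n) normrM exprSr mulrA ler_pM //.
have := hM (i + n)%N (leq_trans (nM : (M <= n)%N) (leq_addl i n)).
rewrite ler_norml => /andP[h1 h2]; rewrite ler_norml; apply/andP; split; lra.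
Qed.

Lemma gaussF_uniformized m z : slit_plane z ->
  gaussF m z = (1 + unif z) ^+ m * ufun (parA m) (parB m) (c + m%:R) m (unif z).
Proof.
move=> hz; rewrite /gaussF (hyp2F1E _ _ (c_shift_admissible m) hz) /hyp_slit.
by rewrite (ufun_pow _ _ (c_shift_admissible m) m (unifP hz).1).
Qed.

(** Here F_m = (1+w)^m u_m with u_m of norm O((1+d)^m), and |z| |1+w|^2 = 4|w|: the
    powers of z take away those of 1 + w. The offsets [i] and [x] only affect
    the constant. *)
Lemma gaussF_growth r (i : nat) (d : R) : 0 < r -> r < 1 -> 0 < d -> r * (1 + d) ^+ 2 < 1 ->
  exists M K, 0 <= K /\ forall J (x : nat) z, (M <= J)%N -> (x <= 1)%N -> slit_plane z -> mo (unif z) <= r ->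
    mo z ^+ J * mo (gaussF (i + 2 * J + x) z) <= K * (4 * r * (1 + d) ^+ 2) ^+ J.
Proof.
move=> r0 r1 d0 hrd.
have rd : r * (1 + d) < 1.
  apply: le_lt_trans hrd; rewrite expr2 mulrA ler_peMr //; last by rewrite lerDl ltW.
  by rewrite mulr_ge0 ?addr_ge0 // ltW.
(* Chosen to make r (d (1+d) + e (1+d)^2) <= d. *)
pose e := d * (1 - r * (1 + d)) / (1 + d) ^+ 2.
have d1 : 0 < 1 + d by rewrite addr_gt0.
have e0 : 0 < e by rewrite divr_gt0 ?exprn_gt0 // mulr_gt0 // subr_gt0.
have hrde : r * (d * (1 + d) + e * (1 + d) ^+ 2) <= d.
  rewrite /e mulfVK ?gt_eqF ?exprn_gt0 //.
  have h2 : r * (1 - r * (1 + d)) <= 1 - r * (1 + d).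
    by rewrite ler_piMl ?(ltW r1) // subr_ge0 ltW.
  have -> : r * (d * (1 + d) + d * (1 - r * (1 + d))) =
    (r * (1 + d) + r * (1 - r * (1 + d))) * d by ring.
  by rewrite ler_piMl ?(ltW d0) //; lra.
have [M hM] := gaussd_limit e0.
have [B hB] := ufun_pser (parA M) (parB M) (c_shift_admissible M) M r0 r1.
have B0 := pser_bound_ge0 hB.
exists M, (2 ^+ i.+1 * (1 + d) ^+ i.+1 * B); split.
  by rewrite !mulr_ge0 // exprn_ge0 // ltW.
move=> J x z MJ x1 hz hw; set m := (i + 2 * J + x)%N.
have Mm : (M <= m)%N.
  by rewrite (leq_trans MJ) // /m (leq_trans _ (leq_addr _ _)) // (leq_trans _ (leq_addl _ _)) // leq_pmull.
have [w1 hE] := unifP hz.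
have hQ : mo (ufun (parA m) (parB m) (c + m%:R) m (unif z)) <= (1 + d) ^+ m * B.
  have : pser r ((1 + d) ^+ (m - M) * B) (cseq (gauss_ucoef m)) (psum (cseq (gauss_ucoef m))).
    apply: psum_pser => N; rewrite cseq_sum.
    have := X_growth r0 d0 hrde hM (m - M) N; rewrite subnKC // => h.
    apply: le_trans h _; rewrite ler_wpM2l ?exprn_ge0 ?(ltW d1) //.
    by have := hB.1 N; rewrite cseq_sum.
  move=> /pser_val_le /(_ hw) h; apply: le_trans h _.
  by rewrite ler_wpM2r // ler_weXn2l ?leq_subr // lerDl ltW.
rewrite (gaussF_uniformized m hz) moM moX.
have n0 : 1 + unif z != 0.
  by apply/eqP => h0; have := mo_geD 1 (unif z); rewrite h0 mo0 mo1; lra.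
have n0' : 0 < mo (1 + unif z) by rewrite mo_gt0.
have zE : mo z = 4 * mo (unif z) / mo (1 + unif z) ^+ 2.
  have zE' : z = 4 * unif z / (1 + unif z) ^+ 2 by rewrite -hE mulfK // expf_neq0.
  by rewrite {1}zE' !moM moV moX -(rmorph_nat (@ofR R)) mo_ofR ger0_norm.
have m2 : mo (1 + unif z) <= 2 by have := moD 1 (unif z); rewrite mo1; lra.
have -> : mo z ^+ J * (mo (1 + unif z) ^+ m * mo (ufun (parA m) (parB m) (c + m%:R) m (unif z))) =
  (4 * mo (unif z)) ^+ J * (mo (1 + unif z) ^+ (i + x) * mo (ufun (parA m) (parB m) (c + m%:R) m (unif z))).
  rewrite zE exprMn exprVn -exprM /m -addnA (addnC (2 * J)%N) addnA exprD.
  rewrite -!mulrA; congr (_ * _); rewrite mulrC -!mulrA; congr (_ * _).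
  by rewrite mulrCA mulfV ?mulr1 // gt_eqF // exprn_gt0.
have -> : 2 ^+ i.+1 * (1 + d) ^+ i.+1 * B * (4 * r * (1 + d) ^+ 2) ^+ J =
  (4 * r) ^+ J * (2 ^+ i.+1 * ((1 + d) ^+ (i.+1 + 2 * J) * B)).
  by rewrite exprMn exprD exprM; ring.
apply: ler_pM; rewrite ?exprn_ge0 ?mulr_ge0 ?exprn_ge0 ?mo_ge0 //.
  by apply: pow_le; rewrite ?mulr_ge0 ?mo_ge0 // ler_pM2l.
apply: ler_pM; rewrite ?exprn_ge0 ?mo_ge0 //.
  apply: le_trans (pow_le _ _ m2) _; rewrite ?mo_ge0 //.
  by apply: ler_weXn2l; [lra|rewrite -[i.+1]addn1 leq_add2l].
apply: le_trans hQ _; rewrite ler_wpM2r //; apply: ler_weXn2l; first by rewrite lerDl ltW.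
by rewrite /m addSn -[(i + 2 * J).+1]addn1 leq_add2l.
Qed.

(** The factor 4^J in the growth of each of the two functions meets the decay
    4^(-2J) of the product of the d_m; what is left is (r (1+d)^3)^(2J), and [d] is
    chosen so that r (1+d)^3 < 1. *)
Lemma tail_bound r (i : nat) : 0 < r -> r < 1 ->
  exists M K q, [/\ 0 <= q, q < 1 & forall J (x x' : nat) z z', (M <= J)%N -> (x <= 1)%N -> (x' <= 1)%N ->
    slit_plane z -> slit_plane z' -> mo (unif z) <= r -> mo (unif z') <= r ->
    `|gaussD i (2 * J)| * (mo z ^+ J * mo (gaussF (i + 2 * J + x) z)) * (mo z' ^+ J * mo (gaussF (i + 2 * J + x') z'))
      <= K * q ^+ J].
Proof.
move=> r0 r1; pose d := (1 - r) / 8.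
have d0 : 0 < d by rewrite divr_gt0 // subr_gt0.
(* With r = 1 - 8 d the product is 1 minus a polynomial in d with positive coefficients. *)
have hrd3 : r * (1 + d) ^+ 3 < 1.
  have -> : r = 1 - 8 * d by rewrite /d; field.
  have d8 : d < 1 / 8 by rewrite /d; lra.
  have -> : (1 - 8 * d) * (1 + d) ^+ 3 = 1 - (5 * d + 21 * (d * d) + 23 * (d * d * d) + 8 * (d * d * d * d)) by ring.
  by rewrite gtrBl; do 3?[apply: addr_gt0]; do 4?[apply: mulr_gt0 => //].
have d1 : 0 < 1 + d by rewrite addr_gt0.
have rd2 : r * (1 + d) ^+ 2 < 1.
  apply: le_lt_trans hrd3; rewrite ler_wpM2l ?(ltW r0) // ler_weXn2l // lerDl ltW //.
have [M [K [K0 hK]]] := gaussF_growth i r0 r1 d0 rd2.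
have [B B0 hB] := gaussD_growth i d0.
exists M, (B * K ^+ 2), ((r * (1 + d) ^+ 3) ^+ 2); split.
- by rewrite exprn_ge0 // mulr_ge0 ?exprn_ge0 // ltW.
- by rewrite expr_lt1 // mulr_ge0 ?exprn_ge0 // ltW.
move=> J x x' z z' MJ x1 x1' hz hz' hw hw'.
have -> : B * K ^+ 2 * ((r * (1 + d) ^+ 3) ^+ 2) ^+ J =
  B * ((1 + d) / 4) ^+ (2 * J) * (K * (4 * r * (1 + d) ^+ 2) ^+ J) * (K * (4 * r * (1 + d) ^+ 2) ^+ J).
  have -> : B * ((1 + d) / 4) ^+ (2 * J) * (K * (4 * r * (1 + d) ^+ 2) ^+ J) * (K * (4 * r * (1 + d) ^+ 2) ^+ J) =
    B * K ^+ 2 * (((1 + d) / 4) ^+ (2 * J) * (4 * r * (1 + d) ^+ 2) ^+ J * (4 * r * (1 + d) ^+ 2) ^+ J) by ring.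
  by congr (_ * _); rewrite exprM -!exprMn; congr (_ ^+ J); field.
have P0 (y : nat) v : 0 <= mo v ^+ J * mo (gaussF (i + 2 * J + y) v) by rewrite mulr_ge0 ?exprn_ge0 ?mo_ge0.
apply: ler_pM; [by rewrite mulr_ge0|exact: P0| |exact: hK].
by apply: ler_pM; [|exact: P0|exact: hB|exact: hK].
Qed.

End GaussFraction.

(** * Negative eigenvalues of hermitian matrices *)

Section Inertia.
Variable K : numClosedFieldType.
Implicit Types (m n k : nat).

Definition adjmx m n (A : 'M[K]_(m, n)) : 'M[K]_(n, m) := map_mx Num.conj A^T.

Lemma adjmxK m n (A : 'M[K]_(m, n)) : adjmx (adjmx A) = A.
Proof. by apply/matrixP => i j; rewrite !mxE conjCK. Qed.

Lemma adjmxM m n k (A : 'M[K]_(m, n)) (B : 'M[K]_(n, k)) : adjmx (A *m B) = adjmx B *m adjmx A.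
Proof. by rewrite /adjmx trmx_mul map_mxM. Qed.

Definition qform n (M : 'M[K]_n) (x : 'rV[K]_n) : K := (x *m M *m adjmx x) 0 0.

(** [neg_eigenvalues] over an arbitrary field. *)
Definition negev n (M : 'M[K]_n) : nat :=
  count (fun x => x < 0) (sval (closed_field_poly_normal (char_poly M))).

Lemma char_poly_similar n (P M D : 'M[K]_n) : P \in unitmx -> M = invmx P *m D *m P ->
  char_poly M = char_poly D.
Proof.
move=> Pu ->; rewrite /char_poly /char_poly_mx.
have -> : 'X%:M - map_mx polyC (invmx P *m D *m P) =
    map_mx polyC (invmx P) *m ('X%:M - map_mx polyC D) *m map_mx polyC P.
  rewrite mulmxBr mulmxBl !map_mxM; congr (_ - _).
  by rewrite scalar_mxC -mulmxA -map_mxM mulVmx // map_mx1 mulmx1.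
rewrite !det_mulmx mulrAC -det_mulmx -map_mxM mulVmx // map_mx1 det1 mul1r //.
Qed.

(** The form is diagonal in an orthonormal basis of eigenvectors, and the
    characteristic polynomial is that of the diagonal matrix. *)
Lemma spectral_decomposition n (M : 'M[K]_n) : adjmx M = M ->
  exists (P : 'M[K]_n) (d : 'rV[K]_n),
  [/\ P *m adjmx P = 1%:M /\ P *m M *m adjmx P = diag_mx d, forall i, d 0 i \is Num.real,
      forall x, qform M x = \sum_i d 0 i * `|(x *m adjmx P) 0 i| ^+ 2
    & negev M = #|[pred i | d 0 i < 0]|].
Proof.
move=> hM; have herm : M \is hermsymmx.
  by apply/is_hermitianmxP; rewrite expr0 scale1r; exact: esym hM.
have /orthomx_spectralP E := hermitian_normalmx herm.
have Pu := spectral_unitarymx M; have Pi := spectral_unit M.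
set P := spectralmx M in E Pu Pi; set d := spectral_diag M in E.
have PP : P *m adjmx P = 1%:M by apply/eqP; move: Pu; rewrite qualifE.
exists P, d; split=> //.
- by split=> //; rewrite {1}E (invmx_unitary Pu) !mulmxA PP mul1mx -mulmxA PP mulmx1.
- by move=> i; have /mxOverP := hermitian_spectral_diag_real herm; apply.
- move=> x; have -> : qform M x = (x *m adjmx P *m diag_mx d *m adjmx (x *m adjmx P)) 0 0.
    by rewrite /qform {1}E adjmxM adjmxK (invmx_unitary Pu) !mulmxA.
  rewrite mul_mx_diag !mxE; apply: eq_bigr => i _.
  by rewrite !mxE normCK; ring.
- rewrite /negev; case: closed_field_poly_normal => s /=.
  rewrite (monicP (char_poly_monic M)) scale1r (char_poly_similar Pi E).
  rewrite char_poly_trig; last by apply/is_trig_mxP => i j ij; rewrite !mxE -val_eqE ltn_eqF.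
  have -> : \prod_(i < n) ('X - (diag_mx d i i)%:P) = \prod_(x <- [seq d 0 i | i <- enum 'I_n]) ('X - x%:P).
    by rewrite big_map enumT; apply: eq_bigr => i _; rewrite !mxE eqxx mulr1n.
  move=> /prod_XsubC_eq /permP <-.
  rewrite count_map -sum1_count big_enum_cond /= -sum1_card.
  by apply: eq_bigl => i; rewrite !inE.
Qed.

Lemma left_kernel m n (A : 'M[K]_(m, n)) : (n < m)%N -> exists2 y : 'rV[K]_m, y != 0 & y *m A = 0.
Proof.
move=> nm; have : kermx A != 0.
  by rewrite -mxrank_eq0 mxrank_ker subn_eq0 -ltnNge (leq_ltn_trans (rank_leq_col A)).
move=> /rowV0Pn [y /sub_kermxP yA y0]; by exists y.
Qed.

(** If there were more negative eigenvalues than columns of [W], some nonzero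
    combination of their eigenvectors would be annihilated by [W]. *)
Lemma negev_le n k (M : 'M[K]_n) (W : 'M[K]_(n, k)) : adjmx M = M ->
  (forall x : 'rV[K]_n, x *m W = 0 -> 0 <= qform M x) -> (negev M <= k)%N.
Proof.
move=> hM hW; have [P [d [[PP _] dr hq ->]]] := spectral_decomposition hM.
set S := [pred i | d 0 i < 0]; rewrite leqNgt; apply/negP => kS.
pose E : 'M[K]_(#|S|, n) := \matrix_(i, j) P (enum_val i) j.
have [y y0 yEW] := left_kernel (E *m W) kS.
rewrite mulmxA in yEW; have := hW _ yEW; rewrite hq => /le_gtF/negP; apply.
have EP i j : (E *m adjmx P) i j = (enum_val i == j)%:R.
  have /matrixP/(_ (enum_val i) j) := PP; rewrite !mxE => <-.
  by apply: eq_bigr => l _; rewrite !mxE.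
have yE j : (y *m E *m adjmx P) 0 j = \sum_i y 0 i * (enum_val i == j)%:R.
  by rewrite -mulmxA mxE; apply: eq_bigr => i _; rewrite EP.
have [i0 hi0] : exists i, y 0 i != 0 by apply/rV0Pn.
have yv i : (y *m E *m adjmx P) 0 (enum_val i) = y 0 i.
  rewrite yE (bigD1 i) //= eqxx mulr1 big1 ?addr0 // => l li.
  by rewrite (inj_eq enum_val_inj) (negPf li) mulr0.
have dneg (i : 'I_#|S|) : d 0 (enum_val i) < 0 by have := enum_valP i; rewrite inE.
have out j : j \notin S -> (y *m E *m adjmx P) 0 j = 0.
  move=> jS; rewrite yE big1 // => i _; case: eqP => [ej|]; last by rewrite mulr0.
  by case/negP: jS; rewrite -ej enum_valP.
have nonpos j : d 0 j * `|(y *m E *m adjmx P) 0 j| ^+ 2 <= 0.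
  case: (boolP (j \in S)) => jS; last by rewrite out // normr0 expr0n mulr0.
  by rewrite mulr_le0_ge0 ?exprn_ge0 //; move: jS; rewrite inE => /ltW.
rewrite (bigD1 (enum_val i0)) //= yv.
rewrite -[ltRHS]addr0; apply: ltr_leD; last by apply: sumr_le0 => j _; apply: nonpos.
by rewrite nmulr_rlt0 // exprn_gt0 // normr_gt0.
Qed.

(** If [k] exceeded the number of negative eigenvalues, some combination of the
    rows of [V] would be orthogonal to all their eigenvectors. *)
Lemma negev_ge n k (M : 'M[K]_n) (V : 'M[K]_(k, n)) : adjmx M = M ->
  (forall y : 'rV[K]_k, y != 0 -> qform M (y *m V) < 0) -> (k <= negev M)%N.
Proof.
move=> hM hV; have [P [d [[PP _] dr hq ->]]] := spectral_decomposition hM.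
set S := [pred i | d 0 i < 0]; rewrite leqNgt; apply/negP => kS.
pose W : 'M[K]_(n, #|S|) := \matrix_(i, j) (adjmx P) i (enum_val j).
have [y y0 yVW] := left_kernel (V *m W) kS.
have := hV y y0; rewrite hq => /lt_geF/negP; apply; apply: sumr_ge0 => j _.
case: (boolP (j \in S)) => jS; last first.
  rewrite mulr_ge0 ?exprn_ge0 //; move: jS; rewrite inE.
  by rewrite -real_leNgt ?real0.
suff -> : (y *m V *m adjmx P) 0 j = 0 by rewrite normr0 expr0n mulr0.
have /matrixP/(_ 0 (enum_rank_in jS j)) := yVW; rewrite mulmxA !mxE => E.
rewrite -[RHS]E; apply: eq_bigr => l _; by rewrite !mxE enum_rankK_in.
Qed.

(** Normalized eigenvectors of the negative eigenvalues. *)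
Lemma neg_frame n (M : 'M[K]_n) : adjmx M = M ->
  exists V : 'M[K]_(negev M, n), V *m M *m adjmx V = - 1%:M.
Proof.
move=> hM; have [P [d [[PP PM] dr hq E]]] := spectral_decomposition hM.
rewrite E; set S := [pred i | d 0 i < 0].
have dneg (i : 'I_#|S|) : d 0 (enum_val i) < 0 by have := enum_valP i; rewrite inE.
pose sq (i : 'I_#|S|) := sqrtC (- d 0 (enum_val i)).
have sq2 i : sq i ^+ 2 = - d 0 (enum_val i) by rewrite sqrtCK.
have sqr i : (sq i)^* = sq i.
  by apply/CrealP; rewrite ger0_real // sqrtC_ge0 oppr_ge0 ltW.
have sq0 i : sq i != 0 by rewrite sqrtC_eq0 oppr_eq0 lt_eqF.
pose V : 'M[K]_(#|S|, n) := \matrix_(i, j) ((sq i)^-1 * P (enum_val i) j).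
exists V; apply/matrixP => i j.
have h p q : (V *m M *m adjmx V) p q = (sq p)^-1 * (sq q)^-1 * (P *m M *m adjmx P) (enum_val p) (enum_val q).
  rewrite !mxE mulr_sumr; apply: eq_bigr => l _.
  rewrite !mxE rmorphM fmorphV /= sqr !mulr_suml mulr_sumr; apply: eq_bigr => o _.
  by rewrite !mxE; ring.
rewrite h PM !mxE (inj_eq enum_val_inj); case: eqP => [->|_]; last by rewrite !mulr0n mulr0 oppr0.
rewrite !mulr1n -invfM -expr2 sq2 invrN mulNr mulVf // lt_eqF //.
Qed.

Lemma qformE n k (M : 'M[K]_n) (V : 'M[K]_(k, n)) (y : 'rV[K]_k) :
  qform M (y *m V) = qform (V *m M *m adjmx V) y.
Proof. by rewrite /qform adjmxM !mulmxA. Qed.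

Lemma qform_sum n (M : 'M[K]_n) x : qform M x = \sum_i \sum_j x 0 i * M i j * (x 0 j)^*.
Proof.
rewrite /qform mxE exchange_big; apply: eq_bigr => j _ /=; rewrite mxE mulr_suml.
by apply: eq_bigr => i _; rewrite !mxE.
Qed.

Lemma qform_real n (M : 'M[K]_n) x : adjmx M = M -> qform M x \is Num.real.
Proof.
move=> hM; apply/CrealP; rewrite qform_sum rmorph_sum exchange_big; apply: eq_bigr => j _ /=.
rewrite rmorph_sum; apply: eq_bigr => i _ /=.
by rewrite !rmorphM /= conjCK -{2}hM !mxE; ring.
Qed.

(** Entrywise errors of size 1/(2(k+1)) change the form by less than the squared
    norm, so it stays negative definite on the frame. Frames obtained by limits
    satisfy such a condition. *)
Lemma negev_ge_approx n k (M : 'M[K]_n) (V : 'M[K]_(k, n)) : adjmx M = M ->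
  (forall i j, `|(V *m M *m adjmx V) i j + (i == j)%:R| <= (2 * k.+1%:R)^-1) ->
  (k <= negev M)%N.
Proof.
move=> hM hV; apply: (negev_ge hM (V := V)) => y y0; rewrite qformE.
set H := V *m M *m adjmx V in hV *.
have hH : adjmx H = H by rewrite /H !adjmxM adjmxK hM mulmxA.
pose S := \sum_i `|y 0 i| ^+ 2.
have S0 : 0 < S.
  have [i hi] : exists i, y 0 i != 0 by apply/rV0Pn.
  rewrite /S (bigD1 i) //= ltr_wpDr ?exprn_gt0 ?normr_gt0 //.
  by apply: sumr_ge0 => j _; rewrite exprn_ge0.
have CS : \sum_i \sum_j `|y 0 i| * `|y 0 j| <= k%:R * S.
  have h i j : `|y 0 i| * `|y 0 j| <= (`|y 0 i| ^+ 2 + `|y 0 j| ^+ 2) / 2.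
    rewrite ler_pdivlMr // -subr_ge0.
    have -> : `|y 0 i| ^+ 2 + `|y 0 j| ^+ 2 - `|y 0 i| * `|y 0 j| * 2 = (`|y 0 i| - `|y 0 j|) ^+ 2 by ring.
    by rewrite real_exprn_even_ge0 // rpredB // normr_real.
  apply: (@le_trans _ _ (\sum_(i < k) \sum_(j < k) (`|y 0 i| ^+ 2 + `|y 0 j| ^+ 2) / 2)).
    by apply: ler_sum => i _; apply: ler_sum => j _; apply: h.
  under eq_bigr do rewrite -mulr_suml big_split /= sumr_const card_ord -/S.
  rewrite -mulr_suml big_split /= sumr_const card_ord sumrMnl -/S.
  by have -> : (S *+ k + S *+ k) / 2 = k%:R * S by rewrite -mulr_natl; field.
have real_form := qform_real y hH.
pose E : K := qform H y + S.
have EE : `|E| <= (2 * k.+1%:R)^-1 * (k%:R * S).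
  have -> : E = \sum_i \sum_j y 0 i * (H i j + (i == j)%:R) * (y 0 j)^*.
    rewrite /E qform_sum /S -big_split; apply: eq_bigr => i _ /=.
    under [RHS]eq_bigr do rewrite mulrDr mulrDl; rewrite big_split /=; congr (_ + _).
    rewrite (bigD1 i) //= eqxx mulr1 big1 ?addr0 ?normCK // => j ji.
    by rewrite eq_sym (negPf ji) mulr0 mul0r.
  have k0 : 0 <= (2 * k.+1%:R)^-1 :> K by rewrite invr_ge0 mulr_ge0.
  apply: le_trans (ler_wpM2l k0 CS); rewrite mulr_sumr.
  apply: le_trans (ler_norm_sum _ _ _) _; apply: ler_sum => i _; rewrite mulr_sumr.
  apply: le_trans (ler_norm_sum _ _ _) _; apply: ler_sum => j _.
  by rewrite !normrM norm_conjC mulrAC mulrC ler_wpM2r ?mulr_ge0.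
have Er : E \is Num.real by rewrite rpredD // ger0_real // ltW.
have -> : qform H y = E - S by rewrite addrK.
rewrite subr_lt0; apply: le_lt_trans (real_ler_norm Er) _; apply: le_lt_trans EE _.
rewrite mulrC ltr_pdivrMr ?mulr_gt0 // mulrC ltr_pM2l //.
by rewrite -natrM ltr_nat; lia.
Qed.

End Inertia.

(** * From kernels to generalized Nevanlinna functions *)

Section PickKernels.
Variable R : realType.
Local Notation C := (Cx R).
Implicit Types (z h : C) (k : C -> C -> C).

Definition bform k (n : nat) (z x y : nat -> C) : C :=
  \sum_(p < n) \sum_(q < n) x p * k (z p) (z q) * (y q)^*.

(** At most [m] negative squares, in a form uniform in the points: the same [m]
    functions provide the linear conditions for every choice of points. *)
Definition neg_bounded k (m : nat) := exists V : nat -> C -> C,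
  forall n (z x : nat -> C), (forall p, (p < n)%N -> upper_half (z p)) ->
    (forall j, (j < m)%N -> \sum_(p < n) x p * V j (z p) = 0) -> 0 <= bform k n z x x.

(** At least [m] negative squares, at points arbitrarily close to the origin and
    up to an arbitrarily small error. Both features are used when further points
    are added one at a time. *)
Definition neg_attained k (m : nat) := forall d e : R, 0 < d -> 0 < e ->
  exists n (z : nat -> C) (c : nat -> nat -> C),
    (forall p, (p < n)%N -> upper_half (z p) /\ mo (z p) < d) /\
    (forall i j, (i < m)%N -> (j < m)%N -> mo (bform k n z (c i) (c j) + (i == j)%:R) <= e).

(** Dividing by den(z) den(w)^* gives the entries of the Pick matrix of num/den;
    unlike these, the kernel has no singularity at the zeros of the
    denominator. *)
Definition pick_kernel (num den : C -> C) z w : C :=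
  (num z * (den w)^* - den z * (num w)^*) / (z - w^*).

Lemma upper_slit z : upper_half z -> slit_plane z.
Proof. by move=> hz [h]; move: hz; rewrite /upper_half /= h ltxx. Qed.

Lemma upper_sub_conj z w : upper_half z -> upper_half w -> z - w^* != 0.
Proof.
rewrite /upper_half /= => hz hw; apply/eqP => /(congr1 (fun x : C => complex.Im x)).
rewrite cImD cImN cIm_conj opprK /= => h; have := addr_gt0 hz hw; by rewrite h ltxx.
Qed.

Lemma pick_entry (num den : C -> C) z w : den z != 0 -> den w != 0 ->
  (num z / den z - (num w / den w)^*) / (z - w^*) =
  (den z)^-1 * pick_kernel num den z w * ((den w)^-1)^*.
Proof.
move=> hz hw; rewrite /pick_kernel rmorphM /= fmorphV /=.
have hw' : (den w)^* != 0 by rewrite conjC_eq0.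
move: (z - w^*)^-1 (num z) (den z) hz ((num w)^*) ((den w)^*) hw' => y a b b0 u v v0.
by field; rewrite ?b0 ?v0.
Qed.

Lemma tends_fin (T : finType) (u : T -> nat -> C) (l : T -> C) : (forall i, tends (u i) (l i)) ->
  forall e, 0 < e -> exists N, forall n i, (N <= n)%N -> mo (u i n - l i) < e.
Proof.
move=> h e e0; have [N hN] := choice (fun i => h i e e0).
exists (\max_i N i)%N => n i hn; apply: hN; apply: leq_trans hn; exact: leq_bigmax.
Qed.

Lemma pick_matrix_herm (f : C -> C) n (z : 'I_n -> C) : adjmx (pick_matrix f z) = pick_matrix f z.
Proof.
apply/matrixP => i j; rewrite !mxE rmorphM fmorphV /= !rmorphB /= !conjCK.
by rewrite -opprB -[X in _ / X]opprB invrN mulrNN.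
Qed.

Section OfKernel.
Variables (num den f : C -> C) (m : nat).
Hypotheses (anum : forall z, slit_plane z -> ana num z) (aden : forall z, slit_plane z -> ana den z)
  (cnum : forall z, slit_plane z -> num z^* = (num z)^*)
  (cden : forall z, slit_plane z -> den z^* = (den z)^*)
  (den0 : den 0 = 1) (fE : forall z, f z = num z / den z).

(** A flat zero would propagate along the segment from [z] to the origin, where the
    denominator is 1. *)
Lemma den_not_flat z : slit_plane z ->
  ~ exists2 d, 0 < d & forall h, mo h <= d -> den (z + h) = 0.
Proof.
move=> hz [d d0 hd].
pose D : set C := [set y | exists2 t : R, 0 <= t <= 1 & y = - (ofR t * z)].
have : den (z + (- z)) = 0.
  apply: (@identity_star _ D (fun h => den (z + h))).
  - move=> _ t [s /andP[s0 s1] ->] /andP[t0 t1]; exists (t * s); last by rewrite rmorphM mulrN mulrA.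
    by rewrite mulr_ge0 //= mulr_ile1.
  - move=> _ [t /andP[t0 t1] ->].
    have hz' : slit_plane (z - ofR t * z).
      rewrite (_ : z - ofR t * z = ofR (1 - t) * z); last by rewrite rmorphB rmorph1 mulrBl mul1r.
      by apply: slit_plane_star => //; rewrite subr_ge0 t1 gerBl.
    have [r [B [u [r0 hu]]]] := aden hz'; exists r, B, u; split=> //.
    by apply: pser_eq hu => h _; rewrite addrA.
  - by exists d => // h /ltW; apply: hd.
  - by exists 1; rewrite ?ler01 ?lexx // rmorph1 mul1r.
by rewrite subrr den0 => /eqP; rewrite oner_eq0.
Qed.

Lemma den_local z : slit_plane z -> exists l g, [/\ ana g z, g z != 0 &
  exists2 d, 0 < d & forall h, mo h < d -> den (z + h) = h ^+ l * g (z + h) /\ g (z + h) != 0].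
Proof.
move=> hz; have [/(den_not_flat hz) []|[l [g [ag g0 [d d0 hd]]]]] := ana_dichotomy (aden hz).
have [d' d'0 hd'] := ana_near_neq0 ag g0.
exists l, g; split=> //; exists (Num.min d d'); first by rewrite lt_min d0.
by move=> h; rewrite lt_min => /andP[h1 h2]; split; [apply: hd; apply: ltW|apply: hd'].
Qed.

Lemma f_meromorphic z : slit_plane z -> meromorphic_at f z.
Proof.
move=> hz; have [l [g [ag g0 [d d0 hd]]]] := den_local hz.
exists l, (fun y => num y / g y); split; first by apply/anaP; apply: ana_div (anum hz) ag g0.
rewrite near_withinE; apply/near_mo; exists d => // h /hd [E gh].
rewrite -subr_eq0 addrC addKr => h0; rewrite fE E.
have := expf_neq0 l h0; move: (h ^+ l) (num (z + h)) (g (z + h)) gh => a b v v0 a0.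
by field; rewrite ?v0 ?a0.
Qed.

Lemma f_analytic z : slit_plane z -> den z != 0 -> ana f z.
Proof.
move=> hz h; apply: (@ana_ext _ (fun z => num z / den z)); first by move=> y; rewrite fE.
exact: ana_div (anum hz) (aden hz) h.
Qed.

Lemma f_conj z : slit_plane z -> f z^* = (f z)^*.
Proof. by move=> hz; rewrite !fE cnum // cden // rmorphM fmorphV. Qed.

Hypothesis hU : neg_bounded (pick_kernel num den) m.

Lemma neg_le_off_zeros n (z : 'I_n.+1 -> C) : (forall i, upper_half (z i)) ->
  (forall i, den (z i) != 0) -> (neg_eigenvalues (pick_matrix f z) <= m)%N.
Proof.
move=> uz dz; have [V hV] := hU.
pose W : 'M[C]_(n.+1, m) := \matrix_(i, j) (V j (z i) / den (z i)).
apply: (negev_le (pick_matrix_herm f z) (W := W)) => x xW.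
pose z' p := z (inord p); pose x' p := x 0 (inord p) / den (z' p).
have -> : qform (pick_matrix f z) x = bform (pick_kernel num den) n.+1 z' x' x'.
  rewrite qform_sum; apply: eq_bigr => i _; apply: eq_bigr => j _.
  rewrite mxE !fE pick_entry // /x' /z' !inord_val rmorphM /=; ring.
apply: hV => [p pn|j jm]; first exact: uz.
have /matrixP/(_ 0 (Ordinal jm)) := xW; rewrite !mxE => E; rewrite -[RHS]E.
by apply: eq_bigr => i _; rewrite !mxE /x' /z' inord_val /=; ring.
Qed.

(** The zeros of the denominator are isolated. *)
Lemma approx_points n (z : 'I_n -> C) : (forall i, upper_half (z i)) ->
  exists y : 'I_n -> nat -> C, forall i, [/\ tends (y i) (z i) &
    forall t, upper_half (y i t) /\ den (y i t) != 0].
Proof.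
move=> uz; suff h i : exists y : nat -> C, tends y (z i) /\ forall t, upper_half (y t) /\ den (y t) != 0.
  by have [y hy] := choice h; exists y => i; have [] := hy i.
have [l [g [ag g0 [d d0 hd]]]] := den_local (upper_slit (uz i)).
pose s (t : nat) : R := d / 2 * t.+1%:R^-1.
have s0 t : 0 < s t by rewrite mulr_gt0 ?divr_gt0 // invr_gt0 ltr0n.
have sd t : s t < d.
  apply: (@le_lt_trans _ _ (d / 2)); last by lra.
  by rewrite ler_piMr ?divr_ge0 ?(ltW d0) // invf_le1 ?ler1n ?ltr0n.
have ms t : mo (ofR (s t)) = s t by rewrite mo_ofR ger0_norm // ltW.
exists (fun t => z i + ofR (s t)); split.
  apply: (@tends_squeeze _ _ s) => [t|]; first by rewrite addrC addKr ms.
  rewrite -[0](mulr0 (d / 2)); apply: cvgMr; exact: cvg_harmonic.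
move=> t; split; first by rewrite /upper_half /= cImD Im_ofR addr0; apply: uz.
have hs : mo (ofR (s t)) < d by rewrite ms.
have [-> gh] := hd _ hs.
by rewrite mulf_neq0 // expf_neq0 // -mo_eq0 ms gt_eqF.
Qed.

(** The quotient may be analytic at a zero of the denominator. The points are then
    moved off the zeros; by continuity a frame of negative vectors remains
    approximately one. *)
Lemma neg_le_admissible n (z : 'I_n.+1 -> C) : admissible f z ->
  (neg_eigenvalues (pick_matrix f z) <= m)%N.
Proof.
move=> hz; have uz i := (hz i).1; have af i := (anaP f (z i)).1 (hz i).2.
have [y hy] := approx_points uz.
have hM := pick_matrix_herm f z.
have [V hV] := neg_frame hM; set k := negev (pick_matrix f z) in V hV.
pose Mt t := pick_matrix f (fun i => y i t).
have fy i : tends (fun t => f (y i t)) (f (z i)).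
  move=> e e0; have [d d0 hd] := ana_continuous (af i) e0.
  have [ty _] := hy i; have [N hN] := ty d d0; exists N => t /hN /hd.
  by rewrite [z i + _]addrC subrK.
have entry i j : tends (fun t => Mt t i j) (pick_matrix f z i j).
  rewrite mxE; apply: (tends_eq (u := fun t => (f (y i t) - (f (y j t))^*) / (y i t - (y j t)^*))).
    by move=> t; rewrite mxE.
  apply: tendsM; first by apply: tendsB (fy i) _; apply: tends_conj.
  have [ti _] := hy i; have [tj _] := hy j.
  by apply: tendsV (upper_sub_conj (uz i) (uz j)) _; apply: tendsB ti _; apply: tends_conj.
have hVt (ij : 'I_k * 'I_k) : tends (fun t => (V *m Mt t *m adjmx V) ij.1 ij.2) ((- 1%:M : 'M[C]_k) ij.1 ij.2).
  rewrite -hV mxE; apply: (tends_eq (u := fun t => \sum_j (\sum_i V ij.1 i * Mt t i j) * (adjmx V) j ij.2)).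
    by move=> t; rewrite [RHS]mxE; apply: eq_bigr => j _; congr (_ * _); rewrite [RHS]mxE.
  apply: tends_sum => j; apply: tendsM (tends_cst _); rewrite mxE.
  by apply: tends_sum => i; apply: tendsM (tends_cst _) _.
have e0 : 0 < (2 * k.+1%:R)^-1 :> R by rewrite invr_gt0 mulr_gt0.
have [N hN] := tends_fin hVt e0.
apply: leq_trans (neg_le_off_zeros (z := fun i => y i N) _ _); last 2 first.
- by move=> i; have [_ /(_ N) []] := hy i.
- by move=> i; have [_ /(_ N) []] := hy i.
apply: (negev_ge_approx (pick_matrix_herm f _) (V := V)) => i j.
have := hN N (i, j) (leqnn _); rewrite /= !mxE opprK => /ltW.
by rewrite normE -le_ofR => /le_trans; apply; rewrite fmorphV rmorphM !rmorph_nat.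
Qed.

Hypothesis hL : neg_attained (pick_kernel num den) m.

Lemma neg_attained_points : exists n (z : 'I_n.+1 -> C), admissible f z /\
  neg_eigenvalues (pick_matrix f z) = m.
Proof.
have [|d d0 hd] := ana_near_neq0 (aden (@slit0 R)); first by rewrite den0 oner_eq0.
have adm n (z : 'I_n.+1 -> C) : (forall i, upper_half (z i) /\ mo (z i) < d) -> admissible f z.
  move=> h i; have [h1 h2] := h i; split=> //; apply/anaP; apply: f_analytic; first exact: upper_slit.
  by have := hd _ h2; rewrite add0r.
have e0 : 0 < (2 * m.+1%:R)^-1 :> R by rewrite invr_gt0 mulr_gt0.
have [n [z [c [hz hc]]]] := hL d0 e0.
(* Without any point m must be 0, and an arbitrary point is supplied. *)
case: n hz hc => [|n] hz hc.
  have m0 : m = 0%N.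
    case: (posnP m) => // mp; have := hc 0%N 0%N mp mp.
    rewrite /bform big_ord0 eqxx add0r mo1 leNgt invf_lt1 ?mulr_gt0 //.
    by rewrite -natrM ltr1n; case: (m) mp.
  exists 0%N, (fun=> Complex 0 (d / 2) : C); have ha : admissible f (fun i : 'I_1 => Complex 0 (d / 2) : C).
    apply: adm => _; split; first by rewrite /upper_half /= divr_gt0.
    apply: le_lt_trans (mo_le_ReIm _) _; rewrite /= normr0 add0r ger0_norm ?divr_ge0 ?(ltW d0) //.
    by rewrite ltr_pdivrMr // ltr_pMr // ltr1n.
  by split=> //; apply/eqP; rewrite eqn_leq neg_le_admissible // m0.
pose z' (i : 'I_n.+1) := z i.
have hz' i : upper_half (z' i) /\ mo (z' i) < d by apply: hz.
have dn i : den (z' i) != 0 by have := hd _ (hz' i).2; rewrite add0r.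
have ha : admissible f z' by apply: adm.
exists n, z'; split=> //.
apply/eqP; rewrite eqn_leq neg_le_admissible //=.
pose V : 'M[C]_(m, n.+1) := \matrix_(a, p) (c a p * den (z' p)).
apply: (negev_ge_approx (pick_matrix_herm f z') (V := V)) => i j.
have -> : (V *m pick_matrix f z' *m adjmx V) i j = bform (pick_kernel num den) n.+1 z (c i) (c j).
  rewrite mxE /bform exchange_big; apply: eq_bigr => q _ /=; rewrite mxE mulr_suml; apply: eq_bigr => p _.
  rewrite !mxE !fE pick_entry // rmorphM fmorphV /=.
  have := dn p; have : (den (z' q))^* != 0 by rewrite conjC_eq0.
  rewrite -/(z' p) -/(z' q); move: (den (z' p)) ((den (z' q))^*) => u v v0 u0.
  by field; rewrite ?u0 ?v0.
rewrite normE; have := hc i j (ltn_ord i) (ltn_ord j).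
by rewrite -le_ofR => /le_trans; apply; rewrite fmorphV rmorphM !rmorph_nat.
Qed.

(** A quotient of functions analytic on the slit plane is a generalized
    Nevanlinna function whose index is read off from the kernel alone. *)
Theorem nevanlinna_of_kernel : nevanlinna m f.
Proof.
split.
- by move=> z /upper_slit; apply: f_meromorphic.
- by move=> z /upper_slit hz _; apply: f_conj.
- by case=> // n z _; apply: neg_le_admissible.
- by have [n [z [h1 h2]]] := neg_attained_points; exists n.+1, z.
Qed.

End OfKernel.
End PickKernels.

(** * The diagonal expansion of the kernels *)

Section KernelIndex.
Variable R : realType.
Local Notation C := (Cx R).
Implicit Types (z w h : C) (k : C -> C -> C).

Lemma tends_ge0 (u : nat -> C) l : tends u l -> (forall n, 0 <= u n) -> 0 <= l.
Proof.
move=> hu u0.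
have hI n : complex.Im (u n) = 0 /\ 0 <= complex.Re (u n).
  by have := u0 n; rewrite lecE /= => /andP[/eqP -> ->].
rewrite lecE /=; apply/andP; split.
  apply/eqP/eqP/negPn/negP => h; have /hu [N /(_ N (leqnn _))] : 0 < `|complex.Im l| by rewrite normr_gt0.
  have := Im_le_mo (u N - l); rewrite cImD cImN (hI N).1 add0r normrN; lra.
rewrite leNgt; apply/negP => h; have /hu [N /(_ N (leqnn _))] : 0 < - complex.Re l by rewrite oppr_gt0.
have := Re_le_mo (u N - l); rewrite cReD cReN; have := (hI N).2.
have := ler_norm (complex.Re (u N) - complex.Re l); lra.
Qed.

Definition scons (x : C) (u : nat -> C) : nat -> C := fun p => if p is p'.+1 then u p' else x.

Lemma bform_scons k n (e x0 y0 : C) (z x y : nat -> C) :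
  bform k n.+1 (scons e z) (scons x0 x) (scons y0 y) =
  x0 * k e e * y0^* + \sum_(q < n) x0 * k e (z q) * (y q)^* +
  (\sum_(p < n) x p * k (z p) e * y0^* + bform k n z x y).
Proof.
rewrite /bform big_ord_recl /= big_ord_recl /=; congr (_ + _).
by rewrite -big_split; apply: eq_bigr => p _; rewrite big_ord_recl.
Qed.

(** A rank-one part of the kernel contributes a product of two linear forms. *)
Lemma bform_rank1 k k' (s : C) (g : C -> C) n (z x y : nat -> C) :
  (forall p q, (p < n)%N -> (q < n)%N -> k (z p) (z q) = s * (g (z p) * (g (z q))^*) + k' (z p) (z q)) ->
  bform k n z x y = s * (\sum_(p < n) x p * g (z p)) * (\sum_(q < n) y q * g (z q))^* + bform k' n z x y.
Proof.
move=> hk; rewrite /bform rmorph_sum -mulrA mulr_suml mulr_sumr -big_split; apply: eq_bigr => p _ /=.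
rewrite mulr_sumr mulr_sumr -big_split; apply: eq_bigr => q _ /=.
by rewrite hk // rmorphM; ring.
Qed.

Lemma pick_kernel_conj (num den : C -> C) z w : (pick_kernel num den z w)^* = pick_kernel num den w z.
Proof.
rewrite /pick_kernel rmorphM fmorphV !rmorphB !rmorphM /= !conjCK.
have -> : z^* - w = - (w - z^*) by rewrite opprB.
rewrite invrN; move: (w - z^*)^-1 => y; ring.
Qed.

Variables (a b c : R).
Hypothesis hc : forall n : nat, - c != n%:R.
Local Notation P := (gaussF a b c).
Local Notation gd := (gaussd a b c).
Local Notation Dp := (gaussD a b c).

(** The kernel belonging to z F_(i+1) / F_i. *)
Definition Lker i : C -> C -> C := pick_kernel (fun z => z * P i.+1 z) (P i).

(** Substituting F_i = F_(i+1) - d_i z F_(i+2) cancels F_(i+1)(z) F_(i+1)(w)^*, so the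
    kernel without the factor z is d_i times the next kernel with that factor. *)
Lemma pick_kernel_Lker i z w : slit_plane z -> slit_plane w ->
  pick_kernel (P i.+1) (P i) z w = ofR (gd i) * Lker i.+1 z w.
Proof.
move=> hz hw; rewrite /Lker /pick_kernel (gaussF_contiguous _ _ hc i hz) (gaussF_contiguous _ _ hc i hw).
move: (gd i) => g; rewrite !rmorphB !rmorphM /= conj_ofR; ring.
Qed.

(** The same substitution in the presence of the factor z: now the product
    F_(i+1)(z) F_(i+1)(w)^* appears with the coefficient z - w^* and survives as a
    rank-one term. *)
Lemma Lker_step i z w : slit_plane z -> slit_plane w -> z - w^* != 0 ->
  Lker i z w = P i.+1 z * (P i.+1 w)^* + ofR (gd i * gd i.+1) * (z * w^*) * Lker i.+2 z w.
Proof.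
move=> hz hw zw.
have E : Lker i z w = P i.+1 z * (P i.+1 w)^* +
    ofR (gd i) * (z * w^*) * pick_kernel (P i.+2) (P i.+1) z w.
  rewrite /Lker /pick_kernel (gaussF_contiguous _ _ hc i hz) (gaussF_contiguous _ _ hc i hw).
  move: (gd i) => g; rewrite !rmorphB !rmorphM /= conj_ofR.
  move: (P i.+1 z) (P i.+2 z) ((P i.+1 w)^*) ((P i.+2 w)^*) (ofR g) (w^*) zw => p q u v d s zs.
  by field.
by rewrite E pick_kernel_Lker //; move: (gd i) (gd i.+1) => g g'; rewrite rmorphM; ring.
Qed.

Lemma gaussD0 i : Dp i 0 = 1. Proof. by rewrite /Dp big_ord0. Qed.

Lemma gaussD_recr2 i J : Dp i (2 * J.+1) = Dp i (2 * J) * (gd (i + 2 * J) * gd (i + 2 * J).+1).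
Proof.
have -> : (2 * J.+1 = (2 * J).+2)%N by lia.
by rewrite /Dp !big_ord_recr /= mulrA addnS.
Qed.

Lemma gaussD_recl2 i J : Dp i (2 * J.+1) = gd i * gd i.+1 * Dp i.+2 (2 * J).
Proof.
have -> : (2 * J.+1 = (2 * J).+2)%N by lia.
rewrite /Dp !big_ord_recl /= addn0 addn1 mulrA; congr (_ * _); apply: eq_bigr => k _.
by rewrite /bump /= !add1n !addnS !addSn.
Qed.

Definition vfun i j z : C := z ^+ j * P (i + 2 * j).+1 z.

Lemma Lker_expansion i J z w : slit_plane z -> slit_plane w -> z - w^* != 0 ->
  Lker i z w = \sum_(j < J) ofR (Dp i (2 * j)) * (vfun i j z * (vfun i j w)^*)
    + ofR (Dp i (2 * J)) * (z * w^*) ^+ J * Lker (i + 2 * J) z w.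
Proof.
move=> hz hw zw; elim: J => [|J IH].
  by rewrite big_ord0 add0r muln0 gaussD0 rmorph1 expr0 !mul1r addn0.
rewrite IH big_ord_recr /= -addrA; congr (_ + _).
rewrite (Lker_step _ hz hw zw) gaussD_recr2 (_ : (i + 2 * J.+1)%N = (i + 2 * J).+2); last by lia.
rewrite /vfun !rmorphM rmorphXn /= exprS exprMn; ring.
Qed.

Lemma remainder_tends i z w : upper_half z -> upper_half w ->
  tends (fun J => ofR (Dp i (2 * J)) * (z * w^*) ^+ J * Lker (i + 2 * J) z w) 0.
Proof.
move=> uz uw; have hz := upper_slit uz; have hw := upper_slit uw.
have zw := upper_sub_conj uz uw.
pose r0 := Num.max (mo (unif z)) (mo (unif w)).
have r01 : r0 < 1 by rewrite gt_max (unifP hz).1 (unifP hw).1.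
have r00 : 0 <= r0 by rewrite le_max mo_ge0.
pose r := (1 + r0) / 2; have rp : 0 < r by rewrite /r; lra.
have r1 : r < 1 by rewrite /r; lra.
have rr : r0 <= r by rewrite /r; lra.
have zr : mo (unif z) <= r by apply: le_trans rr; rewrite le_max lexx.
have wr : mo (unif w) <= r by apply: le_trans rr; rewrite le_max lexx orbT.
have [M [K [q [q0 q1 hK]]]] := tail_bound a b hc i rp r1.
apply: (@tends_unshift _ _ _ M).
pose A := (mo (z - w^*))^-1 * (mo z + mo w) * K * q ^+ M.
apply: (@tends_squeeze _ _ (fun J => A * q ^+ J)); last first.
  by rewrite -[0](mulr0 A); apply: cvgMr; apply: cvg_expr; rewrite ger0_norm.
move=> n; set J := (n + M)%N; have MJ : (M <= J)%N by rewrite leq_addl.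
rewrite subr0 /Lker /pick_kernel.
have h10 := hK J 1%N 0%N z w MJ isT isT hz hw zr wr.
have h01 := hK J 0%N 1%N z w MJ isT isT hz hw zr wr.
rewrite !addn0 !addn1 in h10 h01.
rewrite !moM !moX moM !mo_conj mo_ofR moV.
have num_le : mo (z * P (i + 2 * J).+1 z * (P (i + 2 * J) w)^* - P (i + 2 * J) z * (w * P (i + 2 * J).+1 w)^*)
  <= mo z * (mo (P (i + 2 * J).+1 z) * mo (P (i + 2 * J) w)) + mo w * (mo (P (i + 2 * J) z) * mo (P (i + 2 * J).+1 w)).
  by apply: le_trans (moD _ _) _; rewrite moN !moM !mo_conj !moM; lra.
have D0 : 0 <= `|Dp i (2 * J)| * (mo z * mo w) ^+ J by rewrite mulr_ge0 ?exprn_ge0 ?mulr_ge0 ?mo_ge0.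
have i0 : 0 <= (mo (z - w^*))^-1 by rewrite invr_ge0 mo_ge0.
apply: le_trans (ler_wpM2l D0 (ler_wpM2r i0 num_le)) _.
have -> : A * q ^+ n = (mo (z - w^*))^-1 * (mo z * (K * q ^+ J) + mo w * (K * q ^+ J)).
  by rewrite /A /J exprD; ring.
rewrite mulrA mulrC; apply: ler_wpM2l => //; rewrite mulrDr.
apply: lerD; rewrite mulrCA; apply: ler_wpM2l; rewrite ?mo_ge0 //.
  by apply: le_trans h10; rewrite exprMn; lra.
by apply: le_trans h01; rewrite exprMn; lra.
Qed.

Definition sker (s : R) i : C -> C -> C := fun z w => ofR s * Lker i z w.

(** A list of the indices of the negative terms, without repetition: its length is
    their number, and its existence contains their finiteness. *)
Definition negset (s : nat -> R) (l : seq nat) := uniq l /\ forall j, (s j < 0) = (j \in l).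

(** On vectors annihilated by the functions v_j of negative coefficient, the form is
    a limit of sums of nonnegative squares. *)
Lemma sker_bounded s i l : negset (fun j => s * Dp i (2 * j)) l -> neg_bounded (sker s i) (size l).
Proof.
move=> [ul hl]; exists (fun j => vfun i (nth 0%N l j)) => n z x uz hx.
pose T j := ofR (s * Dp i (2 * j)) * ((\sum_(p < n) x p * vfun i j (z p)) * (\sum_(p < n) x p * vfun i j (z p))^*).
have T0 j : 0 <= T j.
  case: (boolP (j \in l)) => jl.
    have jn : (index j l < size l)%N by rewrite index_mem.
    have := hx _ jn; rewrite nth_index // => E.
    by rewrite /T E mul0r mulr0.
  rewrite /T mulr_ge0 //; last by rewrite -normCK exprn_ge0.
  by rewrite -(rmorph0 (@ofR R)) le_ofR leNgt hl.
apply: (@tends_ge0 (fun J => \sum_(j < J) T j)); last by move=> J; apply: sumr_ge0.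
pose rem J := \sum_(p < n) \sum_(q < n) x p * (ofR s * (ofR (Dp i (2 * J)) * (z p * (z q)^*) ^+ J * Lker (i + 2 * J) (z p) (z q))) * (x q)^*.
have E J : \sum_(j < J) T j = bform (sker s i) n z x x - rem J.
  apply/eqP; rewrite eq_sym subr_eq; apply/eqP.
  rewrite /bform /rem.
  have -> : \sum_(j < J) T j = \sum_(p < n) \sum_(q < n) x p * (\sum_(j < J) ofR (s * Dp i (2 * j)) * (vfun i j (z p) * (vfun i j (z q))^*)) * (x q)^*.
    under [RHS]eq_bigr do under eq_bigr do rewrite mulr_sumr mulr_suml.
    under [RHS]eq_bigr do rewrite exchange_big /=.
    rewrite exchange_big /=; apply: eq_bigr => j _.
    rewrite /T rmorph_sum mulr_suml mulr_sumr; apply: eq_bigr => p _.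
    rewrite mulr_sumr mulr_sumr; apply: eq_bigr => q _.
    rewrite (rmorphM Num.conj) /=; ring.
  rewrite -big_split; apply: eq_bigr => p _; rewrite -big_split; apply: eq_bigr => q _ /=.
  have hp := uz p (ltn_ord p); have hq := uz q (ltn_ord q).
  rewrite /sker (Lker_expansion i J (upper_slit hp) (upper_slit hq) (upper_sub_conj hp hq)).
  rewrite -mulrDl -mulrDr; congr (_ * _ * _); rewrite mulrDr mulr_sumr; congr (_ + _).
  by apply: eq_bigr => j _; rewrite (rmorphM (@ofR R)) mulrA.
rewrite -[bform _ _ _ _ _](subr0); apply: tends_eq (fun J => esym (E J)) _.
apply: tendsB (tends_cst _) _.
have -> : (0 : C) = \sum_(p < n) \sum_(q < n) x p * (ofR s * 0) * (x q)^*.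
  by rewrite big1 // => p _; rewrite big1 // => q _; rewrite !mulr0 mul0r.
have aux (p q : 'I_n) : tends (fun J => x p * (ofR s * (ofR (Dp i (2 * J)) * (z p * (z q)^*) ^+ J * Lker (i + 2 * J) (z p) (z q))) * (x q)^*) (x p * (ofR s * 0) * (x q)^*).
  apply: tendsM (tends_cst _); apply: tendsM (tends_cst _) _; apply: tendsM (tends_cst _) _.
  exact: remainder_tends (uz p (ltn_ord p)) (uz q (ltn_ord q)).
by apply: tends_sum => p; apply: tends_sum => q; apply: aux.
Qed.

End KernelIndex.

(** * Realizing the negative squares near the origin *)

Section Attained.
Variable R : realType.
Local Notation C := (Cx R).
Implicit Types (z w h : C) (k : C -> C -> C).

Lemma tends_ana (f : C -> C) z0 (u : nat -> C) : ana f z0 -> tends u z0 -> tends (fun t => f (u t)) (f z0).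
Proof.
move=> hf hu e e0; have [d d0 hd] := ana_continuous hf e0; have [N hN] := hu d d0.
by exists N => n /hN /hd; rewrite [z0 + _]addrC subrK.
Qed.

(** Only the terms that involve the extra point depend on it, and all of them tend
    to zero. *)
Lemma bform_scons_tends k n (z x y : nat -> C) (e x0 y0 : nat -> C) (lx ly : C) :
  tends x0 lx -> tends y0 ly ->
  tends (fun t => k (e t) (e t)) 0 ->
  (forall q, (q < n)%N -> tends (fun t => k (e t) (z q)) 0) ->
  (forall p, (p < n)%N -> tends (fun t => k (z p) (e t)) 0) ->
  tends (fun t => bform k n.+1 (scons (e t) z) (scons (x0 t) x) (scons (y0 t) y)) (bform k n z x y).
Proof.
move=> hx hy hee hez hze.
have -> : bform k n z x y = lx * 0 * ly^* + \sum_(q < n) lx * 0 * (y q)^* +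
    (\sum_(p < n) x p * 0 * ly^* + bform k n z x y).
  rewrite !mulr0 mul0r add0r big1 => [|q _]; last by rewrite mul0r.
  by rewrite big1 ?add0r // => p _; rewrite mulr0 mul0r.
apply: (tends_eq (u := fun t => x0 t * k (e t) (e t) * (y0 t)^* + \sum_(q < n) x0 t * k (e t) (z q) * (y q)^* +
  (\sum_(p < n) x p * k (z p) (e t) * (y0 t)^* + bform k n z x y))).
  by move=> t; rewrite bform_scons.
apply: tendsD; apply: tendsD.
- by apply: tendsM (tends_conj hy); apply: tendsM.
- have aux (q : 'I_n) : tends (fun t => x0 t * k (e t) (z q) * (y q)^*) (lx * 0 * (y q)^*).
    by apply: tendsM (tends_cst _); apply: tendsM => //; apply: hez.
  by apply: tends_sum => q; apply: aux.
- have aux (p : 'I_n) : tends (fun t => x p * k (z p) (e t) * (y0 t)^*) (x p * 0 * ly^*).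
    by apply: tendsM (tends_conj hy); apply: tendsM (tends_cst _) _; apply: hze.
  by apply: tends_sum => p; apply: aux.
- exact: tends_cst.
Qed.

(** The points e_t tend to the origin along the imaginary axis. On the diagonal the
    denominator of the kernel is then e_t - e_t^* = 2 e_t, which the factor z of
    the numerator cancels. *)
Section Near0.
Variables (num den : C -> C).
Hypotheses (anum : ana num 0) (aden : ana den 0) (num0 : num 0 = 0) (num' : C -> C)
  (numE : forall z, num z = z * num' z) (anum' : ana num' 0).
Variable e : nat -> C.
Hypotheses (e0 : tends e 0) (en0 : forall t, e t != 0) (econj : forall t, (e t)^* = - e t).

Lemma tends_near_l w : w != 0 -> tends (fun t => e t * w^* * pick_kernel num den (e t) w) 0.
Proof.
move=> w0; have -> : 0 = 0 * w^* * ((num 0 * (den w)^* - den 0 * (num w)^*) / (0 - w^*)) :> C.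
  by rewrite !mul0r.
have tn := tends_ana anum e0; have td := tends_ana aden e0.
apply: tendsM; first exact: tendsM e0 (tends_cst _).
apply: tendsM.
  exact: tendsB (tendsM tn (tends_cst _)) (tendsM td (tends_cst _)).
by apply: tendsV; [rewrite sub0r oppr_eq0 conjC_eq0|exact: tendsB e0 (tends_cst _)].
Qed.

Lemma tends_near_r w : w != 0 -> tends (fun t => w * (e t)^* * pick_kernel num den w (e t)) 0.
Proof.
move=> w0; have := tends_conj (tends_near_l w0); rewrite conjC0; apply: tends_eq => t.
have E (x y v : C) : (x * y^* * v)^* = y * x^* * v^* by rewrite !rmorphM /= conjCK [_ * y]mulrC.
by rewrite E pick_kernel_conj.
Qed.

Lemma tends_near_diag : tends (fun t => e t * (e t)^* * pick_kernel num den (e t) (e t)) 0.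
Proof.
have td := tends_ana aden e0; have tn' := tends_ana anum' e0.
have -> : 0 = 0 * 0^* * ((num' 0 * (den 0)^* + den 0 * (num' 0)^*) / 2) :> C by rewrite !mul0r.
apply: (tends_eq (u := fun t => e t * (e t)^* * ((num' (e t) * (den (e t))^* + den (e t) * (num' (e t))^*) / 2))).
  move=> t; congr (_ * _); rewrite /pick_kernel numE rmorphM /= econj.
  have := en0 t; move: (num' (e t)) (den (e t)) => a b; move: (a^*) (b^*) (e t) => a' b' x x0.
  have -> : x - - x = 2 * x by ring.
  by field.
apply: tendsM; first exact: tendsM e0 (tends_conj e0).
apply: tendsM (tends_cst _).
exact: tendsD (tendsM tn' (tends_conj td)) (tendsM td (tends_conj tn')).
Qed.
End Near0.

Variables (a b c : R).
Hypothesis hc : forall n : nat, - c != n%:R.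
Local Notation P := (gaussF a b c).
Local Notation gd := (gaussd a b c).
Local Notation Dp := (gaussD a b c).
Local Notation sker := (sker a b c).
Local Notation Lker := (Lker a b c).

Lemma ana_gaussF m z : slit_plane z -> ana (P m) z.
Proof. by move=> hz; apply: (ana_hyp2F1 _ _ (c_shift_admissible hc m) hz). Qed.

Lemma gaussF_at0 m : P m 0 = 1.
Proof. exact: (hyp2F1_0 _ _ (c_shift_admissible hc m)). Qed.

(** A new point close to the origin sees the rank-one part of the kernel only. It
    contributes one negative square when [s < 0]; in any case it can be used to
    make the old vectors orthogonal to the rank-one part. *)
Lemma attained_step i (s : R) m : neg_attained (sker (s * (gd i * gd i.+1)) i.+2) m ->
  neg_attained (sker s i) ((s < 0)%R + m).
Proof.
move=> IH d e d0 e0.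
have e2 : 0 < e / 2 by rewrite divr_gt0.
have [n [z [cc [hz hcc]]]] := IH d (e / 2) d0 e2.
pose P' := P i.+1.
have [d1 d10 hd1] : exists2 d1, 0 < d1 & forall h, mo h < d1 -> P' h != 0.
  have [|d1 d10 hd1] := ana_near_neq0 (ana_gaussF i.+1 (@slit0 R)); first by rewrite gaussF_at0 oner_eq0.
  by exists d1 => // h /hd1; rewrite add0r.
pose rho := Num.min d d1 / 2.
have dd : 0 < Num.min d d1 by rewrite lt_min d0.
have rho0 : 0 < rho by rewrite divr_gt0.
pose sq t : R := rho * t.+1%:R^-1.
have sq0 t : 0 < sq t by rewrite mulr_gt0 // invr_gt0 ltr0n.
pose ep t : C := Complex 0 (sq t).
have mep t : mo (ep t) <= sq t.
  by apply: le_trans (mo_le_ReIm _) _; rewrite /= normr0 add0r gtr0_norm.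
have epd t : mo (ep t) < Num.min d d1.
  apply: le_lt_trans (mep t) _; apply: (@le_lt_trans _ _ rho).
    by rewrite ler_piMr ?(ltW rho0) // invf_le1 ?ler1n ?ltr0n.
  by rewrite /rho ltr_pdivrMr // ltr_pMr // ltr1n.
have upep t : upper_half (ep t) by rewrite /upper_half /=.
have epn0 t : ep t != 0.
  by apply/eqP => /(congr1 (fun x : C => complex.Im x)) /=; apply/eqP; rewrite gt_eqF.
have epconj t : (ep t)^* = - ep t by apply: complexP; rewrite /= ?oppr0.
have tep : tends ep 0.
  apply: (@tends_squeeze _ _ sq) => [t|]; first by rewrite subr0.
  by rewrite -[0](mulr0 rho); apply: cvgMr; exact: cvg_harmonic.
have P'ep t : P' (ep t) != 0 by apply: hd1; have := epd t; rewrite lt_min => /andP[].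
have tP' : tends (fun t => P' (ep t)) 1.
  by have := tends_ana (ana_gaussF i.+1 (@slit0 R)) tep; rewrite gaussF_at0.
have tP'V : tends (fun t => (P' (ep t))^-1) 1.
  by have := tendsV (oner_neq0 C) tP'; rewrite invr1.
have zn0 p : (p < n)%N -> z p != 0.
  move=> pn; have [+ _] := hz p pn; rewrite /upper_half /=; apply: contraTneq => ->.
  by rewrite /= ltxx.
(* Dividing by z absorbs the factor z w^* that separates k2 from the next kernel. *)
pose xx (al : nat) p := cc al p / z p.
pose SS al := \sum_(p < n) xx al p * P' (z p).
(* The weight of the new point that makes the vector orthogonal to the rank-one part. *)
pose x0 al t := - SS al * (P' (ep t))^-1.
(* Normalizes the negative square of the new point alone to -1. *)
pose kap : C := (sqrtC (- ofR s))^-1.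
pose X (al : nat) t := scons (x0 al t) (xx al).
pose Y t := scons (kap * (P' (ep t))^-1) (fun=> 0).
pose V (al : nat) t := if s < 0 then (if al is al'.+1 then X al' t else Y t) else X al t.
pose zz t := scons (ep t) z.
pose k2 (v w : C) : C := ofR (s * (gd i * gd i.+1)) * ((v * w^*) * Lker i.+2 v w).
have upzz t p : (p < n.+1)%N -> upper_half (zz t p) /\ mo (zz t p) < d.
  case: p => [_|p] /=; last by rewrite ltnS; apply: hz.
  by split=> //; have := epd t; rewrite lt_min => /andP[].
have decomp t x y : bform (sker s i) n.+1 (zz t) x y =
    ofR s * (\sum_(p < n.+1) x p * P' (zz t p)) * (\sum_(p < n.+1) y p * P' (zz t p))^* + bform k2 n.+1 (zz t) x y.
  apply: bform_rank1 => p q pn qn; have [hp _] := upzz t p pn; have [hq _] := upzz t q qn.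
  rewrite /sker (Lker_step _ _ hc i (upper_slit hp) (upper_slit hq) (upper_sub_conj hp hq)).
  rewrite /k2 (rmorphM (@ofR R) s) /=; move: (ofR (gd i * gd i.+1)) => g; rewrite /P'; ring.
have sumX al t : \sum_(p < n.+1) X al t p * P' (zz t p) = 0.
  by rewrite big_ord_recl /= -/(SS al) /x0 mulfVK // addNr.
have sumY t : \sum_(p < n.+1) Y t p * P' (zz t p) = kap.
  by rewrite big_ord_recl /= mulfVK // big1 ?addr0 // => p _; rewrite mul0r.
have num0 : 0 * P i.+3 0 = 0 :> C by rewrite mul0r.
have anum : ana (fun z => z * P i.+3 z) 0 by apply: anaM (ana_id _) _; apply: ana_gaussF; apply: slit0.
have aden : ana (P i.+2) 0 by apply: ana_gaussF; apply: slit0.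
have anum' : ana (P i.+3) 0 by apply: ana_gaussF; apply: slit0.
have lim2 (x0' y0' : nat -> C) (lx ly : C) (x y : nat -> C) :
    tends x0' lx -> tends y0' ly ->
    tends (fun t => bform k2 n.+1 (zz t) (scons (x0' t) x) (scons (y0' t) y)) (bform k2 n z x y).
  move=> tx ty; apply: bform_scons_tends tx ty _ _ _.
  - rewrite -[0](mulr0 (ofR (s * (gd i * gd i.+1)))); apply: tendsM (tends_cst _) _.
    exact: (tends_near_diag aden (fun z => erefl) anum' tep epn0 epconj).
  - move=> q qn; rewrite -[0](mulr0 (ofR (s * (gd i * gd i.+1)))); apply: tendsM (tends_cst _) _.
    exact: (tends_near_l anum aden tep (zn0 q qn)).
  - move=> q qn; rewrite -[0](mulr0 (ofR (s * (gd i * gd i.+1)))); apply: tendsM (tends_cst _) _.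
    exact: (tends_near_r anum aden tep (zn0 q qn)).
have tx0 al : tends (x0 al) (- SS al) by have := tendsM (tends_cst (- SS al)) tP'V; rewrite mulr1.
have tkap : tends (fun t => kap * (P' (ep t))^-1) kap by have := tendsM (tends_cst kap) tP'V; rewrite mulr1.
have old al be : bform k2 n z (xx al) (xx be) = bform (sker (s * (gd i * gd i.+1)) i.+2) n z (cc al) (cc be).
  apply: eq_bigr => p _; apply: eq_bigr => q _; rewrite /k2 /xx /sker (rmorphM Num.conj) fmorphV /=.
  have := zn0 p (ltn_ord p); have : (z q)^* != 0 by rewrite conjC_eq0; apply: zn0.
  move: (z p) ((z q)^*) (Lker i.+2 (z p) (z q)) (ofR (s * (gd i * gd i.+1))) ((cc be q)^*) (cc al p) => u v l g c1 c2 v0 u0.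
  by field; rewrite ?u0 ?v0.
have XX al be : tends (fun t => bform (sker s i) n.+1 (zz t) (X al t) (X be t))
    (bform (sker (s * (gd i * gd i.+1)) i.+2) n z (cc al) (cc be)).
  rewrite -old; apply: tends_eq (lim2 _ _ _ _ _ _ (tx0 al) (tx0 be)) => t.
  by rewrite decomp !sumX mulr0 mul0r add0r.
have XY al : tends (fun t => bform (sker s i) n.+1 (zz t) (X al t) (Y t)) 0.
  have := lim2 _ _ _ _ (xx al) (fun=> 0) (tx0 al) tkap.
  have -> : bform k2 n z (xx al) (fun=> 0) = 0.
    by rewrite /bform big1 // => p _; rewrite big1 // => q _; rewrite conjC0 mulr0.
  by apply: tends_eq => t; rewrite decomp sumX mulr0 mul0r add0r.
have YX al : tends (fun t => bform (sker s i) n.+1 (zz t) (Y t) (X al t)) 0.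
  have := lim2 _ _ _ _ (fun=> 0) (xx al) tkap (tx0 al).
  have -> : bform k2 n z (fun=> 0) (xx al) = 0.
    by rewrite /bform big1 // => p _; rewrite big1 // => q _; rewrite !mul0r.
  by apply: tends_eq => t; rewrite decomp sumX conjC0 mulr0 add0r.
have YY : s < 0 -> tends (fun t => bform (sker s i) n.+1 (zz t) (Y t) (Y t)) (-1).
  move=> sn; have := lim2 _ _ _ _ (fun=> 0) (fun=> 0) tkap tkap.
  have -> : bform k2 n z (fun=> 0) (fun=> 0) = 0.
    by rewrite /bform big1 // => p _; rewrite big1 // => q _; rewrite !mul0r.
  move=> /(tendsD (tends_cst (-1))); rewrite addr0; apply: tends_eq => t.
  rewrite decomp !sumY; congr (_ + _).
  have s0 : 0 < - ofR s by rewrite -rmorphN -(rmorph0 (@ofR R)) lt_ofR oppr_gt0.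
  have kr : kap^* = kap.
    by apply/CrealP; rewrite ger0_real // invr_ge0 sqrtC_ge0 ltW.
  rewrite kr -mulrA -expr2 exprVn sqrtCK invrN mulrN divff // -oppr_eq0 gt_eqF //.
(* The limits of the entries of the extended Gram matrix. *)
pose EE (al be : nat) := if s < 0 then
    (if al is al'.+1 then (if be is be'.+1 then bform (sker (s * (gd i * gd i.+1)) i.+2) n z (cc al') (cc be') else 0)
     else (if be is be'.+1 then 0 else -1))
  else bform (sker (s * (gd i * gd i.+1)) i.+2) n z (cc al) (cc be).
have tV al be : tends (fun t => bform (sker s i) n.+1 (zz t) (V al t) (V be t)) (EE al be).
  rewrite /V /EE; case: ifP => hs; last exact: XX.
  case: al => [|al]; case: be => [|be]; [exact: YY|exact: YX|exact: XY|exact: XX].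
have [N hN] := tends_fin (fun ij : 'I_((s < 0)%R + m) * 'I_((s < 0)%R + m) => tV ij.1 ij.2) e2.
exists n.+1, (zz N), (fun al => V al N); split; first exact: upzz.
move=> al be hal hbe.
have := hN N (Ordinal hal, Ordinal hbe) (leqnn _) => /= h1.
have h2 : mo (EE al be + (al == be)%:R) <= e / 2.
  rewrite /EE; case: ifP hal hbe => hs hal hbe; rewrite ?add1n ?add0n in hal hbe; last exact: hcc.
  case: al hal {h1} => [|al] hal; case: be hbe => [|be] hbe; rewrite ?eqSS ?addNr ?addr0 ?mo0 ?(ltW e2) //.
  exact: hcc.
have -> : bform (sker s i) n.+1 (zz N) (V al N) (V be N) + (al == be)%:R =
  (bform (sker s i) n.+1 (zz N) (V al N) (V be N) - EE al be) + (EE al be + (al == be)%:R) by ring.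
apply: le_trans (moD _ _) _; rewrite [e]splitr; apply: lerD h2; exact: ltW.
Qed.

Lemma attained_count J i (s : R) :
  neg_attained (sker s i) (\sum_(j < J) (s * Dp i (2 * j) < 0)%R).
Proof.
elim: J i s => [|J IH] i s.
  by rewrite big_ord0 => d e d0 e0; exists 0%N, (fun=> 0), (fun _ _ => 0).
rewrite big_ord_recl muln0 gaussD0 mulr1; apply: attained_step.
rewrite (eq_bigr (fun j : 'I_J => nat_of_bool (s * (gd i * gd i.+1) * Dp i.+2 (2 * j) < 0))).
  exact: IH.
by move=> j _; rewrite lift0 gaussD_recl2 !mulrA.
Qed.

Lemma count_negset (t : nat -> R) l : negset t l ->
  exists J, (\sum_(j < J) nat_of_bool (t j < 0)%R)%N = size l.
Proof.
move=> [ul hl]; pose J := (\max_(j <- l) j).+1; exists J.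
transitivity (count (mem l) (iota 0 J)).
  rewrite -(big_mkord xpredT (fun j => nat_of_bool (t j < 0)%R)) /index_iota subn0.
  rewrite -sum1_count [RHS]big_mkcond; apply: eq_bigr => j _.
  by have -> : (mem l) j = (j \in l) by []; rewrite hl; case: (j \in l).
rewrite -size_filter; apply: perm_size; apply: uniq_perm => //; first by rewrite filter_uniq ?iota_uniq.
move=> j; rewrite mem_filter mem_iota /= add0n /J ltnS andb_idr // => jl.
by rewrite (big_rem j) //= leq_maxl.
Qed.

Lemma sker_attained s i l : negset (fun j => s * Dp i (2 * j)) l -> neg_attained (sker s i) (size l).
Proof. by move=> /count_negset [J <-]; apply: attained_count. Qed.

(** The kernel of s F_1 / F_0 is s d_0 L_1, whose coefficients are the s D_(2j+1). *)
Lemma nevanlinna_P (s : R) l : negset (fun j => s * Dp 0 (2 * j + 1)) l ->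
  nevanlinna (size l) (fun z => ofR s * (P 1 z / P 0 z)).
Proof.
move=> hl.
have hl' : negset (fun j => s * gd 0 * Dp 1 (2 * j)) l.
  case: hl => ul hl; split=> // j; rewrite -hl addn1 /Dp big_ord_recl /= addn0 mulrA.
  by congr (_ * _ < 0); apply: eq_bigr => k _; rewrite lift0.
have E z w : slit_plane z -> slit_plane w ->
    pick_kernel (fun z => ofR s * P 1 z) (P 0) z w = sker (s * gd 0) 1 z w.
  move=> hz hw; rewrite /sker (rmorphM (@ofR R)) -mulrA -(pick_kernel_Lker _ _ hc 0 hz hw) /pick_kernel.
  by rewrite (rmorphM Num.conj) /= conj_ofR; ring.
have Eb n (z x y : nat -> C) : (forall p, (p < n)%N -> upper_half (z p)) ->
    bform (pick_kernel (fun z => ofR s * P 1 z) (P 0)) n z x y = bform (sker (s * gd 0) 1) n z x y.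
  move=> hz; apply: eq_bigr => p _; apply: eq_bigr => q _.
  by rewrite E //; apply: upper_slit; apply: hz.
apply: (@nevanlinna_of_kernel _ (fun z => ofR s * P 1 z) (P 0)).
- by move=> z hz; apply: anaM (ana_cst _ _) (ana_gaussF _ hz).
- by move=> z hz; apply: ana_gaussF.
- move=> z hz; rewrite rmorphM /= conj_ofR; congr (_ * _).
  exact: (hyp2F1_conj _ _ (c_shift_admissible hc 1) hz).
- move=> z hz; exact: (hyp2F1_conj _ _ (c_shift_admissible hc 0) hz).
- exact: gaussF_at0.
- by move=> z; rewrite mulrA.
- have [V hV] := sker_bounded hc hl'; exists V => n z x hz hx.
  by rewrite Eb //; apply: hV.
- move=> d e d0 e0; have [n [z [cc [hz hcc]]]] := sker_attained hl' d0 e0.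
  exists n, z, cc; split=> // i j hi hj; rewrite Eb; last by move=> p /hz [].
  exact: hcc.
Qed.

(** The kernel of s z F_1 / F_0 is s L_0, whose coefficients are the s D_(2j). *)
Lemma nevanlinna_zP (s : R) l : negset (fun j => s * Dp 0 (2 * j)) l ->
  nevanlinna (size l) (fun z => z * (ofR s * (P 1 z / P 0 z))).
Proof.
move=> hl.
have E z w : pick_kernel (fun z => ofR s * (z * P 1 z)) (P 0) z w = sker s 0 z w.
  by rewrite /sker /Lker /pick_kernel (rmorphM Num.conj (ofR s)) /= conj_ofR; ring.
have Eb n (z x y : nat -> C) : bform (pick_kernel (fun z => ofR s * (z * P 1 z)) (P 0)) n z x y = bform (sker s 0) n z x y.
  by apply: eq_bigr => p _; apply: eq_bigr => q _; rewrite E.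
apply: (@nevanlinna_of_kernel _ (fun z => ofR s * (z * P 1 z)) (P 0)).
- by move=> z hz; apply: anaM (ana_cst _ _) (anaM (ana_id _) (ana_gaussF _ hz)).
- by move=> z hz; apply: ana_gaussF.
- move=> z hz; rewrite !rmorphM /= conj_ofR; congr (_ * (_ * _)).
  exact: (hyp2F1_conj _ _ (c_shift_admissible hc 1) hz).
- move=> z hz; exact: (hyp2F1_conj _ _ (c_shift_admissible hc 0) hz).
- exact: gaussF_at0.
- by move=> z; rewrite !mulrA [z * _]mulrC.
- have [V hV] := sker_bounded hc hl; exists V => n z x hz hx.
  by rewrite Eb //; apply: hV.
- move=> d e d0 e0; have [n [z [cc [hz hcc]]]] := sker_attained hl d0 e0.
  exists n, z, cc; split=> // i j hi hj; rewrite Eb; exact: hcc.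
Qed.

End Attained.

(** * The sign of the Gamma function *)

Section GammaSign.
Variable R : realType.
Implicit Types (x y : R).

Definition gauss_product x (n : nat) : R := n`!%:R * n%:R `^ x / poch x n.+1.

Lemma poch_gt0 x n : 0 < x -> 0 < poch x n.
Proof. by move=> x0; apply: prodr_gt0 => i _; rewrite ltr_wpDr. Qed.

Lemma poch_neq0 x n : (forall k : nat, x + k%:R != 0) -> poch x n != 0.
Proof. by move=> h; apply/prodf_neq0 => i _. Qed.

Lemma gauss_product_gt0 x n : 0 < x -> 0 < gauss_product x n.+1.
Proof.
move=> x0; rewrite divr_gt0 ?poch_gt0 // mulr_gt0 ?powR_gt0 ?ltr0n ?fact_gt0 //.
Qed.

Definition dln (m : nat) : R := ln m.+2%:R - ln m.+1%:R.

Lemma dln_bounds m : m.+2%:R^-1 <= dln m <= m.+1%:R^-1.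
Proof.
have p1 : 0 < m.+1%:R :> R by rewrite ltr0n.
have p2 : 0 < m.+2%:R :> R by rewrite ltr0n.
have e : m.+2%:R = m.+1%:R + 1 :> R by rewrite natr1.
apply/andP; split.
  rewrite -lerN2 /dln opprB -ln_div ?posrE //.
  have -> : m.+1%:R / m.+2%:R = 1 + - m.+2%:R^-1 :> R.
    by rewrite e; move: (m.+1%:R) p1 => y y0; field; lra.
  apply: le_ln1Dx; rewrite ltrN2 invf_lt1 // ltr1n //.
rewrite /dln -ln_div ?posrE //.
have -> : m.+2%:R / m.+1%:R = 1 + m.+1%:R^-1 :> R.
  by rewrite e; move: (m.+1%:R) p1 => y y0; field; lra.
by apply: le_ln1Dx; apply: lt_le_trans (_ : 0 <= _); rewrite ?ltrN10 // invr_ge0.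
Qed.

Lemma gauss_product_ratio x m : (forall k : nat, x + k%:R != 0) ->
  gauss_product x m.+2 = gauss_product x m.+1 * (m.+2%:R / (x + m.+2%:R) * expR (x * dln m)).
Proof.
move=> hx; rewrite /gauss_product pochS factS natrM.
have -> : m.+2%:R `^ x = m.+1%:R `^ x * expR (x * dln m).
  by rewrite /powR !pnatr_eq0 /= -expRD /dln; congr expR; ring.
have p0 := poch_neq0 m.+2 hx; have h2 := hx m.+2.
move: (poch x m.+2) p0 (m.+2%:R) h2 (m.+1)`!%:R (m.+1%:R `^ x) (expR _) => p p0 v h2 w s t.
by field; rewrite ?p0 ?h2.
Qed.

(** For positive x the sequence increases. The increments of its logarithm are at
    most A (1/m - 1/(m+1)), with a telescoping sum, so it is bounded as well. *)
Lemma gauss_product_pos_cvg x : 0 < x -> exists2 l : R, 0 < l & gauss_product x @ \oo --> l.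
Proof.
move=> x0; pose g m := gauss_product x m.+1.
have hx (k : nat) : x + k%:R != 0 by rewrite gt_eqF // ltr_wpDr.
have g0 m : 0 < g m by apply: gauss_product_gt0.
have incr m : g m <= g m.+1.
  rewrite {2}/g gauss_product_ratio // ler_pMr ?g0 //.
  have /andP[h1 _] := dln_bounds m.
  have p2 : 0 < m.+2%:R :> R by rewrite ltr0n.
  have p3 : 0 < x + m.+2%:R by rewrite addr_gt0.
  rewrite mulrAC ler_pdivlMr // mul1r.
  apply: (@le_trans _ _ (m.+2%:R * (1 + x * dln m))); last by rewrite ler_pM2l // expR_ge1Dx.
  rewrite mulrDr mulr1 addrC lerD2l mulrCA ler_peMr ?(ltW x0) //.
  by rewrite -ler_pdivrMl // mulr1.
pose A := x + x ^+ 2; have A0 : 0 < A by rewrite addr_gt0 // exprn_gt0.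
have bnd m : g m <= g 0%N * expR (A * (1 - m.+1%:R^-1)).
  elim: m => [|m IH]; first by rewrite invr1 subrr mulr0 expR0 mulr1.
  rewrite {1}/g gauss_product_ratio // -/(g m).
  have /andP[_ h1] := dln_bounds m.
  have p1 : 0 < m.+1%:R :> R by rewrite ltr0n.
  have e : m.+2%:R = m.+1%:R + 1 :> R by rewrite natr1.
  apply: (@le_trans _ _ (g 0%N * expR (A * (1 - m.+1%:R^-1)) * expR (A * (m.+1%:R^-1 - m.+2%:R^-1)))); last first.
    by rewrite -mulrA -expRD; rewrite le_eqVlt; apply/orP; left; apply/eqP; congr (_ * expR _); ring.
  apply: ler_pM => //; first exact: ltW.
    by rewrite mulr_ge0 ?expR_ge0 // divr_ge0 // addr_ge0 // ltW.
  pose y := x / m.+2%:R; have y0 : 0 < y by rewrite divr_gt0 // ltr0n.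
  (* 1/(1+y) <= exp(y^2 - y) for positive y, by (1+y)(1 - y + y^2) = 1 + y^3. *)
  have k1 : m.+2%:R / (x + m.+2%:R) <= expR (- y + y ^+ 2).
    have -> : m.+2%:R / (x + m.+2%:R) = (1 + y)^-1.
      rewrite /y e; move: (m.+1%:R) p1 => v v0; have : 0 < x + (v + 1) by lra.
      by move=> h; field; rewrite ?gt_eqF //; lra.
    rewrite -[expR _]invrK lef_pV2 ?posrE ?invr_gt0 ?expR_gt0 //; last by lra.
    rewrite -expRN opprD opprK.
    have h2 : 1 + (y ^+ 2 - y) <= expR (y ^+ 2 - y) by apply: expR_ge1Dx.
    have h3 : 0 < 1 + (y ^+ 2 - y) by nra.
    have -> : y - y ^+ 2 = - (y ^+ 2 - y) by ring.
    rewrite expRN -[1 + y]invrK lef_pV2 ?posrE ?invr_gt0 ?expR_gt0 //; last by lra.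
    apply: le_trans h2; rewrite -div1r ler_pdivrMr; last by lra.
    by have := exprn_gt0 3 y0; nra.
  apply: (@le_trans _ _ (expR (- y + y ^+ 2) * expR (x * m.+1%:R^-1))).
    by apply: ler_pM; [rewrite divr_ge0 // addr_ge0 // ltW|exact: expR_ge0|exact: k1|rewrite ler_expR ler_pM2l].
  rewrite -expRD ler_expR /A /y e; move: (m.+1%:R) p1 => v v0.
  have -> : - (x / (v + 1)) + (x / (v + 1)) ^+ 2 + x * v^-1 =
    x * (v^-1 - (v + 1)^-1) + x ^+ 2 * (v + 1)^-2 by field; lra.
  rewrite mulrDl lerD2l ler_pM2l ?exprn_gt0 //.
  have -> : v^-1 - (v + 1)^-1 = (v * (v + 1))^-1 by field; lra.
  have q : 0 < v + 1 by lra.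
  by rewrite lef_pV2 ?posrE ?mulr_gt0 ?exprn_gt0 // expr2 ler_pM2r //; lra.
have ub m : g m <= g 0%N * expR A.
  apply: le_trans (bnd m) _; apply: ler_wpM2l; first exact: ltW.
  rewrite ler_expR; apply: ler_piMr; first exact: ltW.
  by rewrite lerBlDr lerDl invr_ge0.
have cg : cvgn g.
  apply: nondecreasing_is_cvgn; first by apply/nondecreasing_seqP.
  by exists (g 0%N * expR A) => _ [m _ <-].
exists (limn g).
  apply: lt_le_trans (g0 0%N) _; apply: nondecreasing_cvgn_le => //.
  by apply/nondecreasing_seqP.
by rewrite -cvg_shiftS; exact: cg.
Qed.

Definition gamma_defined x := forall n : nat, x + n%:R != 0.

Lemma gauss_product_shift x n : gamma_defined x ->
  gauss_product (x + 1) n.+1 = gauss_product x n.+1 * (x * (n.+1%:R / (x + n.+2%:R))).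
Proof.
move=> hx; rewrite /gauss_product.
have -> : n.+1%:R `^ (x + 1) = n.+1%:R `^ x * n.+1%:R.
  by rewrite /powR pnatr_eq0 /= mulrDl mul1r expRD lnK // posrE ltr0n.
have x0 : x != 0 by have := hx 0%N; rewrite addr0.
have -> : poch (x + 1) n.+2 = poch x n.+2 * (x + n.+2%:R) / x.
  by rewrite -pochS (pochSl x) [x * _]mulrC mulfK.
have p0 := poch_neq0 n.+2 hx; have h2 := hx n.+2.
move: (poch x n.+2) p0 (n.+2%:R) h2 (n.+1)`!%:R (n.+1%:R `^ x) (n.+1%:R) => p p0 v h2 w s t.
by field; rewrite ?p0 ?h2 ?x0.
Qed.

Lemma cvg_shift_ratio x : gamma_defined x -> (fun n : nat => n.+1%:R / (x + n.+2%:R)) @ \oo --> (1 : R).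
Proof.
move=> hx.
have -> : (fun n : nat => n.+1%:R / (x + n.+2%:R)) = (fun n => (1 + (x + 1) * (harmonic n : R))^-1).
  apply/funext => n; rewrite /harmonic /=.
  have := hx n.+2; rewrite -(natr1 n.+1) => h.
  have : n.+1%:R != 0 :> R by rewrite pnatr_eq0.
  move: (n.+1%:R) h => v h v0.
  have h' : v + (x + 1) != 0 by rewrite addrCA.
  by field; rewrite ?v0 ?h ?h'.
have h : (fun n => 1 + (x + 1) * (harmonic n : R)) @ \oo --> (1 + (x + 1) * 0 : R).
  by apply: cvgD; [exact: cvg_cst|apply: cvgMr; exact: cvg_harmonic].
rewrite mulr0 addr0 in h; rewrite -[X in _ --> X]invr1; apply: cvgV => //; exact: oner_neq0.
Qed.

Definition gamma_cvg x := exists2 l : R, l != 0 & gauss_product x @ \oo --> l.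

Lemma Gamma_lim x (l : R) : gauss_product x @ \oo --> l -> Gamma_fun x = l.
Proof. by move=> h; exact: (cvg_lim _ h). Qed.

Lemma gauss_product_up x (l : R) : gamma_defined x -> gauss_product x @ \oo --> l ->
  gauss_product (x + 1) @ \oo --> x * l.
Proof.
move=> hx; rewrite -cvg_shiftS => hl; rewrite -cvg_shiftS.
have -> : (fun n => gauss_product (x + 1) n.+1) = fun n => gauss_product x n.+1 * (x * (n.+1%:R / (x + n.+2%:R))).
  by apply/funext => n; rewrite gauss_product_shift.
have h3 : (fun n : nat => x * (n.+1%:R / (x + n.+2%:R))) @ \oo --> (x * 1 : R).
  by apply: cvgMr; exact: cvg_shift_ratio hx.
have -> : x * l = l * (x * 1) by rewrite mulr1 mulrC.
exact: (cvgM hl h3).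
Qed.

Lemma gauss_product_down x (l : R) : gamma_defined x -> gauss_product (x + 1) @ \oo --> l ->
  gauss_product x @ \oo --> l / x.
Proof.
move=> hx; rewrite -cvg_shiftS => hl; rewrite -cvg_shiftS.
have x0 : x != 0 by have := hx 0%N; rewrite addr0.
have -> : [sequence gauss_product x n.+1]_n = fun n => gauss_product (x + 1) n.+1 * (x^-1 * (n.+1%:R / (x + n.+2%:R))^-1).
  apply/funext => n; rewrite gauss_product_shift //=.
  have n0 : n.+1%:R != 0 :> R by rewrite pnatr_eq0.
  have := hx n.+2; move: (gauss_product x n.+1) (n.+1%:R) n0 (n.+2%:R) => g v v0 w h.
  by field; rewrite ?v0 ?x0 ?h.
have h2 : (fun n : nat => (n.+1%:R / (x + n.+2%:R))^-1) @ \oo --> (1^-1 : R).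
  by apply: cvgV; [exact: oner_neq0|exact: cvg_shift_ratio hx].
have h3 : (fun n : nat => x^-1 * (n.+1%:R / (x + n.+2%:R))^-1) @ \oo --> (x^-1 * 1^-1 : R).
  by apply: cvgMr.
have -> : l / x = l * (x^-1 * 1^-1) by rewrite invr1 mulr1.
exact: (cvgM hl h3).
Qed.

(** The functional equation of the products moves the argument to the positive
    half-line. *)
Lemma Gamma_cvg x : gamma_defined x -> gamma_cvg x.
Proof.
move=> hx; have [k hk] : exists k : nat, 0 < x + k%:R.
  exists (Num.truncn `|x|).+1; have := truncnS_gt `|x|; have := ler_norm (- x); rewrite normrN; lra.
elim: k x hx hk => [|k IH] x hx hk.
  rewrite addr0 in hk; have [l l0 hl] := gauss_product_pos_cvg hk.
  by exists l => //; rewrite gt_eqF.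
have hx1 : gamma_defined (x + 1) by move=> n; have := hx n.+1; rewrite -nat1r addrA.
have [|l l0 hl] := IH _ hx1; first by rewrite -addrA nat1r.
exists (l / x); last exact: gauss_product_down.
by rewrite mulf_neq0 // invr_eq0; have := hx 0%N; rewrite addr0.
Qed.

Lemma Gamma_neq0 x : gamma_defined x -> Gamma_fun x != 0.
Proof. by move=> /Gamma_cvg [l l0 /Gamma_lim ->]. Qed.

Lemma Gamma_rec x : gamma_defined x -> Gamma_fun (x + 1) = x * Gamma_fun x.
Proof.
move=> hx; have [l l0 hl] := Gamma_cvg hx.
by rewrite (Gamma_lim hl) (Gamma_lim (gauss_product_up hx hl)).
Qed.

Lemma Gamma_poch x n : gamma_defined x -> Gamma_fun (x + n%:R) = poch x n * Gamma_fun x.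
Proof.
move=> hx; elim: n => [|n IH]; first by rewrite addr0 poch0 mul1r.
rewrite -natr1 addrA Gamma_rec; first by rewrite IH pochS; ring.
by move=> k; have := hx (n + k)%N; rewrite natrD addrA.
Qed.

Lemma Gamma_gt0 x : 0 < x -> 0 < Gamma_fun x.
Proof. by move=> /gauss_product_pos_cvg [l l0 /Gamma_lim ->]. Qed.

End GammaSign.

(** * Signs of the products of the partial numerators *)

Section Signs.
Variable R : realType.
Implicit Types (x y : R).
Variables (a b c : R).
Hypothesis hc : forall n : nat, - c != n%:R.
Local Notation gd := (gaussd a b c).
Local Notation Dp := (gaussD a b c).
Local Notation parA := (parA a b).
Local Notation parB := (parB a b).

(** The numerator of d_k; in contrast to the denominator it decides the zeros of
    d_k. *)
Definition numg k : R := parA k * (c + k%:R - parB k).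
Definition Np i n : R := \prod_(k < n) numg (i + k).

Lemma par_even j : parA (2 * j) = a + j%:R /\ parB (2 * j) = b + j%:R.
Proof.
elim: j => [|j [h1 h2]]; first by rewrite muln0 /parA /parB /= !addr0.
by rewrite (_ : (2 * j.+1 = (2 * j).+2)%N) ?parAS ?parBS ?parAS ?h1 ?h2 -?natr1 ?addrA //; lia.
Qed.

Lemma numg_even j : numg (2 * j) = (a + j%:R) * (c - b + j%:R).
Proof. by have [h1 h2] := par_even j; rewrite /numg h1 h2 natrM; ring. Qed.

Lemma numg_odd j : numg (2 * j).+1 = (b + j%:R + 1) * (c - a + j%:R + 1).
Proof. by have [h1 h2] := par_even j; rewrite /numg parAS parBS h1 h2 -natr1 natrM; ring. Qed.

Lemma gaussd_sg k : Num.sg (gd k) = Num.sg (numg k) * Num.sg (c + k%:R) * Num.sg (c + k.+1%:R).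
Proof.
have E : c + k%:R + 1 = c + k.+1%:R by rewrite -addrA natr1.
rewrite /gd -/(numg k) E; move: (numg k) => u.
by rewrite sgrM sgrV [Num.sg (_ * _)]sgrM mulrA.
Qed.

Lemma gaussd_eq0 k : (gd k == 0) = (numg k == 0).
Proof.
have E : c + k%:R + 1 = c + k.+1%:R by rewrite -addrA natr1.
rewrite /gd -/(numg k) E; move: (numg k) => u; rewrite mulf_eq0 invr_eq0 [(_ * _) == 0]mulf_eq0.
by rewrite (negPf (c_shift_neq0 hc k)) (negPf (c_shift_neq0 hc k.+1)) !orbF.
Qed.

Lemma sg_c2 k : Num.sg (c + k%:R) * Num.sg (c + k%:R) = 1.
Proof. by rewrite -expr2 sqr_sg (c_shift_neq0 hc k). Qed.

(** The denominators (c+k)(c+k+1) telescope up to squares. *)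
Lemma gaussD_sg i n : Num.sg (Dp i n) = Num.sg (c + i%:R) * Num.sg (c + (i + n)%:R) * Num.sg (Np i n).
Proof.
elim: n => [|n IH]; first by rewrite /Dp /Np !big_ord0 addn0 sg_c2 sgr1 mulr1.
rewrite /Dp /Np !big_ord_recr /= -/(Dp i n) -/(Np i n) (sgrM (Dp i n)) (sgrM (Np i n)) IH gaussd_sg addnS.
have := sg_c2 (i + n); move: (Num.sg (c + (i + n)%:R)) => u uu.
rewrite -[RHS]mul1r -uu; ring.
Qed.

Lemma Np_even i l : Np (2 * i) (2 * l) = poch (a + i%:R) l * poch (c - b + i%:R) l *
  poch (b + i%:R + 1) l * poch (c - a + i%:R + 1) l.
Proof.
elim: l => [|l IH]; first by rewrite muln0 /Np big_ord0 !poch0 !mulr1.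
rewrite (_ : (2 * l.+1 = (2 * l).+2)%N); last by lia.
rewrite /Np !big_ord_recr /= -/(Np _ _) IH addnS -mulnDr numg_even numg_odd !pochS natrD; ring.
Qed.

Lemma Np_odd i l : Np (2 * i).+1 (2 * l) = poch (a + i.+1%:R) l * poch (c - b + i.+1%:R) l *
  poch (b + i%:R + 1) l * poch (c - a + i%:R + 1) l.
Proof.
elim: l => [|l IH]; first by rewrite muln0 /Np big_ord0 !poch0 !mulr1.
rewrite (_ : (2 * l.+1 = (2 * l).+2)%N); last by lia.
rewrite /Np !big_ord_recr /= -/(Np _ _) IH addnS !addSn -mulnDr numg_odd.
rewrite (_ : (2 * (i + l)).+2 = (2 * (i + l).+1)%N); last by lia.
rewrite numg_even !pochS -addnS !natrD -natr1; ring.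
Qed.

Lemma Np_recr i n : Np i n.+1 = Np i n * numg (i + n).
Proof. by rewrite /Np big_ord_recr. Qed.

(** The signs in the statement are those of D_s / D_i, while the kernels
    produce the signs of D_i. *)
Lemma gaussD_split i n : (i <= n)%N -> Dp 0 n = Dp 0 i * Dp i (n - i).
Proof. by move=> h; rewrite -{1}(subnKC h) /Dp big_split_ord. Qed.

Lemma sg_div_sq x y : Num.sg (x / y) = Num.sg x * Num.sg y.
Proof. by rewrite sgrM sgrV. Qed.

Lemma epsB1_0 s1 j : (j <= s1)%N -> epsB1 a b c s1 j 0 = Num.sg (Dp (2 * j) (2 * s1 - 2 * j)).
Proof.
move=> h; rewrite gaussD_sg -mulnBr Np_even -mulnDr subnKC // /epsB1 sg_div_sq !addn0 !subn0 mulrC.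
by rewrite [Num.sg (_ * (c + _))]sgrM.
Qed.

Lemma epsB1_1 s1 j : (j < s1)%N -> epsB1 a b c s1 j 1 = Num.sg (Dp (2 * j).+1 (2 * s1 - (2 * j).+1)).
Proof.
move=> h; have [l hl] : exists l, s1 = (j + l).+1 by exists (s1 - j.+1)%N; lia.
rewrite gaussD_sg (_ : (2 * s1 - (2 * j).+1 = (2 * l).+1)%N); last by lia.
have E1 : ((2 * j).+1 + 2 * l = (2 * (j + l)).+1)%N by lia.
have E2 : ((2 * j).+1 + (2 * l).+1 = 2 * s1)%N by lia.
rewrite Np_recr Np_odd E1 numg_odd E2.
have E3 : (s1 - j - 1 = l)%N by lia.
have E4 : (s1 - j = l.+1)%N by lia.
rewrite /epsB1 sg_div_sq !addn1 E3 E4.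
rewrite mulrC [Num.sg (_ * (c + _))]sgrM; congr (_ * Num.sg _); rewrite !pochS natrD; ring.
Qed.

Lemma epsB2_1 s2 j : (j < s2)%N -> epsB2 a b c s2 j 1 = Num.sg (Dp (2 * j) (2 * s2 - 1 - 2 * j)).
Proof.
move=> h; have [l hl] : exists l, s2 = (j + l).+1 by exists (s2 - j.+1)%N; lia.
rewrite gaussD_sg (_ : (2 * s2 - 1 - 2 * j = (2 * l).+1)%N); last by lia.
rewrite Np_recr Np_even -mulnDr numg_even.
have E3 : (s2 - j - 1 = l)%N by lia.
have E4 : (s2 - j = l.+1)%N by lia.
rewrite /epsB2 sg_div_sq !addn1 E3 E4.
have -> : c + (2 * j)%:R - 1 + 1 = c + (2 * j)%:R by ring.
have -> : c + (2 * s2)%:R - 1 = c + (2 * j + (2 * l).+1)%:R.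
  by rewrite (_ : (2 * s2 = (2 * j + (2 * l).+1).+1)%N) -?natr1; [ring|lia].
have -> : b + j.+1%:R = b + j%:R + 1 by rewrite -natr1 addrA.
have -> : c - a + j.+1%:R = c - a + j%:R + 1 by rewrite -natr1 addrA.
rewrite mulrC [Num.sg (_ * (c + _))]sgrM; congr (_ * Num.sg _); rewrite !pochS natrD; ring.
Qed.

Lemma epsB2_0 s2 j : (j.+1 < s2)%N ->
  epsB2 a b c s2 j.+1 0 = Num.sg (Dp (2 * j).+1 (2 * s2 - 1 - (2 * j).+1)).
Proof.
move=> h; have [l hl] : exists l, s2 = (j + l).+1 by exists (s2 - j.+1)%N; lia.
rewrite gaussD_sg (_ : (2 * s2 - 1 - (2 * j).+1 = 2 * l)%N); last by lia.
rewrite Np_odd /epsB2 sg_div_sq !addn0 !subn0 (_ : (s2 - j.+1 = l)%N); last by lia.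
have -> : c + (2 * j.+1)%:R - 1 + 0 = c + (2 * j).+1%:R.
  by rewrite (_ : (2 * j.+1 = (2 * j).+2)%N) -?natr1; [ring|lia].
have -> : c + (2 * s2)%:R - 1 = c + ((2 * j).+1 + 2 * l)%:R.
  by rewrite (_ : (2 * s2 = ((2 * j).+1 + 2 * l).+1)%N) -?natr1; [ring|lia].
rewrite mulrC [Num.sg (_ * (c + _))]sgrM; congr (_ * Num.sg _).
have -> : b + j.+1%:R = b + j%:R + 1 by rewrite -natr1 addrA.
have -> : c - a + j.+1%:R = c - a + j%:R + 1 by rewrite -natr1 addrA.
by ring.
Qed.

Lemma nat_half_cases k : exists j, k = (2 * j)%N \/ k = (2 * j).+1.
Proof.
exists k./2; have := odd_double_half k; rewrite -mul2n.
by case: (odd k) => /= E; [right|left]; rewrite -{1}E.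
Qed.

Lemma gaussd_even_eq0 j : (gd (2 * j) == 0) = (j%:R \in [:: - a; b - c]).
Proof.
rewrite gaussd_eq0 numg_even mulf_eq0 !inE; congr (_ || _).
  by rewrite addrC addr_eq0.
by rewrite addrC addr_eq0 opprB.
Qed.

Lemma gaussd_odd_eq0 j : (gd (2 * j).+1 == 0) = (j.+1%:R \in [:: - b; a - c]).
Proof.
rewrite gaussd_eq0 numg_odd mulf_eq0 !inE -!addrA !natr1; congr (_ || _).
  by rewrite addrC addr_eq0.
by rewrite addrA addrC addr_eq0 opprB.
Qed.

Lemma rational_caseP : rational_case a b c <-> exists k, gd k == 0.
Proof.
split=> [[n]|[k]].
  rewrite !inE => /or4P[] /eqP h.
  - by exists (2 * n)%N; rewrite gaussd_even_eq0 !inE h eqxx.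
  - by exists (2 * n).+1; rewrite gaussd_odd_eq0 !inE -natr1 h subrK eqxx.
  - by exists (2 * n).+1; rewrite gaussd_odd_eq0 !inE -natr1 h subrK eqxx orbT.
  - by exists (2 * n)%N; rewrite gaussd_even_eq0 !inE h eqxx orbT.
have [j [|] ->] := nat_half_cases k; [rewrite gaussd_even_eq0|rewrite gaussd_odd_eq0];
  rewrite !inE => /orP[] /eqP h; exists j; rewrite !inE.
- by rewrite h eqxx.
- by rewrite h eqxx !orbT.
- by rewrite -h -natr1 addrK eqxx orbT.
- by rewrite -h -natr1 addrK eqxx !orbT.
Qed.

Lemma card_eq_seq (P : set nat) (l : seq nat) : uniq l -> (forall j, P j <-> j \in l) ->
  (P #= `I_(size l))%card.
Proof.
move=> ul hl; apply/card_set_bijP; exists (fun j => index j l); split.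
- by move=> j /hl jl; rewrite /= index_mem.
- move=> i j; rewrite !inE => /hl il /hl jl h.
  by rewrite -(nth_index 0%N il) h nth_index.
- move=> k /= kl; exists (nth 0%N l k); last by rewrite index_uniq.
  by apply/hl; rewrite mem_nth.
Qed.

Lemma negset_filter (t : nat -> R) N : (forall j, (N <= j)%N -> 0 <= t j) ->
  negset t [seq j <- iota 0 N | t j < 0].
Proof.
move=> h; split; first by rewrite filter_uniq ?iota_uniq.
move=> j; rewrite mem_filter mem_iota /= add0n; case: ltnP => jN; first by rewrite andbT.
by rewrite andbF; apply/negbTE; rewrite -leNgt h.
Qed.

Section NonRational.
Hypothesis nonrat : ~ rational_case a b c.

Lemma gaussd_neq0 k : gd k != 0.
Proof. by apply/negP => h; apply: nonrat; apply/rational_caseP; exists k. Qed.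

Lemma nonrat_gamma_defined : [/\ gamma_defined a, gamma_defined (c - b), gamma_defined (b + 1)
  & gamma_defined (c - a + 1)].
Proof.
split=> n; apply/eqP => h; apply: nonrat; exists n; rewrite !inE.
- by rewrite -(_ : - a = n%:R) ?eqxx //; lra.
- by rewrite -(_ : b - c = n%:R) ?eqxx ?orbT //; lra.
- by rewrite -(_ : - b - 1 = n%:R) ?eqxx ?orbT //; lra.
- by rewrite -(_ : a - c - 1 = n%:R) ?eqxx ?orbT //; lra.
Qed.

Let G := Num.sg c * (Num.sg (Gamma_fun a) * Num.sg (Gamma_fun (c - b)) *
  Num.sg (Gamma_fun (b + 1)) * Num.sg (Gamma_fun (c - a + 1))).

(** The Gamma factors at index j differ from those at index 0 by Pochhammer symbols,
    whose product is the numerator of D_(2j). *)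
Lemma theta_signE j : theta_sign a b c j = G * Num.sg (Dp 0 (2 * j)).
Proof.
have [h1 h2 h3 h4] := nonrat_gamma_defined.
rewrite /theta_sign [b + j%:R + 1]addrAC [c - a + j%:R + 1]addrAC !Gamma_poch //.
have := Np_even 0 j; rewrite muln0 !addr0 => E.
rewrite gaussD_sg add0n addr0 E /G.
move: (poch a j) (poch (c - b) j) (poch (b + 1) j) (poch (c - a + 1) j) => p1 p2 p3 p4.
move: (Gamma_fun a) (Gamma_fun (c - b)) (Gamma_fun (b + 1)) (Gamma_fun (c - a + 1)) => g1 g2 g3 g4.
rewrite !sgrM; have := sg_c2 0; rewrite addr0; move: (Num.sg c) => u uu.
rewrite -[LHS]mul1r -uu; ring.
Qed.

Lemma theta0E : theta_sign a b c 0 = G.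
Proof. by rewrite theta_signE muln0 gaussD0 sgr1 mulr1. Qed.

Lemma theta_signD j : theta_sign a b c j = theta_sign a b c 0 * Num.sg (Dp 0 (2 * j)).
Proof. by rewrite theta0E theta_signE. Qed.

Lemma eta_signD j : eta_sign a b c j.+1 = theta_sign a b c 0 * Num.sg (Dp 0 (2 * j).+1).
Proof.
have [h1 h2 h3 h4] := nonrat_gamma_defined.
rewrite theta0E /eta_sign.
have -> : b + j.+1%:R = b + 1 + j%:R by rewrite -nat1r addrA.
have -> : c - a + j.+1%:R = c - a + 1 + j%:R by rewrite -nat1r addrA.
have -> : c + (2 * j.+1)%:R - 1 = c + (2 * j).+1%:R.
  by rewrite (_ : (2 * j.+1 = (2 * j).+2)%N) -?natr1; [ring|lia].
rewrite !Gamma_poch // gaussD_sg add0n addr0 Np_recr add0n numg_even.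
have := Np_even 0 j; rewrite muln0 !addr0 => ->.
rewrite /G !pochS.
have e1 : b + j%:R + 1 = b + 1 + j%:R by rewrite addrAC.
move: (poch a j) (poch (c - b) j) (poch (b + 1) j) (poch (c - a + 1) j) => p1 p2 p3 p4.
move: (Gamma_fun a) (Gamma_fun (c - b)) (Gamma_fun (b + 1)) (Gamma_fun (c - a + 1)) => g1 g2 g3 g4.
rewrite !sgrM; have := sg_c2 0; rewrite addr0; move: (Num.sg c) => u uu.
rewrite -[LHS]mul1r -uu; ring.
Qed.

Lemma theta0_pm : theta_sign a b c 0 = 1 \/ theta_sign a b c 0 = -1.
Proof.
have h : theta_sign a b c 0 != 0.
  have [h1 h2 h3 h4] := nonrat_gamma_defined; have c0 := c_shift_neq0 hc 0; rewrite addr0 in c0.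
  by rewrite theta0E /G !mulf_neq0 // sgr_eq0 ?Gamma_neq0.
move: h; rewrite /theta_sign; move: (_ * Gamma_fun (c - a + _ + 1)) => X; rewrite sgr_eq0 => X0.
have [Xp|Xn] := ltrP 0 X; first by left; apply: gtr0_sg.
by right; apply: ltr0_sg; rewrite lt_neqAle X0.
Qed.

(** For large j every factor is positive. *)
Lemma signs_eventually_pos : exists N, forall j, (N <= j)%N ->
  0 <= theta_sign a b c j /\ 0 <= eta_sign a b c j.
Proof.
pose B := `|a| + `|b| + `|c| + 1.
exists (Num.truncn B).+2 => j hj.
have hB : B + 1 <= j%:R.
  apply: (@le_trans _ _ (Num.truncn B).+2%:R); last by rewrite ler_nat.
  by rewrite -(natr1 (Num.truncn B).+1) lerD2r ltW // truncnS_gt.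
have := ler_norm a; have := ler_norm b; have := ler_norm c.
have := ler_norm (- a); have := ler_norm (- b); have := ler_norm (- c); rewrite !normrN.
rewrite /B in hB => ? ? ? ? ? ?.
have j2 : (2 * j)%:R = j%:R + j%:R :> R by rewrite -natrD addnn mul2n.
have p : forall x, - (`|a| + `|b| + `|c|) <= x -> 0 < Gamma_fun (x + j%:R).
  by move=> x hx; apply: Gamma_gt0; lra.
rewrite /theta_sign /eta_sign j2 [b + j%:R + 1]addrAC [c - a + j%:R + 1]addrAC.
by split; apply: ltW; rewrite sgr_gt0; do 4?[apply: mulr_gt0]; (try apply: p); lra.
Qed.

Lemma nonterminating_negsets : exists lk ll, [/\
  negset (fun j => theta_sign a b c 0 * Dp 0 (2 * j)) ll,
  negset (fun j => theta_sign a b c 0 * Dp 0 (2 * j + 1)) lk,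
  ([set j : nat | theta_sign a b c j < 0] #= `I_(size ll))%card &
  ([set j : nat | (1 <= j)%N /\ eta_sign a b c j < 0] #= `I_(size lk))%card].
Proof.
have [N hN] := signs_eventually_pos.
have sgt j : (theta_sign a b c 0 * Dp 0 (2 * j) < 0) = (theta_sign a b c j < 0).
  rewrite -sgr_lt0 sgrM [in RHS]theta_signD; congr (_ * _ < 0).
  by case: theta0_pm => ->; rewrite ?sgr1 ?sgrN1.
have sge j : (theta_sign a b c 0 * Dp 0 (2 * j + 1) < 0) = (eta_sign a b c j.+1 < 0).
  rewrite -sgr_lt0 sgrM addn1 [in RHS]eta_signD; congr (_ * _ < 0).
  by case: theta0_pm => ->; rewrite ?sgr1 ?sgrN1.
have n1 : negset (fun j => theta_sign a b c j) [seq j <- iota 0 N | theta_sign a b c j < 0].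
  by apply: negset_filter => j /hN [].
have n2 : negset (fun j => eta_sign a b c j.+1) [seq j <- iota 0 N | eta_sign a b c j.+1 < 0].
  by apply: (@negset_filter (fun j => eta_sign a b c j.+1)) => j h; case: (hN j.+1 (leqW h)).
exists [seq j <- iota 0 N | eta_sign a b c j.+1 < 0], [seq j <- iota 0 N | theta_sign a b c j < 0]; split.
- by case: n1 => u1 h; split=> // j; rewrite sgt h.
- by case: n2 => u1 h; split=> // j; rewrite sge h.
- by case: n1 => u1 h; apply: card_eq_seq => // j; rewrite /= h.
- case: n2 => u1 h; rewrite -(size_map succn); apply: card_eq_seq.
    by rewrite map_inj_uniq // => ? ? [].
  move=> j; split=> [[+ +]|/mapP [i + ->]]; last by rewrite -h.
  by case: j => // j _; rewrite h => hj; rewrite mem_map // => ? ? [].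
Qed.

End NonRational.
End Signs.

(** * Rationality *)

Section Rational.
Variable R : realType.
Local Notation C := (Cx R).
Implicit Types (z h : C) (p q U V : {poly C}).
Variables (a b c : R).
Hypothesis hc : forall n : nat, - c != n%:R.
Local Notation P := (gaussF a b c).
Local Notation gd := (gaussd a b c).

Lemma R011E z : R011 a b c z = P 1 z / P 0 z.
Proof. by rewrite /R011 /gaussF /parA /parB /= addr0 [hyp2F1 (b + 1) a _]hyp2F1_sym. Qed.

Lemma ana_horner p z : ana (fun z => p.[z]) z.
Proof.
elim/poly_ind: p => [|p x IH].
  by apply: ana_ext (ana_cst 0 z) => y; rewrite horner0.
apply: (@ana_ext _ (fun z => p.[z] * z + x)); first by move=> y; rewrite hornerMXaddC.
exact: anaD (anaM IH (ana_id _)) (ana_cst _ _).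
Qed.

Lemma poly_flat0 p (d : R) : 0 < d -> (forall h, mo h <= d -> p.[h] = 0) -> p = 0.
Proof.
move=> d0 hp; apply/eqP/negPn/negP => p0.
(* More real roots in the disc than the degree allows. *)
pose f (k : nat) : C := ofR (d / k.+1%:R).
have fi : injective f.
  move=> i j /ofR_inj; move/(mulfI _); rewrite gt_eqF // => /(_ isT) /invr_inj /eqP.
  by rewrite eqr_nat eqSS => /eqP.
have : all (root p) [seq f k | k <- iota 0 (size p)].
  apply/allP => _ /mapP [k _ ->]; apply/eqP; apply: hp; rewrite mo_ofR ger0_norm ?divr_ge0 ?(ltW d0) //.
  by rewrite ler_pdivrMr ?ltr0n // ler_peMr ?(ltW d0) // ler1n.
by move=> /(max_poly_roots p0); rewrite map_inj_uniq // iota_uniq size_map size_iota ltnn => /(_ isT).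
Qed.

(** The zeros of a nonzero germ are isolated. *)
Lemma punctured_zero (f : C -> C) (d : R) : 0 < d -> ana f 0 ->
  (forall h, h != 0 -> mo h < d -> f h = 0) -> forall h, mo h < d -> f h = 0.
Proof.
move=> d0 hf h0 h hd; case: (eqVneq h 0) => [->|hn]; last exact: h0.
have [[e e0 he]|[l [g [ag g0 [e e0 he]]]]] := ana_dichotomy hf.
  by have := he 0; rewrite mo0 add0r; apply; apply: ltW.
have [e' e'0 he'] := ana_near_neq0 ag g0.
pose t := Num.min d (Num.min e e') / 2.
have m0 : 0 < Num.min d (Num.min e e') by rewrite !lt_min d0 e0.
have t0 : 0 < t by rewrite divr_gt0.
have tm : t < Num.min d (Num.min e e') by rewrite ltr_pdivrMr // ltr_pMr // ltr1n.
move: tm; rewrite !lt_min => /and3P[td te te'].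
have mt : mo (ofR t) = t by rewrite mo_ofR ger0_norm // ltW.
have tn : ofR t != 0 by rewrite -mo_eq0 mt gt_eqF.
have := he (ofR t); rewrite mt (ltW te) add0r => /(_ isT).
rewrite h0 ?mt // => /esym/eqP; rewrite mulf_eq0 expf_eq0 (negPf tn) andbF /=.
by have := he' (ofR t); rewrite mt add0r => /(_ te') /negPf ->.
Qed.

(** The relation F_m / F_(m+1) = U / V near the origin, without denominators. *)
Definition germ_ratio m U V := exists2 d : R, 0 < d & forall z, mo z < d -> P m.+1 z * U.[z] = P m z * V.[z].

(** Both functions take the value 1 at the origin, so U and V agree there and
    W = (V - U) / (d_m z) is a polynomial. Gauss's relation makes it the next
    term: F_(m+1) / F_(m+2) = V / W. *)
Lemma germ_ratio_step m U V : gd m != 0 -> germ_ratio m U V -> exists W,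
  [/\ germ_ratio m.+1 V W, (size W <= (maxn (size U) (size V)).-1)%N & W = 0 -> V = U].
Proof.
move=> g0 [d d0 hd].
have e0 : (V - U).[0] = 0.
  have := hd 0; rewrite mo0 !(gaussF_at0 a b hc) !mul1r => /(_ d0) E.
  by rewrite hornerD hornerN E subrr.
have /factor_theorem [W0 hW0] : root (V - U) 0 by rewrite /root e0.
rewrite subr0 in hW0.
have gC : ofR (gd m) != 0 by rewrite -(rmorph0 (@ofR R)) (inj_eq (@ofR_inj R)).
exists ((ofR (gd m))^-1 *: W0); split.
- pose d' := Num.min d 1; have d'0 : 0 < d' by rewrite lt_min d0 ltr01.
  exists d' => // z hz; apply/eqP; rewrite -subr_eq0; apply/eqP; move: z hz.
  apply: (@punctured_zero (fun z => P m.+2 z * V.[z] - P m.+1 z * ((ofR (gd m))^-1 *: W0).[z]) _ d'0).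
    apply: anaB; apply: anaM; rewrite ?(ana_gaussF a b hc) //; try exact: ana_horner.
      by apply: ana_gaussF => //; exact: slit0.
    by apply: ana_gaussF => //; exact: slit0.
  move=> h hn; rewrite lt_min => /andP[h1 h2].
  have hs := disc_slit h2; have := hd h h1; rewrite (gaussF_contiguous _ _ hc m hs) => E.
  have EW : V.[h] = U.[h] + W0.[h] * h.
    by have := congr1 (fun p => p.[h]) hW0; rewrite hornerD hornerN hornerMX => <-; rewrite addrC subrK.
  apply: (mulfI hn); apply: (mulfI gC); rewrite !mulr0 hornerZ.
  have -> : ofR (gd m) * (h * (P m.+2 h * V.[h] - P m.+1 h * ((ofR (gd m))^-1 * W0.[h]))) =
    ofR (gd m) * (h * P m.+2 h) * V.[h] - (ofR (gd m) / ofR (gd m)) * P m.+1 h * (W0.[h] * h) by ring.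
  rewrite divff // mul1r; have -> : W0.[h] * h = V.[h] - U.[h] by rewrite EW addrC addKr.
  by rewrite mulrBr E; ring.
- apply: leq_trans (size_scale_leq _ _) _.
  case: (eqVneq W0 0) => [->|Wn]; first by rewrite size_poly0.
  have := size_polyD V (- U); rewrite size_polyN hW0 size_mulX // maxnC.
  by case: (maxn _ _).
- move=> /eqP; rewrite scaler_eq0 invr_eq0 (negPf gC) /= => /eqP W00.
  by apply/eqP; rewrite -subr_eq0 hW0 W00 mul0r.
Qed.

Lemma germ_ratio_zero m U V : germ_ratio m U V -> U = 0 -> V = 0.
Proof.
move=> [d d0 hd] U0.
have [|e e0 he] := ana_near_neq0 (ana_gaussF a b hc m (@slit0 R)); first by rewrite gaussF_at0 // oner_eq0.
have m0 : 0 < Num.min d e by rewrite lt_min d0.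
have mh : Num.min d e / 2 < Num.min d e by rewrite ltr_pdivrMr // ltr_pMr // ltr1n.
apply: (@poly_flat0 _ (Num.min d e / 2)); first by rewrite divr_gt0.
move=> h hh; have : mo h < Num.min d e by apply: le_lt_trans hh mh.
rewrite lt_min => /andP[h1 h2]; have := hd h h1; rewrite U0 horner0 mulr0 => /esym/eqP.
by rewrite mulf_eq0; have := he h h2; rewrite add0r => /negPf -> /eqP.
Qed.

(** Each step divides by z. The sizes of two consecutive polynomials cannot
    decrease forever unless all of them vanish. *)
Lemma germ_ratio_descent N m U V : (forall k, gd k != 0) ->
  (size U <= N)%N -> (size V <= N)%N -> germ_ratio m U V -> U = 0.
Proof.
move=> g0; elim: N m U V => [|N IH] m U V hU hV hr.
  by apply/eqP; rewrite -size_poly_eq0 -leqn0.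
have [W [hr2 sW W0]] := germ_ratio_step (g0 m) hr.
have [X [hr3 sX X0]] := germ_ratio_step (g0 m.+1) hr2.
have sW' : (size W <= N)%N.
  apply: leq_trans sW _; have : (maxn (size U) (size V) <= N.+1)%N by rewrite geq_max hU.
  by case: (maxn _ _).
have sX' : (size X <= N)%N.
  apply: leq_trans sX _; have : (maxn (size V) (size W) <= N.+1)%N by rewrite geq_max hV leqW.
  by case: (maxn _ _).
have Wz := IH _ _ _ sW' sX' hr3.
have Xz := germ_ratio_zero hr3 Wz.
by rewrite -(W0 Wz) -(X0 Xz).
Qed.

Lemma not_rational : (forall k, gd k != 0) -> ~ rational_function (R011 a b c).
Proof.
move=> g0 [d [p [q [q0 _ _ hf]]]].
suff : germ_ratio 0 q p by move=> /(germ_ratio_descent g0 (leq_maxl _ _) (leq_maxr _ _)) /eqP; rewrite (negPf q0).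
have [|e e0 he] := ana_near_neq0 (ana_gaussF a b hc 0 (@slit0 R)); first by rewrite gaussF_at0 // oner_eq0.
have [[r r0 hr]|[l [g [ag gn [r r0 hr]]]]] := ana_dichotomy (ana_horner q 0).
  by move: q0; rewrite (@poly_flat0 q r) ?eqxx // => h /hr; rewrite add0r.
have [r' r'0 hr'] := ana_near_neq0 ag gn.
pose d' := Num.min (Num.min e 1) (Num.min r r').
have d'0 : 0 < d' by rewrite !lt_min e0 ltr01 r0.
exists d' => // z hz; apply/eqP; rewrite -subr_eq0; apply/eqP; move: z hz.
apply: (@punctured_zero (fun z => P 1 z * q.[z] - P 0 z * p.[z]) _ d'0).
  apply: anaB; apply: anaM; try exact: ana_horner; apply: ana_gaussF => //; exact: slit0.
move=> h hn; rewrite !lt_min => /andP[/andP[h1 h2] /andP[h3 h4]].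
have P0 : P 0 h != 0 by have := he h h1; rewrite add0r.
have qh : q.[h] != 0.
  have := hr h (ltW h3); rewrite add0r => ->; rewrite mulf_neq0 ?expf_neq0 //.
  by have := hr' h h4; rewrite add0r.
have := hf h (disc_slit h2) qh; rewrite R011E => E.
have : P 1 h = p.[h] / q.[h] * P 0 h by rewrite -E mulfVK.
by move=> ->; rewrite mulrAC mulfVK // mulrC subrr.
Qed.

Lemma hyp2F1_par0 (x y u : R) : (forall n : nat, - u != n%:R) -> x = 0 -> forall z, slit_plane z ->
  hyp2F1 x y u z = 1.
Proof.
move=> hu -> z hz; move: z hz.
apply: (@identity_star2 _ (@slit_plane R)); first exact: slit_plane_star.
- by move=> z; apply: ana_hyp2F1.
- by move=> z _; apply: ana_cst.
exists 1 => // h hh; rewrite hyp2F1_hsum // /hsum; apply: psum_tends.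
apply: (@tends_eventually _ _ _ 1) => -[|n] // _.
rewrite big_ord_recl big1 ?addr0 ?expr0 ?mulr1 /cseq ?hcoef_0 ?rmorph1 // => i _.
by rewrite /cseq /hcoef lift0 pochSl !mul0r.
Qed.

Lemma hcoef_binom (x u : R) n : (forall n : nat, - u != n%:R) -> hcoef x u u n = binom_coef x n.
Proof.
move=> hu; rewrite /hcoef /binom_coef invfM mulrA mulfK //; exact: poch_c_neq0.
Qed.

(** F(x,u;u;z) is a power of 1 - z, hence has the power of opposite exponent as its
    inverse. *)
Lemma hyp2F1_power_neq0 (x u : R) z : (forall n : nat, - u != n%:R) -> slit_plane z ->
  hyp2F1 x u u z != 0.
Proof.
move=> hu hz; suff E : hyp2F1 x u u z * hyp2F1 (- x) u u z = 1.
  by apply/eqP => h; move: E; rewrite h mul0r => /eqP; rewrite eq_sym oner_eq0.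
move: z hz; apply: (@identity_star2 _ (@slit_plane R)); first exact: slit_plane_star.
- by move=> z hz; apply: anaM; apply: ana_hyp2F1.
- by move=> z _; apply: ana_cst.
have [r0 r1] : 0 < 1 / 2 :> R /\ 1 / 2 < 1 :> R by split; lra.
exists (1 / 2) => // h hh; have h1 : mo h < 1 by lra.
rewrite !hyp2F1_hsum //.
have [B hB] := hsum_pser x u hu r0 r1; have [B' hB'] := hsum_pser (- x) u hu r0 r1.
have hm := pser_mul_coef r0 hB hB'.
apply: tends_unique (hm.2 h (ltW hh)) _.
apply: (@tends_eventually _ _ _ 1) => -[|n] // _.
have E k : \sum_(i < k.+1) cseq (hcoef x u u) i * cseq (hcoef (- x) u u) (k - i) = ofR (binom_coef 0 k) :> C.
  rewrite -(subrr x) -binom_coef_conv rmorph_sum; apply: eq_bigr => i _.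
  by rewrite /cseq !hcoef_binom // rmorphM.
under eq_bigr do rewrite E.
rewrite big_ord_recl big1 ?addr0 ?expr0 ?mulr1 /binom_coef ?poch0 ?fact0 ?divr1 ?rmorph1 // => i _.
by rewrite lift0 pochSl mul0r mul0r rmorph0 mul0r.
Qed.

Variable s : nat.
Hypotheses (gs : gd s = 0) (gk : forall k, (k < s)%N -> gd k != 0).

(** The numerator of d_s vanishes when the first parameter of F_s is zero or the
    second one equals the third: F_s is then 1 or a power of 1 - z. *)
Lemma gaussF_last_neq0 z : slit_plane z -> P s z != 0.
Proof.
move=> hz; have := gaussd_eq0 a b hc s; rewrite gs eqxx => /esym; rewrite /numg mulf_eq0 => /orP[/eqP A0|].
  by rewrite /gaussF (hyp2F1_par0 _ (c_shift_admissible hc s) A0 hz) oner_eq0.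
rewrite subr_eq0 => /eqP B0; rewrite /gaussF -B0; apply: hyp2F1_power_neq0 hz; exact: c_shift_admissible.
Qed.

(** Backward recursion for F_(s-i) and F_(s-i+1) as polynomial multiples of F_s. It
    starts from F_s = F_(s+1), which is Gauss's relation at d_s = 0. *)
Fixpoint pq i : {poly C} * {poly C} :=
  if i is i'.+1 then ((pq i').1 - ofR (gd (s - i'.+1)) *: ('X * (pq i').2), (pq i').1) else (1, 1).

Lemma pq_P i z : (i <= s)%N -> slit_plane z ->
  P (s - i) z = (pq i).1.[z] * P s z /\ P (s - i).+1 z = (pq i).2.[z] * P s z.
Proof.
move=> + hz; elim: i => [_|i IH si].
  rewrite subn0 /= hornerC !mul1r; split=> //.
  by rewrite [in RHS](gaussF_contiguous _ _ hc s hz) gs rmorph0 mul0r subr0.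
have [h1 h2] := IH (ltnW si).
have e : ((s - i.+1).+1 = s - i)%N by rewrite subnSK.
rewrite e; split; last exact: h1.
rewrite (gaussF_contiguous _ _ hc _ hz) e h1 h2 /= hornerD hornerN hornerZ hornerM hornerX; ring.
Qed.

Lemma pq_at0 i : (pq i).1.[0] = 1 /\ (pq i).2.[0] = 1.
Proof.
elim: i => [|i [h1 h2]] /=; first by rewrite hornerC.
by rewrite hornerD hornerN hornerZ hornerM hornerX mul0r mulr0 subr0.
Qed.

(** The recursion carries a common root back to the constant pair; it cannot be the
    origin, where both polynomials are 1. *)
Lemma pq_no_common_root i z : (i <= s)%N -> (pq i).1.[z] = 0 -> (pq i).2.[z] = 0 -> False.
Proof.
elim: i => [_|i IH si] /=; first by rewrite hornerC => /eqP; rewrite oner_eq0.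
rewrite hornerD hornerN hornerZ hornerM hornerX => h1 h2; apply: (IH (ltnW si)) => //.
move/eqP: h1; rewrite h2 sub0r oppr_eq0 !mulf_eq0 => /or3P[|/eqP z0|/eqP] //.
  rewrite -(rmorph0 (@ofR R)) (inj_eq (@ofR_inj R)) (negPf (gk _)) //.
  by rewrite ltn_subrL /= (leq_trans _ si).
by move: h2; rewrite z0 (pq_at0 i).1 => /eqP; rewrite oner_eq0.
Qed.

Lemma pq_size i : (i <= s)%N ->
  [/\ (size (pq i).1 <= i.+1./2.+1)%N, (size (pq i).2 <= i./2.+1)%N
    & if odd i then size (pq i).1 = i.+1./2.+1 else size (pq i).2 = i./2.+1].
Proof.
elim: i => [_|i IH si]; first by rewrite /= !size_poly1.
have [h1 h2 h3] := IH (ltnW si).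
have gn : ofR (gd (s - i.+1)) != 0.
  rewrite -(rmorph0 (@ofR R)) (inj_eq (@ofR_inj R)) gk //.
  by rewrite ltn_subrL /= (leq_trans _ si).
have y0 : (pq i).2 != 0.
  by apply/eqP => h; have := (pq_at0 i).2; rewrite h horner0 => /eqP; rewrite eq_sym oner_eq0.
have sX : size (ofR (gd (s - i.+1)) *: ('X * (pq i).2)) = (size (pq i).2).+1.
  by rewrite size_scale // mulrC size_mulX.
have sD := size_polyD (pq i).1 (- (ofR (gd (s - i.+1)) *: ('X * (pq i).2))).
rewrite size_polyN sX in sD.
move: h1 h2 h3 sD; rewrite /= !uphalf_half; case: (odd i) => h1 h2 h3 sD; split; try lia.
  exact: h3.
by rewrite /= addrC size_polyDl size_polyN sX h3 //; lia.
Qed.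

Lemma R011_poly z : slit_plane z -> (pq s).1.[z] != 0 -> R011 a b c z = (pq s).2.[z] / (pq s).1.[z].
Proof.
move=> hz hx; have [h1 h2] := pq_P (leqnn s) hz; rewrite subnn in h1 h2.
have Pn := gaussF_last_neq0 hz; rewrite R011E h1 h2 invfM mulrACA divff // mulr1 //.
Qed.

Lemma pq1_neq0 : (pq s).1 != 0.
Proof. by apply/eqP => h; have := (pq_at0 s).1; rewrite h horner0 => /eqP; rewrite eq_sym oner_eq0. Qed.

Lemma R011_degree : rational_of_degree ((s + 1) %/ 2) (R011 a b c).
Proof.
have [h1 h2 h3] := pq_size (leqnn s).
exists (pq s).2, (pq s).1; split; first exact: pq1_neq0.
- apply: Pdiv.ClosedField.root_coprimep => x /eqP hx; apply/eqP => hy.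
  exact: pq_no_common_root (leqnn s) hy hx.
- move: h1 h2 h3; move: (size _) (size _) => n1 n2; rewrite divn2 addn1.
  have := odd_double_half s; have := odd_double_half s.+1; rewrite /= .
  by case: (odd s) => /= *; lia.
- by move=> z; apply: R011_poly.
Qed.

Lemma zR011_degree : rational_of_degree ((s + 2) %/ 2) (fun z => z * R011 a b c z).
Proof.
have [h1 h2 h3] := pq_size (leqnn s).
have y0 : (pq s).2 != 0.
  by apply/eqP => h; have := (pq_at0 s).2; rewrite h horner0 => /eqP; rewrite eq_sym oner_eq0.
exists ('X * (pq s).2), (pq s).1; split; first exact: pq1_neq0.
- apply: Pdiv.ClosedField.root_coprimep => x; rewrite rootM => /orP[].
    by rewrite /root hornerX => /eqP ->; rewrite (pq_at0 s).1 oner_eq0.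
  move=> /eqP hx; apply/eqP => hy; exact: pq_no_common_root (leqnn s) hy hx.
- rewrite mulrC size_mulX //.
  move: h1 h2 h3; move: (size _) (size _) => n1 n2; rewrite divn2 addn2.
  have := odd_double_half s; have := odd_double_half s.+1; rewrite /= .
  by case: (odd s) => /= *; lia.
- by move=> z hz hq; rewrite R011_poly // hornerM hornerX mulrA.
Qed.

End Rational.

(** * The terminating case and the theorem *)

Section Minima.
Variable R : realType.

Lemma ereal_inf_nat_ge (p : pred nat) N : (forall n, p n -> (N <= n)%N) ->
  (N%:R%:E <= ereal_inf [set n%:R%:E | n in [set n : nat | p n]] :> \bar R)%E.
Proof. by move=> h; apply: le_ereal_inf_tmp => _ [n pn <-]; rewrite lee_fin ler_nat h. Qed.

Lemma ereal_inf_nat_min (p : pred nat) m : p m -> (forall n, p n -> (m <= n)%N) ->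
  ereal_inf [set n%:R%:E | n in [set n : nat | p n]] = m%:R%:E :> \bar R.
Proof.
move=> pm h; apply/eqP; rewrite eq_le ereal_inf_nat_ge // andbT.
by apply: ereal_inf_lbound; exists m.
Qed.

End Minima.

Section Terminating.
Variable R : realType.
Local Notation C := (Cx R).
Variables (a b c : R).
Hypothesis hc : forall n : nat, - c != n%:R.
Local Notation gd := (gaussd a b c).
Local Notation Dp := (gaussD a b c).
Local Notation P := (gaussF a b c).

Lemma R011_scaledE e : (fun z : C => ofR e * R011 a b c z) = (fun z => ofR e * (P 1 z / P 0 z)).
Proof. by apply/funext => z; rewrite R011E. Qed.

Lemma nevanlinna2_R011 e lk ll :
  negset (fun j => e * Dp 0 (2 * j + 1)) lk -> negset (fun j => e * Dp 0 (2 * j)) ll ->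
  nevanlinna2 (size lk) (size ll) (fun z : C => ofR e * R011 a b c z).
Proof.
move=> hk hl; rewrite R011_scaledE; split; [exact: nevanlinna_P|exact: nevanlinna_zP].
Qed.

Lemma s2_set : [set n : nat | (0 < n)%N /\ (n%:R : R) \in [:: - b; a - c]] =
  [set n | (0 < n)%N && (n%:R \in [:: - b; a - c])].
Proof. by apply/seteqP; split => n /=; [case=> -> ->|move=> /andP[]]. Qed.

Lemma s2_of_ge1 : (1%:R%:E <= s2_of a b c)%E.
Proof.
by rewrite /s2_of s2_set; apply: (@ereal_inf_nat_ge R (fun n => (0 < n)%N && _) _) => n /andP[].
Qed.

Variable s : nat.
Hypotheses (gs : gd s = 0) (gk : forall k, (k < s)%N -> gd k != 0).

Let gd0_ge n : gd n == 0 -> (s <= n)%N.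
Proof. by move=> h; rewrite leqNgt; apply/negP => /gk; rewrite h. Qed.

(** Even zeros of d correspond to the set defining s_1 and odd ones to that defining
    s_2; the first zero is twice the first minimum or twice the second minus one,
    whichever is smaller. *)
Lemma s_ofE : s_of a b c = s%:R%:E.
Proof.
have [m [sm|sm]] := nat_half_cases s; rewrite /s_of.
  have -> : s1_of a b c = m%:R%:E.
    apply: (@ereal_inf_nat_min R (fun n => n%:R \in [:: - a; b - c]) _).
      by rewrite -gaussd_even_eq0 // -sm gs.
    by move=> n; rewrite -gaussd_even_eq0 // => /gd0_ge; lia.
  have : (m.+1%:R%:E <= s2_of a b c)%E.
    rewrite /s2_of s2_set; apply: (@ereal_inf_nat_ge R (fun n => (0 < n)%N && (n%:R \in [:: - b; a - c])) _).
    by case=> // n; rewrite -gaussd_odd_eq0 //= => /gd0_ge; lia.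
  have e : (2%:E * m%:R%:E)%E = s%:R%:E :> \bar R by rewrite -EFinM sm natrM.
  rewrite e => h; apply/min_idPl; move: h; case: (s2_of a b c) => [r| |] //=.
    rewrite -EFinM -EFinB !lee_fin sm natrM -natr1; lra.
  by move=> _; rewrite gt0_muley ?lte_fin // ?addye // leey.
have -> : s2_of a b c = m.+1%:R%:E.
  rewrite /s2_of s2_set.
  apply: (@ereal_inf_nat_min R (fun n => (0 < n)%N && (n%:R \in [:: - b; a - c])) _).
    by rewrite /= -gaussd_odd_eq0 // -sm gs.
  by case=> // n; rewrite -gaussd_odd_eq0 //= => /gd0_ge; lia.
have : (m.+1%:R%:E <= s1_of a b c)%E.
  apply: (@ereal_inf_nat_ge R (fun n => n%:R \in [:: - a; b - c]) _).
  by move=> n; rewrite -gaussd_even_eq0 // => /gd0_ge; lia.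
have e : (2%:E * m.+1%:R%:E - 1%:E)%E = s%:R%:E :> \bar R.
  by rewrite -EFinM -EFinB sm -natrM mulnS -[in RHS]addn1 2!natrD; congr (_%:E); ring.
rewrite e => h; apply/min_idPr; move: h; case: (s1_of a b c) => [r| |] //=.
  by rewrite -EFinM !lee_fin sm -!natr1 natrM; lra.
by move=> _; rewrite gt0_muley ?lte_fin // leey.
Qed.

Let D_neq0 i : (i <= s)%N -> Dp 0 i != 0.
Proof.
by move=> h; apply/prodf_neq0 => k _; rewrite add0n gk // (leq_trans (ltn_ord k)).
Qed.

Let D_eq0 i : (s < i)%N -> Dp 0 i = 0.
Proof. by move=> h; rewrite /gaussD (bigD1 (Ordinal h)) //= add0n gs mul0r. Qed.

Local Notation eps := (Num.sg (Dp 0 s)).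

Lemma eps_pm : eps = 1 \/ eps = - 1.
Proof. by have := D_neq0 (leqnn s); case: sgrP => //; [left|right]. Qed.

Let eps_sign i : (i <= s)%N -> (eps * Dp 0 i < 0) = (Num.sg (Dp i (s - i)) < 0).
Proof.
move=> h; rewrite -sgr_lt0 (gaussD_split a b c h).
have := D_neq0 h; move: (Dp 0 i) (Dp i _) => x y x0.
have -> : Num.sg (Num.sg (x * y) * x) = Num.sg y; last by [].
rewrite !sgrM sgr_id sgr_id mulrAC; have -> : Num.sg x * Num.sg x = 1; last by rewrite mul1r.
by rewrite -expr2 sqr_sg x0.
Qed.

Local Notation K := ((s + 1) %/ 2)%N.
Local Notation L := ((s + 2) %/ 2)%N.
Local Notation kap := (count (fun j => eps * Dp 0 (2 * j + 1) < 0) (iota 0 K)).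
Local Notation lam := (count (fun j => eps * Dp 0 (2 * j) < 0) (iota 0 L)).

Lemma terminating_index e :
  nevanlinna2 (count (fun j => e * Dp 0 (2 * j + 1) < 0) (iota 0 K))
    (count (fun j => e * Dp 0 (2 * j) < 0) (iota 0 L)) (fun z : C => ofR e * R011 a b c z).
Proof.
rewrite -!size_filter; apply: nevanlinna2_R011.
  by apply: negset_filter => j h; rewrite D_eq0 ?mulr0 //; lia.
by apply: negset_filter => j h; rewrite D_eq0 ?mulr0 //; lia.
Qed.

Lemma count_compl (p q : pred nat) n : (forall j, (j < n)%N -> q j = ~~ p j) ->
  count q (iota 0 n) = (n - count p (iota 0 n))%N.
Proof.
move=> h; rewrite -{2}(size_iota 0 n) -(count_predC p) addKn.
by apply: eq_in_count => j; rewrite mem_iota => /andP[_ /h].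
Qed.

(** The signs up to index s are nonzero and are all reversed by the opposite factor;
    beyond s the products vanish and do not count. *)
Lemma terminating_index_opp : nevanlinna2 (K - kap) (L - lam) (fun z : C => ofR (- eps) * R011 a b c z).
Proof.
have flip i : (i <= s)%N -> (- eps * Dp 0 i < 0) = ~~ (eps * Dp 0 i < 0).
  move=> h; rewrite mulNr oppr_lt0 -leNgt lt_neqAle eq_sym mulf_eq0 (negPf (D_neq0 h)) orbF.
  by rewrite sgr_eq0 (negPf (D_neq0 (leqnn s))).
rewrite -(count_compl (q := fun j => - eps * Dp 0 (2 * j + 1) < 0)); last first.
  by move=> j h; apply: flip; lia.
rewrite -(count_compl (q := fun j => - eps * Dp 0 (2 * j) < 0)); last first.
  by move=> j h; apply: flip; lia.
exact: terminating_index.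
Qed.

(** The sign of index s is positive for the chosen eps. It is the term by which the
    counts below exceed the sequences of the statement. *)
Let top_sign : (eps * Dp 0 s < 0) = false.
Proof. by rewrite eps_sign // subnn /gaussD big_ord0 sgr1 ltr10. Qed.

Lemma count_iota_recr (p : pred nat) n : p n = false -> count p (iota 0 n.+1) = count p (iota 0 n).
Proof. by move=> pn; rewrite -addn1 iotaD count_cat /= add0n pn !addn0. Qed.

Lemma terminating_signs_even s1 : s = (2 * s1)%N ->
  ((0 < s1)%N ->
     [/\ eps = epsB1 a b c s1 0 0,
         lam = count (fun j => epsB1 a b c s1 j 0 < 0) (iota 0 s1)
       & kap = count (fun j => epsB1 a b c s1 j 1 < 0) (iota 0 s1)]) /\
  (s1 = 0%N -> [/\ lam = 0%N, kap = 0%N & eps = 1]).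
Proof.
move=> E.
have hK : K = s1 by lia.
have hL : L = s1.+1 by lia.
have hlam : lam = count (fun j => epsB1 a b c s1 j 0 < 0) (iota 0 s1).
  rewrite hL count_iota_recr; last by rewrite -E top_sign.
  apply: eq_in_count => j; rewrite mem_iota add0n => /= h.
  by rewrite eps_sign ?epsB1_0 -?E //; lia.
have hkap : kap = count (fun j => epsB1 a b c s1 j 1 < 0) (iota 0 s1).
  rewrite hK; apply: eq_in_count => j; rewrite mem_iota add0n => /= h.
  by rewrite addn1 eps_sign ?epsB1_1 -?E //; lia.
split=> [s10|s10].
  by split=> //; rewrite epsB1_0 // muln0 subn0 E.
by rewrite hlam hkap s10; split=> //; rewrite E s10 /gaussD big_ord0 sgr1.
Qed.

Lemma terminating_signs_odd s2 : (0 < s2)%N -> s = (2 * s2 - 1)%N ->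
  [/\ eps = epsB2 a b c s2 0 1,
      ((1 < s2)%N ->
         lam = count (fun j => epsB2 a b c s2 j 1 < 0) (iota 0 s2) /\
         kap = count (fun j => epsB2 a b c s2 j 0 < 0) (iota 1 s2.-1))
    & (s2 = 1%N -> lam%:R = 1 / 2 - eps / 2 :> R /\ kap = 0%N)].
Proof.
move=> s20 E.
have hK : K = s2.-1.+1 by lia.
have hL : L = s2 by lia.
have hkap : kap = count (fun j => epsB2 a b c s2 j 0 < 0) (iota 1 s2.-1).
  rewrite hK count_iota_recr; last by rewrite (_ : (2 * s2.-1 + 1)%N = s) ?top_sign //; lia.
  rewrite (iotaDl 1 0) count_map; apply: eq_in_count => j; rewrite mem_iota add0n => /= h.
  by rewrite addn1 add1n eps_sign ?epsB2_0 -?E //; lia.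
split=> [|s21|s21].
- by rewrite epsB2_1 // muln0 subn0 -E.
- split=> //; rewrite hL; apply: eq_in_count => j; rewrite mem_iota add0n => /= h.
  by rewrite eps_sign ?epsB2_1 -?E //; lia.
- split; last by rewrite hkap s21.
  rewrite hL s21 /= [X in _ * X]/gaussD big_ord0 mulr1 addn0.
  by case: eps_pm => ->; rewrite ?ltr10 ?ltrN10 /=; lra.
Qed.

End Terminating.

Local Open Scope card_scope.

Theorem theorem3p4 (R : realType) (a b c : R)
    (hc : forall n : nat, - c != n%:R) :
  [/\ (exists (kappa lambda : nat) (eps : R),
         (eps = 1 \/ eps = -1) /\
         nevanlinna2 kappa lambda (fun z => ofR eps * R011 a b c z)),
      (~ rational_case a b c ->
         ~ rational_function (R011 a b c) /\
         exists kappa lambda : nat,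
           [/\ [set j : nat | theta_sign a b c j < 0] #= `I_lambda,
               [set j : nat | (1 <= j)%N /\ eta_sign a b c j < 0] #= `I_kappa,
               (theta_sign a b c 0 = 1 \/ theta_sign a b c 0 = -1)
             & nevanlinna2 kappa lambda
                 (fun z => ofR (theta_sign a b c 0) * R011 a b c z)])
    & (rational_case a b c ->
         exists (s K Lambda kappa lambda : nat) (eps : R),
           [/\ [/\ s_of a b c = s%:R%:E, K = (s + 1) %/ 2 & Lambda = (s + 2) %/ 2]%N,
               [/\ rational_of_degree K (R011 a b c)
                 & rational_of_degree Lambda (fun z => z * R011 a b c z)],
               [/\ (eps = 1 \/ eps = -1), (kappa <= K)%N, (lambda <= Lambda)%N,
                   nevanlinna2 kappa lambda (fun z => ofR eps * R011 a b c z)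
                 & nevanlinna2 (K - kappa) (Lambda - lambda)
                     (fun z => ofR (- eps) * R011 a b c z)],
               (forall s1 : nat, s1_of a b c = s1%:R%:E -> s = (2 * s1)%N ->
                  ((0 < s1)%N ->
                     [/\ eps = epsB1 a b c s1 0 0,
                         lambda = count (fun j => epsB1 a b c s1 j 0 < 0) (iota 0 s1)
                       & kappa = count (fun j => epsB1 a b c s1 j 1 < 0) (iota 0 s1)]) /\
                  (s1 = 0%N -> [/\ lambda = 0%N, kappa = 0%N & eps = 1]))
             & (forall s2 : nat, s2_of a b c = s2%:R%:E -> s = (2 * s2 - 1)%N ->
                  [/\ eps = epsB2 a b c s2 0 1,
                      ((1 < s2)%N ->
                         lambda = count (fun j => epsB2 a b c s2 j 1 < 0) (iota 0 s2) /\
                         kappa = count (fun j => epsB2 a b c s2 j 0 < 0) (iota 1 s2.-1))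
                    & (s2 = 1%N ->
                         lambda%:R = 1 / 2 - eps / 2 :> R /\ kappa = 0%N)])])].
Proof.
have A : ~ rational_case a b c ->
    ~ rational_function (R011 a b c) /\
    exists kappa lambda : nat,
      [/\ [set j : nat | theta_sign a b c j < 0] #= `I_lambda,
          [set j : nat | (1 <= j)%N /\ eta_sign a b c j < 0] #= `I_kappa,
          (theta_sign a b c 0 = 1 \/ theta_sign a b c 0 = -1)
        & nevanlinna2 kappa lambda (fun z => ofR (theta_sign a b c 0) * R011 a b c z)].
  move=> nonrat; split; first by apply: not_rational => // k; exact: gaussd_neq0.
  have [lk [ll [hl hk cl ck]]] := nonterminating_negsets hc nonrat.
  exists (size lk), (size ll); split=> //; first exact: theta0_pm.
  exact: nevanlinna2_R011.
have B : rational_case a b c -> exists2 s, gaussd a b c s = 0 & forall k, (k < s)%N -> gaussd a b c k != 0.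
  move=> /(rational_caseP a b hc) ex; case: (ex_minnP ex) => s /eqP gs smin; exists s => // k.
  by rewrite ltnNge; apply: contraNneq => /eqP /smin.
split; [|exact: A|].
  have [/B [s gs gk]|/A] := pselect (rational_case a b c); last first.
    by move=> [_ [kappa [lambda [_ _ e0 h]]]]; exists kappa, lambda, (theta_sign a b c 0).
  exists (count (fun j => Num.sg (gaussD a b c 0 s) * gaussD a b c 0 (2 * j + 1) < 0) (iota 0 ((s + 1) %/ 2))).
  exists (count (fun j => Num.sg (gaussD a b c 0 s) * gaussD a b c 0 (2 * j) < 0) (iota 0 ((s + 2) %/ 2))).
  by exists (Num.sg (gaussD a b c 0 s)); split; [exact: eps_pm|exact: terminating_index].
move=> /B [s gs gk]; exists s, ((s + 1) %/ 2)%N, ((s + 2) %/ 2)%N.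
exists (count (fun j => Num.sg (gaussD a b c 0 s) * gaussD a b c 0 (2 * j + 1) < 0) (iota 0 ((s + 1) %/ 2))).
exists (count (fun j => Num.sg (gaussD a b c 0 s) * gaussD a b c 0 (2 * j) < 0) (iota 0 ((s + 2) %/ 2))).
exists (Num.sg (gaussD a b c 0 s)); split.
- by split=> //; exact: s_ofE.
- by split; [exact: R011_degree|exact: zR011_degree].
- split; [exact: eps_pm| | |exact: terminating_index|exact: terminating_index_opp].
    by rewrite -{2}(size_iota 0 ((s + 1) %/ 2)) count_size.
  by rewrite -{2}(size_iota 0 ((s + 2) %/ 2)) count_size.
- by move=> s1 _; exact: terminating_signs_even.
- move=> s2 hs2; apply: terminating_signs_odd => //.
  by have := s2_of_ge1 a b c; rewrite hs2 lee_fin ler_nat.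
Qed.
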